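(* Let $K$ be a field with $\mathrm{char}\,K\neq 2$ and let $\mathbb{G}$ be an affine supergroup over $K$ with unipotent radical $\mathbb{G}_u$. The quotient morphism $\mathbb{G} \to \mathbb{G}/\mathbb{G}_u$ splits (i.e. has a section that is a morphism of affine supergroups) if either (a) (i) $\mathrm{char}\, K=0$, and (ii) $\mathbb{G}/\mathbb{G}_u$ is linearly reductive; or (b) (i) $K$ is an algebraically closed field of $\mathrm{char}\, K > 2$, and (ii) $\mathbb{G}/\mathbb{G}_u$ is purely even and diagonalizable.
   Context: ''Super'' means $\mathbb{Z}_2$-graded. $\mathsf{SAlg}_K$ is the category of super-commutative superalgebras over $K$. An affine supergroup $\mathbb{G}$ is a representable group-valued functor on $\mathsf{SAlg}_K$, represented by a super-commutative Hopf superalgebra $K[\mathbb{G}]$ (not assumed finitely generated). It is purely even if $K[\mathbb{G}]$ has zero odd component, i.e. it is an affine group scheme. A purely even $\mathbb{G}$ is diagonalizable if $K[\mathbb{G}]$ is spanned by grouplike elements. Closed super-subgroups correspond to quotient Hopf superalgebras of $K[\mathbb{G}]$. For a normal closed super-subgroup $\mathbb{N}$, $\mathbb{G}/\mathbb{N}$ is represented by the unique Hopf super-subalgebra $B\subset K[\mathbb{G}]$ with $K[\mathbb{G}]/B^+K[\mathbb{G}]=K[\mathbb{N}]$, $B^+=\mathrm{Ker}\,\varepsilon_B$. A left $\mathbb{G}$-supermodule is a right $K[\mathbb{G}]$-super-comodule. $\mathbb{G}$ is linearly reductive if the category of $\mathbb{G}$-supermodules is semisimple; equivalently, the coalgebra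 $K[\mathbb{G}]$ is cosemisimple. $\mathbb{G}$ is unipotent if its only simple supermodules are the trivial one-dimensional ones (in either parity); equivalently, the coradical of $K[\mathbb{G}]$ is $K$. The unipotent radical $\mathbb{G}_u$ is the largest unipotent normal closed super-subgroup of $\mathbb{G}$. *)

(* Defs.v *)
From HB Require Import structures.
From mathcomp Require Import all_boot all_algebra generic_quotient.
From mathcomp Require Import boolp classical_sets.

Set Implicit Arguments.
Unset Strict Implicit.
Unset Printing Implicit Defensive.

Import GRing.Theory.
Local Open Scope ring_scope.
Local Open Scope quotient_scope.

(* The tensor product of K-vector spaces, possibly of infinite dimension.
   A formal sum of pure tensors is a list of pairs; two formal sums are
   identified when every bilinear map takes the same value on them.  The
   universal property is [tlift_linear], [tlift_tens] and [tensor_ind]. *)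
Section Tensor.
Variables (K : fieldType) (V W : lmodType K).

Definition bilin (U : lmodType K) (f : V -> W -> U) : Prop :=
  (forall w, linear (f^~ w)) /\ (forall v, linear (f v)).

Definition tsum (U : lmodType K) (f : V -> W -> U) (s : seq (V * W)) : U :=
  \sum_(p <- s) f p.1 p.2.

Definition tensor_rel (s t : seq (V * W)) : Prop :=
  forall (U : lmodType K) (f : V -> W -> U), bilin f -> tsum f s = tsum f t.

Definition tensor_eqb (s t : seq (V * W)) : bool := `[< tensor_rel s t >].

Lemma tensor_eqb_refl : reflexive tensor_eqb.
Proof. by move=> s; apply/asboolP. Qed.

Lemma tensor_eqb_sym : symmetric tensor_eqb.
Proof.
by move=> s t; apply/asboolP/asboolP => st U f hf; rewrite st.
Qed.

Lemma tensor_eqb_trans : transitive tensor_eqb.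
Proof.
move=> t s u /asboolP st /asboolP tu; apply/asboolP => U f hf.
by rewrite st // tu.
Qed.

Canonical tensor_equiv :=
  EquivRel tensor_eqb tensor_eqb_refl tensor_eqb_sym tensor_eqb_trans.

Definition tensor := {eq_quot tensor_equiv}.

HB.instance Definition _ := Choice.on tensor.

Definition tens (v : V) (w : W) : tensor := \pi_tensor [:: (v, w)].

(* The linear map induced by f, meaningful when f is bilinear. *)
Definition tlift (U : lmodType K) (f : V -> W -> U) (x : tensor) : U :=
  tsum f (repr x).

Lemma tensor_piE s t : tensor_rel s t -> \pi_tensor s = \pi_tensor t.
Proof. by move=> st; apply/(@eqmodP _ tensor_equiv)/asboolP. Qed.

Lemma repr_rel s : tensor_rel (repr (\pi_tensor s)) s.
Proof. by apply/asboolP/(@eqmodP _ tensor_equiv); rewrite reprK. Qed.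

Lemma tlift_pi (U : lmodType K) (f : V -> W -> U) s :
  bilin f -> tlift f (\pi_tensor s) = tsum f s.
Proof. by move=> hf; apply: repr_rel. Qed.

Lemma tensorP (x y : tensor) :
  (forall (U : lmodType K) (f : V -> W -> U), bilin f ->
    tlift f x = tlift f y) -> x = y.
Proof.
by move=> h; rewrite -[x]reprK -[y]reprK; apply: tensor_piE => U f /h.
Qed.

Definition tscale_seq (a : K) (s : seq (V * W)) : seq (V * W) :=
  [seq (a *: p.1, p.2) | p <- s].

Lemma bilinZl (U : lmodType K) (f : V -> W -> U) : bilin f ->
  forall a v w, f (a *: v) w = a *: f v w.
Proof.
case=> hl _ a v w; have f0 : f 0 w = 0.
  by have := hl w (-1) 0 0; rewrite /= scaler0 addr0 scaleN1r addNr.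
by have := hl w a v 0; rewrite /= f0 !addr0.
Qed.

Lemma tsum_scale (U : lmodType K) (f : V -> W -> U) a s : bilin f ->
  tsum f (tscale_seq a s) = a *: tsum f s.
Proof.
move=> hf; rewrite /tsum big_map scaler_sumr.
by apply: eq_bigr => p _ /=; rewrite (bilinZl hf).
Qed.

Lemma tsum_cat (U : lmodType K) (f : V -> W -> U) s t :
  tsum f (s ++ t) = tsum f s + tsum f t.
Proof. exact: big_cat. Qed.

Definition tzero : tensor := \pi_tensor [::].
Definition tadd (x y : tensor) : tensor := \pi_tensor (repr x ++ repr y).
Definition tscale (a : K) (x : tensor) : tensor :=
  \pi_tensor (tscale_seq a (repr x)).
Definition topp (x : tensor) : tensor := tscale (-1) x.

Section LiftOps.
Variables (U : lmodType K) (f : V -> W -> U) (hf : bilin f).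

Lemma tlift_zero : tlift f tzero = 0.
Proof. by rewrite tlift_pi // /tsum big_nil. Qed.

Lemma tlift_add x y : tlift f (tadd x y) = tlift f x + tlift f y.
Proof. by rewrite tlift_pi // tsum_cat. Qed.

Lemma tlift_scale a x : tlift f (tscale a x) = a *: tlift f x.
Proof. by rewrite tlift_pi // tsum_scale. Qed.

Lemma tlift_opp x : tlift f (topp x) = - tlift f x.
Proof. by rewrite tlift_scale scaleN1r. Qed.
End LiftOps.

Lemma taddA : associative tadd.
Proof. by move=> x y z; apply: tensorP => U f hf; rewrite !tlift_add // addrA. Qed.

Lemma taddC : commutative tadd.
Proof. by move=> x y; apply: tensorP => U f hf; rewrite !tlift_add // addrC. Qed.

Lemma tadd0 : left_id tzero tadd.
Proof.
by move=> x; apply: tensorP => U f hf; rewrite tlift_add // tlift_zero // add0r.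
Qed.

Lemma taddN : left_inverse tzero topp tadd.
Proof.
move=> x; apply: tensorP => U f hf.
by rewrite tlift_add // tlift_opp // tlift_zero // addNr.
Qed.

HB.instance Definition _ :=
  GRing.isZmodule.Build tensor taddA taddC tadd0 taddN.

Lemma tscaleA a b x : tscale a (tscale b x) = tscale (a * b) x.
Proof. by apply: tensorP => U f hf; rewrite !tlift_scale // scalerA. Qed.

Lemma tscale1 : left_id 1 tscale.
Proof. by move=> x; apply: tensorP => U f hf; rewrite tlift_scale // scale1r. Qed.

Lemma tscaleDr : right_distributive tscale +%R.
Proof.
move=> a x y; apply: tensorP => U f hf.
by rewrite tlift_scale // !tlift_add // !tlift_scale // scalerDr.
Qed.

Lemma tscaleDl x : {morph tscale^~ x : a b / a + b}.
Proof.
move=> a b; apply: tensorP => U f hf /=.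
by rewrite tlift_add // !tlift_scale // scalerDl.
Qed.

HB.instance Definition _ :=
  GRing.Zmodule_isLmodule.Build K tensor tscaleA tscale1 tscaleDr tscaleDl.

Lemma tlift_linear (U : lmodType K) (f : V -> W -> U) :
  bilin f -> linear (tlift f).
Proof. by move=> hf a x y; rewrite tlift_add // tlift_scale. Qed.

Lemma tlift_tens (U : lmodType K) (f : V -> W -> U) v w :
  bilin f -> tlift f (tens v w) = f v w.
Proof. by move=> hf; rewrite tlift_pi // /tsum big_seq1. Qed.

Lemma tens_bilin : bilin tens.
Proof.
split=> [w a u v|v a u w]; apply: tensorP => U f hf;
  rewrite tlift_add // tlift_scale // !tlift_tens //.
  by case: hf => hf _; apply: (hf w).
by case: hf => _ hf; apply: (hf v).
Qed.

Lemma tensor_ind (x : tensor) : exists s : seq (V * W), x = tsum tens s.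
Proof.
exists (repr x); rewrite -[LHS]reprK; elim: (repr x) => [|p s IHs].
  by rewrite /tsum big_nil.
rewrite /tsum big_cons -/(tsum tens s) -IHs; apply: tensorP => U f hf.
rewrite tlift_add // tlift_tens // !tlift_pi //.
by rewrite /tsum big_cons.
Qed.
End Tensor.

Definition tmap (K : fieldType) (V W V' W' : lmodType K)
    (f : V -> V') (g : W -> W') : tensor V W -> tensor V' W' :=
  tlift (fun v w => tens (f v) (g w)).

Definition tassoc (K : fieldType) (U V W : lmodType K) :
    tensor (tensor U V) W -> tensor U (tensor V W) :=
  tlift (fun t w => tlift (fun u v => tens u (tens v w)) t).

(* A Z/2-grading V = V_0 + V_1 is given by the two projections
   hpart false : V -> V_0 and hpart true : V -> V_1. *)
HB.mixin Record isSuper (K : fieldType) V of GRing.Lmodule K V := {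
  hpart : bool -> V -> V;
  hpart_linear : forall b, linear (hpart b);
  hpartK : forall b c x,
    hpart b (hpart c x) = if b == c then hpart c x else 0;
  hpart_sum : forall x, hpart false x + hpart true x = x
}.

#[short(type="superModType")]
HB.structure Definition SuperLmodule (K : fieldType) :=
  {V of GRing.Lmodule K V & isSuper K V}.

Definition homogeneous (K : fieldType) (V : superModType K) (b : bool) (x : V)
  : Prop := hpart b x = x.

Section TensorGrading.
Variables (K : fieldType) (V W : superModType K).

(* The part of degree b is the sum of the V_i (x) W_j with i + j = b. *)
Definition thpart (b : bool) (t : tensor V W) : tensor V W :=
  tlift (fun v w => \sum_(i : bool) tens (hpart i v) (hpart (b (+) i) w)) t.

Lemma hpartD (X : superModType K) b (x y : X) :
  hpart b (x + y) = hpart b x + hpart b y.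
Proof. by have := hpart_linear b 1 x y; rewrite !scale1r. Qed.

Lemma hpart0 (X : superModType K) b : hpart b (0 : X) = 0.
Proof. by have := hpart_linear b (-1) (0 : X) 0; rewrite scaler0 addr0 scaleN1r addNr. Qed.

Lemma thpart_bilin b :
  bilin (fun (v : V) (w : W) =>
    \sum_(i : bool) tens (hpart i v) (hpart (b (+) i) w)).
Proof.
have [hl hr] := @tens_bilin K V W.
split=> [w a u v|v a u w]; rewrite /= scaler_sumr -big_split /=;
  apply: eq_bigr => i _; rewrite hpart_linear.
  by rewrite [LHS]hl.
by rewrite [LHS]hr.
Qed.

Lemma thpart_linear b : linear (thpart b).
Proof. exact/tlift_linear/thpart_bilin. Qed.

Lemma thpartD b x y : thpart b (x + y) = thpart b x + thpart b y.
Proof. by have := thpart_linear b 1 x y; rewrite !scale1r. Qed.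

Lemma thpart0 b : thpart b 0 = 0.
Proof. by have := thpart_linear b (-1) 0 0; rewrite scaler0 addr0 scaleN1r addNr. Qed.

Lemma thpart_tens b v w :
  thpart b (tens v w) = \sum_(i : bool) tens (hpart i v) (hpart (b (+) i) w).
Proof. exact/tlift_tens/thpart_bilin. Qed.

Lemma tens0l w : tens (0 : V) w = 0 :> tensor V W.
Proof.
have [hl _] := @tens_bilin K V W.
by have := hl w (-1) 0 0; rewrite /= scaler0 addr0 scaleN1r addNr.
Qed.

Lemma tens0r v : tens v (0 : W) = 0 :> tensor V W.
Proof.
have [_ hr] := @tens_bilin K V W.
by have := hr v (-1) 0 0; rewrite /= scaler0 addr0 scaleN1r addNr.
Qed.

Lemma tensDl v v' w : tens (v + v') w = tens v w + tens v' w :> tensor V W.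
Proof.
have [hl _] := @tens_bilin K V W.
by have := hl w 1 v v'; rewrite /= !scale1r.
Qed.

Lemma tensDr v w w' : tens v (w + w') = tens v w + tens v w' :> tensor V W.
Proof.
have [_ hr] := @tens_bilin K V W.
by have := hr v 1 w w'; rewrite /= !scale1r.
Qed.

Lemma thpartK b c x :
  thpart b (thpart c x) = if b == c then thpart c x else 0.
Proof.
have [s ->] := tensor_ind x; rewrite /tsum.
elim: s => [|p s IHs]; first by rewrite big_nil !thpart0 if_same.
rewrite big_cons !thpartD IHs.
suff -> : thpart b (thpart c (tens p.1 p.2)) =
          if b == c then thpart c (tens p.1 p.2) else 0.
  by case: ifP => // _; rewrite addr0.
rewrite thpart_tens !big_bool /= thpartD !thpart_tens !big_bool !hpartK.
by case: b {IHs}; case: c; rewrite /= ?tens0l ?tens0r ?addr0 ?add0r.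
Qed.

Lemma thpart_sum x : thpart false x + thpart true x = x.
Proof.
have [s ->] := tensor_ind x; rewrite /tsum.
elim: s => [|p s IHs]; first by rewrite big_nil !thpart0 addr0.
rewrite big_cons !thpartD addrACA IHs; congr (_ + _).
rewrite !thpart_tens !big_bool /=.
rewrite -[in RHS](hpart_sum p.1) -[in RHS](hpart_sum p.2) !tensDl !tensDr.
by rewrite [LHS]addrACA [LHS]addrC; congr (_ + _); apply: addrC.
Qed.

HB.instance Definition _ :=
  isSuper.Build K (tensor V W) thpart_linear thpartK thpart_sum.
End TensorGrading.

(* SAlg_K.  In characteristic 2 one would also require odd elements to square
   to zero. *)
HB.mixin Record isSAlg (K : fieldType) A
    of SuperLmodule K A & GRing.Algebra K A := {
  hpart_one : hpart false (1 : A) = 1;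
  hpart_mul : forall (i j : bool) (x y : A),
    homogeneous i x -> homogeneous j y -> homogeneous (i (+) j) (x * y);
  supercomm : forall (i j : bool) (x y : A),
    homogeneous i x -> homogeneous j y -> x * y = (-1) ^+ (i && j) *: (y * x)
}.

#[short(type="salgType")]
HB.structure Definition SAlg (K : fieldType) :=
  {A of SuperLmodule K A & GRing.Algebra K A & isSAlg K A}.

Record salg_hom (K : fieldType) (A B : salgType K) := SAlgHom {
  salg_fun :> {lrmorphism A -> B};
  salg_hom_hpart : forall b x, hpart b (salg_fun x) = salg_fun (hpart b x)
}.

(* (a (x) b)(c (x) d) = (-1)^{|b||c|} ac (x) bd *)
Definition tmul (K : fieldType) (A B : salgType K) (s t : tensor A B) :
    tensor A B :=
  tlift (fun a b => tlift (fun c d =>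
    \sum_(i : bool) \sum_(j : bool)
      (-1) ^+ (i && j) *: tens (a * hpart j c) (hpart i b * d)) t) s.

(* A super-commutative Hopf superalgebra A over K stands for the affine
   supergroup G with K[G] = A; morphisms of supergroups correspond
   contravariantly to morphisms of Hopf superalgebras. *)
HB.mixin Record isHopfSAlg (K : fieldType) A of SAlg K A := {
  comul : A -> tensor A A;
  counit : A -> K;
  antipode : A -> A;
  comul_linear : linear comul;
  comul_hpart : forall b x, hpart b (comul x) = comul (hpart b x);
  comul1 : comul 1 = tens 1 1;
  comulM : forall x y, comul (x * y) = tmul (comul x) (comul y);
  counit_scalar : scalar counit;
  counit_odd : forall x, counit (hpart true x) = 0;
  counit1 : counit 1 = 1;
  counitM : forall x y, counit (x * y) = counit x * counit y;
  antipode_linear : linear antipode;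
  antipode_hpart : forall b x, hpart b (antipode x) = antipode (hpart b x);
  comulA : forall x,
    tassoc (tmap comul idfun (comul x)) = tmap idfun comul (comul x);
  counitl : forall x, tlift (fun a b => counit a *: b) (comul x) = x;
  counitr : forall x, tlift (fun a b => counit b *: a) (comul x) = x;
  antipodel : forall x,
    tlift (fun a b => antipode a * b) (comul x) = (counit x)%:A;
  antipoder : forall x,
    tlift (fun a b => a * antipode b) (comul x) = (counit x)%:A
}.

#[short(type="hopfSAlgType")]
HB.structure Definition HopfSAlg (K : fieldType) :=
  {A of SAlg K A & isHopfSAlg K A}.

(* Compatibility with the antipodes is automatic. *)
Record hopf_hom (K : fieldType) (A B : hopfSAlgType K) := HopfHom {
  hopf_fun :> salg_hom A B;
  hopf_hom_comul : forall x,
    comul (hopf_fun x) = tmap hopf_fun hopf_fun (comul x);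
  hopf_hom_counit : forall x, counit (hopf_fun x) = counit x
}.

(* The product of the group G(R) = Hom_SAlg(K[G], R); the inverse of g is
   g \o antipode. *)
Definition pt_mul (K : fieldType) (A : hopfSAlgType K) (R : salgType K)
    (g h : A -> R) : A -> R :=
  fun x => tlift (fun a b => g a * h b) (comul x).

(* Below, a closed super-subgroup N of G is given by a surjective morphism
   p : K[G] -> K[N], and N(R) is embedded in G(R) by n |-> n \o p. *)
Definition closed_subgroup (K : fieldType) (A N : hopfSAlgType K)
    (p : hopf_hom A N) : Prop :=
  forall y, exists x, p x = y.

Definition normal_subgroup (K : fieldType) (A N : hopfSAlgType K)
    (p : hopf_hom A N) : Prop :=
  forall (R : salgType K) (g : salg_hom A R) (n : salg_hom N R),
  exists n' : salg_hom N R,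
    pt_mul (pt_mul g (n \o p)) (g \o antipode) =1 n' \o p.

Definition subgroup_le (K : fieldType) (A N N' : hopfSAlgType K)
    (p : hopf_hom A N) (p' : hopf_hom A N') : Prop :=
  forall x, p' x = 0 -> p x = 0.

(* i : B -> K[G] identifies B with the Hopf super-subalgebra representing G/N:
   the ideal B^+ K[G] is the kernel of p. *)
Definition is_quotient (K : fieldType) (A N B : hopfSAlgType K)
    (p : hopf_hom A N) (i : hopf_hom B A) : Prop :=
  injective i /\
  forall x, p x = 0 <->
    exists s : seq (B * A),
      (forall u, u \in s -> counit u.1 = 0) /\ x = \sum_(u <- s) i u.1 * u.2.

Section Supermodules.
Variables (K : fieldType) (A : hopfSAlgType K).

(* Left G-supermodules: right K[G]-super-comodules. *)
Record supermodule := Supermodule {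
  smod_sort :> superModType K;
  coact : smod_sort -> tensor smod_sort A;
  coact_linear : linear coact;
  coact_hpart : forall b x, hpart b (coact x) = coact (hpart b x);
  coactA : forall x,
    tassoc (tmap coact idfun (coact x)) = tmap idfun comul (coact x);
  coact_counit : forall x, tlift (fun m a => counit a *: m) (coact x) = x
}.

Local Open Scope classical_set_scope.

Record sub_supermodule (M : supermodule) (N : set M) : Prop := {
  sub_smod0 : N 0;
  sub_smod_linear : forall a x y, N x -> N y -> N (a *: x + y);
  sub_smod_hpart : forall b x, N x -> N (hpart b x);
  sub_smod_coact : forall x, N x ->
    exists s : seq (M * A), (forall u, u \in s -> N u.1) /\
      coact x = \sum_(u <- s) tens u.1 u.2
}.

Definition simple_sub (M : supermodule) (S : set M) : Prop :=
  [/\ sub_supermodule S, S <> [set 0] &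
      forall T : set M, sub_supermodule T -> T `<=` S ->
        T = [set 0] \/ T = S].

Definition simple_supermodule (M : supermodule) : Prop :=
  simple_sub [set: M].

Definition is_direct_sum (M : supermodule) (I : choiceType) (S : I -> set M)
    : Prop :=
  (forall x, exists (r : seq I) (f : I -> M),
     (forall i, S i (f i)) /\ x = \sum_(i <- r) f i) /\
  (forall (r : seq I) (f : I -> M), uniq r -> (forall i, S i (f i)) ->
     \sum_(i <- r) f i = 0 -> forall i, i \in r -> f i = 0).

Definition semisimple_supermodule (M : supermodule) : Prop :=
  exists (I : choiceType) (S : I -> set M),
    (forall i, simple_sub (S i)) /\ is_direct_sum S.

Definition linearly_reductive : Prop :=
  forall M : supermodule, semisimple_supermodule M.

Definition trivial_line (M : supermodule) : Prop :=
  exists (b : bool) (v : M),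
    [/\ v <> 0, homogeneous b v, (forall x : M, exists c : K, x = c *: v) &
        coact v = tens v 1].

Definition unipotent : Prop :=
  forall M : supermodule, simple_supermodule M -> trivial_line M.

Definition purely_even : Prop := forall x : A, hpart true x = 0.

Definition grouplike (x : A) : Prop := comul x = tens x x /\ counit x = 1.

Definition diagonalizable_supergroup : Prop :=
  purely_even /\
  forall x : A, exists s : seq (K * A),
    (forall u, u \in s -> grouplike u.2) /\ x = \sum_(u <- s) u.1 *: u.2.
End Supermodules.

Definition unipotent_radical (K : fieldType) (A U : hopfSAlgType K)
    (p : hopf_hom A U) : Prop :=
  [/\ closed_subgroup p, normal_subgroup p, unipotent U &
      forall (N : hopfSAlgType K) (q : hopf_hom A N),
        closed_subgroup q -> normal_subgroup q -> unipotent N ->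
        subgroup_le q p].

(* Main.v *)
(* Put A = K[G] and let H be the image of K[Q].  The coinvariants of A -> A/H^+A
   are exactly H (super version of Takeuchi's theorem on faithful flatness over Hopf
   subalgebras), and since Gu is unipotent, the filtration of A starting with H,
   whose steps are pulled back along Delta from A (x) H, is exhaustive.  By Zorn,
   take a Hopf ideal I maximal with I meet H = 0.  The hypotheses pass to A/I, so it
   is enough to show that if A <> H then some nonzero Hopf ideal meets H trivially;
   then A/I = H and A -> A/I = H is the required retraction.
   If A <> H, there is x outside H with Delta x - 1 (x) x in A (x) H, and such
   elements form an H-comodule N containing H.
   (a) By complete reducibility N contains a simple subcomodule X of augmentation
   zero meeting H trivially; in characteristic zero the ideal generated by X meets H
   trivially, because A has enough derivations vanishing on H, and these are locally
   nilpotent by the filtration.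
   (b) Here x can be taken homogeneous with Delta x = 1 (x) x + x (x) g, g grouplike.
   If x is odd, the ideal A x works.  If x is even, either x is transcendental over
   H, or its minimal equation over H is a p-polynomial up to a constant term
   c (1 - g^n), and it has a root l (g - 1) with l in K; the ideal generated by
   x - l (g - 1) then works. *)
From HB Require Import structures.
From mathcomp Require Import all_boot all_algebra.
From mathcomp Require Import boolp classical_sets.
Require Import Defs.

Set Implicit Arguments.
Unset Strict Implicit.
Unset Printing Implicit Defensive.

Import GRing.Theory.
Local Open Scope ring_scope.

(** * Linear maps, subspaces and tensor products *)

(** The main obstacle is faithful flatness: determinants do not exist over a supercommutative
    algebra, and A need not be finitely generated. It is replaced by [purity]: every finite subset
    of A lies in an H-submodule, stable under left slices, that has an H-linear retraction onto H
    fixing 1. The retraction is built near the unit element, by a Nakayama argument whose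
    elimination pivots only on even, hence central, entries, and is then translated over the group.
    It yields both the description of the coinvariants and the contraction rule that jA meets H in
    jH, later applied to H[x]. Conditions on Delta are tested on slices: a tensor lies in A (x) S
    exactly when its slices by functionals on the first factor lie in S. In characteristic zero the
    derivations come from functionals vanishing on H + (A^+)^2. That X carries enough of them is
    seen on the N-th powers of the point A -> A/H^+A: they are linear in N on X, but divisible by
    N^2 on products of augmentation zero. In case (b) the root exists because every term of the
    minimal equation, evaluated at l (g - 1), is a multiple of g^n - 1, which leaves one equation
    for l in K. *)

Section LinearMaps.
Variables (K : fieldType) (V W : lmodType K) (f : V -> W).
Hypothesis hf : linear f.

Lemma linD x y : f (x + y) = f x + f y.
Proof. by have := hf 1 x y; rewrite !scale1r. Qed.

Lemma lin0 : f 0 = 0.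
Proof. by have := hf (-1) 0 0; rewrite scaler0 addr0 scaleN1r addNr. Qed.

Lemma linZ a x : f (a *: x) = a *: f x.
Proof. by have := hf a x 0; rewrite lin0 !addr0. Qed.

Lemma linN x : f (- x) = - f x.
Proof. by rewrite -scaleN1r linZ scaleN1r. Qed.

Lemma linB x y : f (x - y) = f x - f y.
Proof. by rewrite linD linN. Qed.

Lemma lin_sum I (r : seq I) (P : pred I) (F : I -> V) :
  f (\sum_(i <- r | P i) F i) = \sum_(i <- r | P i) f (F i).
Proof. exact: (big_morph f linD lin0). Qed.
End LinearMaps.

Lemma lin_comp (K : fieldType) (U V W : lmodType K) (g : V -> W) (f : U -> V) :
  linear g -> linear f -> linear (g \o f).
Proof. by move=> hg hf a x y; rewrite /= hf hg. Qed.

Lemma lin_id (K : fieldType) (V : lmodType K) : linear (@idfun V).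
Proof. by []. Qed.

Lemma lin_scalel (K : fieldType) (V W : lmodType K) (f : V -> K^o) (w : W) :
  linear f -> linear (fun v => f v *: w).
Proof. by move=> hf a x y; rewrite hf scalerDl scalerA. Qed.

Lemma lin_scaler (K : fieldType) (V W : lmodType K) (f : V -> W) (c : K) :
  linear f -> linear (fun v => c *: f v).
Proof. by move=> hf a x y; rewrite hf scalerDr !scalerA mulrC. Qed.

Lemma lin_add (K : fieldType) (V W : lmodType K) (f g : V -> W) :
  linear f -> linear g -> linear (fun v => f v + g v).
Proof. by move=> hf hg a x y; rewrite hf hg scalerDr addrACA. Qed.

Lemma lin_opp (K : fieldType) (V W : lmodType K) (f : V -> W) :
  linear f -> linear (fun v => - f v).
Proof. by move=> hf a x y; rewrite hf opprD scalerN. Qed.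

Lemma lin_big (K : fieldType) (V W : lmodType K) I (r : seq I)
    (f : I -> V -> W) :
  (forall i, linear (f i)) -> linear (fun v => \sum_(i <- r) f i v).
Proof.
by move=> hf a x y; rewrite scaler_sumr -big_split; apply: eq_bigr => i _;
  rewrite hf.
Qed.

Definition subsp (K : fieldType) (V : lmodType K) (S : V -> Prop) : Prop :=
  S 0 /\ forall a x y, S x -> S y -> S (a *: x + y).

Section Subspaces.
Variables (K : fieldType) (V : lmodType K).
Implicit Types S P : V -> Prop.

Lemma subsp0 S : subsp S -> S 0. Proof. by case. Qed.

Lemma subspD S : subsp S -> forall x y, S x -> S y -> S (x + y).
Proof. by case=> _ h x y hx hy; rewrite -[x]scale1r; apply: h. Qed.

Lemma subspZ S : subsp S -> forall a x, S x -> S (a *: x).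
Proof. by case=> h0 h a x hx; rewrite -[_ *: _]addr0; apply: h. Qed.

Lemma subspN S : subsp S -> forall x, S x -> S (- x).
Proof. by move=> h x hx; rewrite -scaleN1r; apply: subspZ. Qed.

Lemma subspB S : subsp S -> forall x y, S x -> S y -> S (x - y).
Proof. by move=> h x y hx hy; apply: subspD => //; apply: subspN. Qed.

Lemma subsp_sum S I (r : seq I) (Q : pred I) (F : I -> V) : subsp S ->
  (forall i, Q i -> S (F i)) -> S (\sum_(i <- r | Q i) F i).
Proof. by move=> h hF; apply: big_ind => //; [apply: subsp0|apply: subspD]. Qed.

Lemma subsp_add S P : subsp S -> subsp P ->
  subsp (fun z => exists x y, [/\ S x, P y & z = x + y]).
Proof.
move=> hS hP; split; first by exists 0, 0; rewrite addr0; split=> //; apply: subsp0.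
move=> a _ _ [x [y [hx hy ->]]] [x' [y' [hx' hy' ->]]].
exists (a *: x + x'), (a *: y + y'); split.
- by case: hS => _; apply.
- by case: hP => _; apply.
- by rewrite scalerDr addrACA.
Qed.

Lemma subsp_line (x : V) : subsp (fun z => exists c : K, z = c *: x).
Proof.
split; first by exists 0; rewrite scale0r.
by move=> a _ _ [c ->] [d ->]; exists (a * c + d); rewrite scalerDl scalerA.
Qed.

(** Zorn's lemma gives a subspace T containing S and maximal among those meeting P trivially.
    Maximality forces T + P to be everything, and f is the projection onto P along T. *)
Lemma proj_along S P : subsp S -> subsp P ->
  (forall x, S x -> P x -> x = 0) ->
  exists f : V -> V, [/\ linear f, forall x, P (f x),
    forall x, P x -> f x = x & forall x, S x -> f x = 0].
Proof.
move=> hS hP SP.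
pose good (T : set V) := [/\ subsp T, forall x, S x -> T x &
  forall x, T x -> P x -> x = 0].
(* The guard [exists x, T x] makes the union of the empty chain admissible. The maximal T is then
   shown to be nonempty by comparing it with S. *)
have [F FG totF|T [gT maxT]] := @Zorn_bigcup V (fun T => (exists x, T x) -> good T).
  case=> x0 [T0 FT0 T0x0].
  have gT T x : F T -> T x -> good T by move=> FT Tx; apply: (FG _ FT); exists x.
  have [hT0 ST0 _] := gT _ _ FT0 T0x0; split.
  - split; first by exists T0 => //; apply: subsp0.
    move=> a x y [T1 FT1 T1x] [T2 FT2 T2y].
    have [T12|T21] := totF _ _ FT1 FT2.
      exists T2 => //; have [[_ h] _ _] := gT _ _ FT2 T2y.
      by apply: h => //; apply: T12.
    exists T1 => //; have [[_ h] _ _] := gT _ _ FT1 T1x.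
    by apply: h => //; apply: T21.
  - by move=> x Sx; exists T0 => //; apply: ST0.
  - by move=> x [T1 FT1 T1x] Px; have [_ _] := gT _ _ FT1 T1x; apply.
have neT : exists x, T x.
  apply: contrapT => eT; apply: (maxT S); last by move=> _; split.
  split=> [x Tx|e]; first by exfalso; apply: eT; exists x.
  by apply: eT; exists 0; apply: e; apply: subsp0.
have {gT neT} [hT ST TP] := gT neT.
have dec x : exists y, P y /\ T (x - y).
  pose T' z := exists t p, [/\ T t, (exists c : K, p = c *: x) & z = t + p].
  have hT' : subsp T' by apply: subsp_add => //; apply: subsp_line.
  have TT' t : T t -> T' t.
    by move=> Tt; exists t, 0; split=> //; [exists 0; rewrite scale0r|rewrite addr0].
  have [Tx|nTx] := pselect (T x).
    by exists 0; split; [apply: subsp0|rewrite subr0].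
  have [z T'z [Pz z0]] : exists2 z, T' z & P z /\ z <> 0.
    apply: contrapT => h; apply: (maxT T').
      split=> // T'T; apply: nTx; apply: T'T; exists 0, x.
      split; [exact: subsp0|by exists 1; rewrite scale1r|by rewrite add0r].
    move=> _; split=> //; first by move=> y /ST/TT'.
    by move=> y T'y Py; apply: contrapT => y0; apply: h; exists y.
  have [t [_ [Tt [c ->] ez]]] := T'z.
  have c0 : c != 0.
    apply/eqP => c0; apply: z0; apply: TP => //.
    by rewrite ez c0 scale0r addr0.
  exists (c^-1 *: z); split; first exact: subspZ.
  rewrite ez scalerDr scalerA mulVf // scale1r opprD addrCA subrr addr0.
  by apply: subspN => //; apply: subspZ.
have {}dec x : {y | P y /\ T (x - y)} by apply: cid.
have uniq x y y' : P y -> T (x - y) -> P y' -> T (x - y') -> y = y'.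
  move=> Py Ty Py' Ty'; apply/eqP; rewrite -subr_eq0; apply/eqP/TP.
    have -> : y - y' = (x - y') - (x - y) by rewrite opprB [RHS]addrC addrA subrK.
    exact: (subspB hT).
  exact: (subspB hP).
exists (fun x => sval (dec x)); split.
- move=> a x y; case: (dec x) => /= x' [Px Tx]; case: (dec y) => /= y' [Py Ty].
  case: (dec _) => /= z [Pz Tz]; apply: (uniq _ _ _ Pz Tz).
    by case: hP => _; apply.
  rewrite opprD addrACA -scalerBr; by case: hT => _; apply.
- by move=> x; case: (dec x) => /= ? [].
- move=> x Px; case: (dec x) => /= z [Pz Tz]; apply: (uniq _ _ _ Pz Tz) => //.
  by rewrite subrr; apply: subsp0.
- move=> x Sx; case: (dec x) => /= z [Pz Tz]; apply: (uniq _ _ _ Pz Tz).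
    exact: subsp0.
  by rewrite subr0; apply: ST.
Qed.

Lemma proj_on P : subsp P ->
  exists f : V -> V, [/\ linear f, forall x, P (f x) & forall x, P x -> f x = x].
Proof.
move=> hP; have h0 : subsp (fun x : V => x = 0).
  by split=> // a x y -> ->; rewrite scaler0 addr0.
by have [//|f [? ? ? _]] := proj_along h0 hP; exists f.
Qed.

Lemma separate S x : subsp S -> ~ S x ->
  exists f : V -> K^o, [/\ linear f, f x = 1 & forall y, S y -> f y = 0].
Proof.
move=> hS nSx.
have x0 : x != 0 by apply/eqP => x0; apply: nSx; rewrite x0; apply: subsp0.
have [y Sy [c ec]|p [hp Pp pP pS]] := proj_along hS (subsp_line x).
  have [-> //|c0] := eqVneq y 0.
  case: nSx; have cn0 : c != 0.
    by apply: contraNneq c0 => c0; rewrite ec c0 scale0r.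
  by rewrite -[x]scale1r -(mulVf cn0) -scalerA -ec; apply: subspZ.
pose f y := sval (cid (Pp y)).
have fE y : p y = f y *: x by rewrite /f; case: (cid _).
have inj a b : a *: x = b *: x -> a = b.
  move/eqP; rewrite -subr_eq0 -scalerBl scaler_eq0 (negbTE x0) orbF subr_eq0.
  by move/eqP.
exists f; split.
- by move=> a u v; apply: inj; rewrite -fE hp !fE scalerDl scalerA.
- by apply: inj; rewrite -fE scale1r pP //; exists 1; rewrite scale1r.
- by move=> y Sy; apply: inj; rewrite -fE pS // scale0r.
Qed.

Lemma separate0 (x : V) : (forall f : V -> K^o, linear f -> f x = 0) -> x = 0.
Proof.
move=> h; apply: contrapT => x0.
have h0 : subsp (fun x : V => x = 0).
  by split=> // a u v -> ->; rewrite scaler0 addr0.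
have [f [/h fx0 fx _]] := separate h0 x0.
by move/eqP: fx; rewrite fx0 eq_sym oner_eq0.
Qed.

Definition span_fam n (v : 'I_n -> V) (x : V) : Prop :=
  exists c : 'I_n -> K, x = \sum_i c i *: v i.

Lemma subsp_span n (v : 'I_n -> V) : subsp (span_fam v).
Proof.
split; first by exists (fun=> 0); rewrite big1 // => i _; rewrite scale0r.
move=> a _ _ [c ->] [d ->]; exists (fun i => a * c i + d i).
rewrite scaler_sumr -big_split; apply: eq_bigr => i _ /=.
by rewrite scalerDl scalerA.
Qed.

Lemma span_mem n (v : 'I_n -> V) i : span_fam v (v i).
Proof.
exists (fun j => (j == i)%:R); rewrite (bigD1 i) //= eqxx scale1r big1 ?addr0 //.
by move=> j /negbTE->; rewrite scale0r.
Qed.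

Lemma span_sub n (v : 'I_n -> V) S : subsp S -> (forall i, S (v i)) ->
  forall x, span_fam v x -> S x.
Proof. by move=> hS h _ [c ->]; apply: subsp_sum => // i _; apply: subspZ. Qed.

Definition free_mod S n (v : 'I_n -> V) : Prop :=
  forall c : 'I_n -> K, S (\sum_i c i *: v i) -> forall i, c i = 0.

Lemma dual_mod S n (v : 'I_n -> V) : subsp S -> free_mod S v ->
  exists f : 'I_n -> V -> K^o, [/\ forall i, linear (f i),
    forall i j, f i (v j) = (i == j)%:R & forall i x, S x -> f i x = 0].
Proof.
move=> hS fr.
have ex i : exists f : V -> K^o, [/\ linear f,
    forall j, f (v j) = (i == j)%:R & forall x, S x -> f x = 0].
  pose P z := exists x y,
    [/\ S x, (exists c : 'I_n -> K, y = \sum_(j | j != i) c j *: v j) & z = x + y].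
  have hP : subsp P.
    apply: subsp_add => //; split.
      by exists (fun=> 0); rewrite big1 // => j _; rewrite scale0r.
    move=> a _ _ [c ->] [d ->]; exists (fun i => a * c i + d i).
    rewrite scaler_sumr -big_split; apply: eq_bigr => j _ /=.
    by rewrite scalerDl scalerA.
  have nP : ~ P (v i).
    case=> x [_ [Sx [c ->] e]].
    have := fr (fun j => if j == i then 1 else - c j).
    rewrite (bigD1 i) //= eqxx scale1r (eq_bigr (fun j => - (c j *: v j))).
      rewrite sumrN e addrK => /(_ Sx i); rewrite eqxx => /eqP.
      by rewrite oner_eq0.
    by move=> j /negbTE->; rewrite scaleNr.
  have [f [hf fi fP]] := separate hP nP; exists f; split=> // [j|x Sx]; last first.
    apply: fP; exists x, 0; split; rewrite ?addr0 //.
    by exists (fun=> 0); rewrite big1 // => j _; rewrite scale0r.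
  have [<- //|ij] := eqVneq i j; apply: fP; exists 0, (v j); split.
  - exact: subsp0.
  - exists (fun k => (k == j)%:R); rewrite (bigD1 j) 1?eq_sym //= eqxx scale1r.
    by rewrite big1 ?addr0 // => k /andP[_ /negbTE->]; rewrite scale0r.
  - by rewrite add0r.
pose f i := sval (cid (ex i)); exists f.
split=> [i|i j|i x]; rewrite /f; case: (cid (ex i)) => /= g [hg gv gS] //.
exact: gS.
Qed.

Definition free_fam n (v : 'I_n -> V) : Prop :=
  forall c : 'I_n -> K, \sum_i c i *: v i = 0 -> forall i, c i = 0.

Lemma dual_fam n (v : 'I_n -> V) : free_fam v ->
  exists f : 'I_n -> V -> K^o, [/\ forall i, linear (f i) &
    forall i j, f i (v j) = (i == j)%:R].
Proof.
move=> fr; have h0 : subsp (fun x : V => x = 0).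
  by split=> // a u w -> ->; rewrite scaler0 addr0.
by have [|f [? ? _]] := @dual_mod _ n v h0; last exists f.
Qed.
End Subspaces.

Lemma subsp_preim (K : fieldType) (V W : lmodType K) (f : V -> W) (S : W -> Prop) : linear f ->
  subsp S -> subsp (fun x => S (f x)).
Proof.
move=> hf hS; split; first by rewrite (lin0 hf); apply: subsp0.
by move=> a x y hx hy; rewrite hf; case: hS => _; apply.
Qed.

(** * Tensors, their slices and their shortest representations *)

Section Tensors.
Variables (K : fieldType).
Implicit Types V W U : lmodType K.

Lemma tensZl V W a (v : V) (w : W) : tens (a *: v) w = a *: tens v w.
Proof. by rewrite (bilinZl (@tens_bilin _ _ _)). Qed.

Lemma tensZr V W a (v : V) (w : W) : tens v (a *: w) = a *: tens v w.
Proof. by have [_ hr] := @tens_bilin K V W; rewrite (linZ (hr v)). Qed.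

Lemma lin_tensl V W (w : W) : linear (fun v : V => tens v w).
Proof. by have [hl _] := @tens_bilin K V W; apply: hl. Qed.

Lemma lin_tensr V W (v : V) : linear (fun w : W => tens v w).
Proof. by have [_ hr] := @tens_bilin K V W; apply: hr. Qed.

Lemma tensor_sumP V W (P : tensor V W -> Prop) : subsp P ->
  (forall v w, P (tens v w)) -> forall t, P t.
Proof.
move=> hP ht t; have [s ->] := tensor_ind t.
by apply: subsp_sum => // p _; apply: ht.
Qed.

Lemma tensor_ext V W U (f g : tensor V W -> U) : linear f -> linear g ->
  (forall v w, f (tens v w) = g (tens v w)) -> f =1 g.
Proof.
move=> hf hg h; apply: tensor_sumP => //; split; first by rewrite !lin0.
by move=> a x y hx hy; rewrite hf hg hx hy.
Qed.

Lemma tlift_eq V W U (f g : V -> W -> U) :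
  (forall v w, f v w = g v w) -> tlift f =1 tlift g.
Proof. by move=> h t; apply: eq_bigr => p _; apply: h. Qed.

Lemma bilin_tens V W V' W' (f : V -> V') (g : W -> W') :
  linear f -> linear g -> bilin (fun v w => tens (f v) (g w)).
Proof.
move=> hf hg; split=> [w|v].
  exact: (lin_comp (@lin_tensl V' W' (g w)) hf).
exact: (lin_comp (@lin_tensr V' W' (f v)) hg).
Qed.

Lemma tmap_linear V W V' W' (f : V -> V') (g : W -> W') :
  linear f -> linear g -> linear (tmap f g).
Proof. by move=> hf hg; apply/tlift_linear/bilin_tens. Qed.

Lemma tmap_tens V W V' W' (f : V -> V') (g : W -> W') v w :
  linear f -> linear g -> tmap f g (tens v w) = tens (f v) (g w).
Proof. by move=> hf hg; apply/tlift_tens/bilin_tens. Qed.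

Lemma lin_tlift V W U U' (h : U -> U') (f : V -> W -> U) :
  linear h -> bilin f -> forall t, h (tlift f t) = tlift (fun v w => h (f v w)) t.
Proof.
move=> hh [hl hr]; have hhf : bilin (fun v w => h (f v w)).
  by split=> [w|v]; [apply: (lin_comp hh (hl w))|apply: (lin_comp hh (hr v))].
apply: tensor_ext; [apply: lin_comp => //; apply: tlift_linear => // | exact: tlift_linear |].
by move=> v w; rewrite /= !tlift_tens.
Qed.

Lemma bilin_scalel V W (f : V -> K^o) : linear f ->
  bilin (fun v (w : W) => f v *: w).
Proof.
move=> hf; split=> [w|v]; first exact: lin_scalel.
by move=> a x y; rewrite scalerDr !scalerA mulrC.
Qed.

Lemma bilin_scaler V W (g : W -> K^o) : linear g ->
  bilin (fun (v : V) w => g w *: v).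
Proof.
move=> hg; split=> [w|v]; last exact: lin_scalel.
by move=> a x y; rewrite scalerDr !scalerA mulrC.
Qed.

Definition lsl V W (f : V -> K^o) : tensor V W -> W :=
  tlift (fun v w => f v *: w).
Definition rsl V W (g : W -> K^o) : tensor V W -> V :=
  tlift (fun v w => g w *: v).

Lemma lsl_linear V W (f : V -> K^o) : linear f -> linear (@lsl V W f).
Proof. by move=> hf; apply/tlift_linear/bilin_scalel. Qed.

Lemma rsl_linear V W (g : W -> K^o) : linear g -> linear (@rsl V W g).
Proof. by move=> hg; apply/tlift_linear/bilin_scaler. Qed.

Lemma lsl_tens V W (f : V -> K^o) v (w : W) : linear f ->
  lsl f (tens v w) = f v *: w.
Proof. by move=> hf; apply/tlift_tens/bilin_scalel. Qed.

Lemma rsl_tens V W (g : W -> K^o) (v : V) w : linear g ->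
  rsl g (tens v w) = g w *: v.
Proof. by move=> hg; apply/tlift_tens/bilin_scaler. Qed.

Lemma lsl_rsl V W (f : V -> K^o) (g : W -> K^o) : linear f -> linear g ->
  forall t : tensor V W, g (lsl f t) = f (rsl g t).
Proof.
move=> hf hg; apply: tensor_ext.
- exact: lin_comp (lsl_linear hf).
- exact: lin_comp (rsl_linear hg).
- by move=> v w; rewrite /= lsl_tens // rsl_tens // (linZ hf) (linZ hg); apply: mulrC.
Qed.

(** Take a representation with the least number of terms: a linear relation among the first factors,
    or among the second ones, would allow one term to be absorbed by the others. *)
Lemma tensor_rep V W (t : tensor V W) :
  exists n (v : 'I_n -> V) (w : 'I_n -> W),
    [/\ t = \sum_i tens (v i) (w i), free_fam v & free_fam w].
Proof.
pose R n := exists (v : 'I_n -> V) (w : 'I_n -> W), t = \sum_i tens (v i) (w i).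
have exR : exists n, `[< R n >].
  have [s es] := tensor_ind t; exists (size s); apply/asboolP.
  exists (fun i => (tnth (in_tuple s) i).1), (fun i => (tnth (in_tuple s) i).2).
  by rewrite es /tsum big_tnth.
case: (ex_minnP exR) => n /asboolP [v [w et]] minn.
have red m (v' : 'I_m -> V) (w' : 'I_m -> W) (k : 'I_m) :
    m = n -> t = \sum_(i | i != k) tens (v' i) (w' i) -> False.
  case: m v' w' k => [|m] v' w' k; [by case: k|move=> mn et'].
  have /minn : `[< R m >].
    apply/asboolP; exists (v' \o lift k), (w' \o lift k); rewrite et'.
    apply: (@addrI _ (tens (v' k) (w' k))).
    by rewrite -[LHS](@bigD1 _ _ _ _ k predT (fun i => tens (v' i) (w' i))) // (bigD1_ord k).
  by rewrite -mn ltnn.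
exists n, v, w; split=> // c ec k; apply/eqP/negP => /negP ck.
- pose w' i := w i - (c i / c k) *: w k.
  apply: (red n v w' k) => //; rewrite et [LHS](bigD1 k) //=.
  have -> : v k = - \sum_(i | i != k) (c i / c k) *: v i.
    apply: (scalerI ck); rewrite scalerN scaler_sumr.
    apply/eqP; rewrite -addr_eq0; apply/eqP.
    rewrite -[RHS]ec [RHS](bigD1 k) //=; congr (_ + _); apply: eq_bigr => i _.
    by rewrite scalerA mulrCA divff // mulr1.
  rewrite (linN (lin_tensl _)) (lin_sum (lin_tensl _)) addrC -sumrB.
  apply: eq_bigr => i _.
  by rewrite (linB (lin_tensr _)) tensZr tensZl.
- pose v' i := v i - (c i / c k) *: v k.
  apply: (red n v' w k) => //; rewrite et [LHS](bigD1 k) //=.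
  have -> : w k = - \sum_(i | i != k) (c i / c k) *: w i.
    apply: (scalerI ck); rewrite scalerN scaler_sumr.
    apply/eqP; rewrite -addr_eq0; apply/eqP.
    rewrite -[RHS]ec [RHS](bigD1 k) //=; congr (_ + _); apply: eq_bigr => i _.
    by rewrite scalerA mulrCA divff // mulr1.
  rewrite (linN (lin_tensr _)) (lin_sum (lin_tensr _)) addrC -sumrB.
  apply: eq_bigr => i _.
  by rewrite (linB (lin_tensl _)) tensZr tensZl.
Qed.

Lemma lsl_sum V W n (f : V -> K^o) (v : 'I_n -> V) (w : 'I_n -> W) : linear f ->
  lsl f (\sum_i tens (v i) (w i)) = \sum_i f (v i) *: w i.
Proof.
move=> hf; rewrite (lin_sum (lsl_linear hf)); apply: eq_bigr => i _.
exact: lsl_tens.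
Qed.

Lemma rsl_sum V W n (g : W -> K^o) (v : 'I_n -> V) (w : 'I_n -> W) : linear g ->
  rsl g (\sum_i tens (v i) (w i)) = \sum_i g (w i) *: v i.
Proof.
move=> hg; rewrite (lin_sum (rsl_linear hg)); apply: eq_bigr => i _.
exact: rsl_tens.
Qed.

Lemma dual_sum V n (f : 'I_n -> K) (v : 'I_n -> V) j :
  (forall i, f i = (j == i)%:R) -> \sum_i f i *: v i = v j.
Proof.
move=> h; rewrite (bigD1 j) //= h eqxx scale1r big1 ?addr0 // => i ij.
by rewrite h eq_sym (negbTE ij) scale0r.
Qed.

Lemma lsl_eq0 V W (t : tensor V W) :
  (forall f : V -> K^o, linear f -> lsl f t = 0) -> t = 0.
Proof.
have [n [v [w [-> /dual_fam[f [hf fv]] _]]]] := tensor_rep t => h.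
apply: big1 => i _; have := h (f i) (hf i); rewrite lsl_sum //.
by rewrite (@dual_sum _ _ _ _ i) // => ->; rewrite (lin0 (lin_tensr _)).
Qed.

Lemma slice_eq0 V W (t : tensor V W) :
  (forall (f : V -> K^o) (g : W -> K^o), linear f -> linear g -> g (lsl f t) = 0) ->
  t = 0.
Proof. by move=> h; apply: lsl_eq0 => f hf; apply: separate0 => g; apply: h. Qed.

Lemma slice_ext V W (t t' : tensor V W) :
  (forall (f : V -> K^o) (g : W -> K^o), linear f -> linear g ->
    g (lsl f t) = g (lsl f t')) -> t = t'.
Proof.
move=> h; apply/eqP; rewrite -subr_eq0; apply/eqP/slice_eq0 => f g hf hg.
by rewrite (linB (lsl_linear hf)) (linB hg) h // subrr.
Qed.

(** Functionals dual to a free family of first factors recover the second factors as slices.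
    Membership in V (x) S is tested in this way throughout. *)
Lemma lsl_in V W (S : W -> Prop) (t : tensor V W) : subsp S ->
  (forall f : V -> K^o, linear f -> S (lsl f t)) ->
  exists n (v : 'I_n -> V) (w : 'I_n -> W),
    [/\ t = \sum_i tens (v i) (w i), free_fam v & forall i, S (w i)].
Proof.
move=> hS; have [n [v [w [-> fv _]]]] := tensor_rep t => h.
exists n, v, w; split=> // i; have [f [hf fvE]] := dual_fam fv.
by have := h (f i) (hf i); rewrite lsl_sum // (@dual_sum _ _ _ _ i).
Qed.

Lemma rsl_in V W (S : V -> Prop) (t : tensor V W) : subsp S ->
  (forall g : W -> K^o, linear g -> S (rsl g t)) ->
  exists n (v : 'I_n -> V) (w : 'I_n -> W),
    [/\ t = \sum_i tens (v i) (w i), free_fam w & forall i, S (v i)].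
Proof.
move=> hS; have [n [v [w [-> _ fw]]]] := tensor_rep t => h.
exists n, v, w; split=> // i; have [f [hf fvE]] := dual_fam fw.
by have := h (f i) (hf i); rewrite rsl_sum // (@dual_sum _ _ _ _ i).
Qed.
End Tensors.

Section Associator.
Variables (K : fieldType) (U V W : lmodType K).

Lemma bilin_assoc_pure (w : W) : bilin (fun (u : U) (v : V) => tens u (tens v w)).
Proof.
split=> [v|u]; first exact: lin_tensl.
exact: (lin_comp (lin_tensr u) (lin_tensl w)).
Qed.

Lemma bilin_assoc :
  bilin (fun (t : tensor U V) (w : W) => tlift (fun u v => tens u (tens v w)) t).
Proof.
have h := bilin_assoc_pure; split=> [w|t]; first exact: (tlift_linear (h w)).
move=> k w w'; move: t; apply: tensor_ext; first exact: (tlift_linear (h _)).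
  by apply: lin_add; [apply: lin_scaler|]; apply: (tlift_linear (h _)).
by move=> u v; rewrite !tlift_tens // lin_tensr lin_tensr.
Qed.

Lemma tassoc_linear : linear (@tassoc K U V W).
Proof. exact: (tlift_linear bilin_assoc). Qed.

Lemma tassoc_tens (t : tensor U V) (w : W) :
  tassoc (tens t w) = tlift (fun (u : U) (v : V) => tens u (tens v w)) t.
Proof. exact: (tlift_tens t w bilin_assoc). Qed.
End Associator.

Lemma homogP (K : fieldType) (V : superModType K) (b c : bool) (x : V) :
  homogeneous b x -> hpart c x = if c == b then x else 0.
Proof. by move=> h; rewrite -{1}h hpartK; case: eqP => // ->; rewrite h. Qed.

Lemma hpart_homog (K : fieldType) (V : superModType K) b (x : V) :
  homogeneous b (hpart b x).
Proof. by rewrite /homogeneous hpartK eqxx. Qed.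

Lemma hpart_bool (K : fieldType) (V : superModType K) (x : V) :
  \sum_(b : bool) hpart b x = x.
Proof. by rewrite big_bool /= addrC hpart_sum. Qed.

Definition graded (K : fieldType) (V : superModType K) (S : V -> Prop) : Prop :=
  forall b x, S x -> S (hpart b x).

Definition evenmap (K : fieldType) (V W : superModType K) (f : V -> W) : Prop :=
  forall b x, f (hpart b x) = hpart b (f x).

Lemma evenmap_of (K : fieldType) (V W : superModType K) (f : V -> W) :
  linear f -> let f' x := \sum_(b : bool) hpart b (f (hpart b x)) in
  linear f' /\ evenmap f'.
Proof.
move=> hf f'; split.
  by apply: lin_big => b; apply: (lin_comp (hpart_linear b)); apply: lin_comp => //;
    exact: hpart_linear.
move=> b x; rewrite /f' !big_bool !hpartD !hpartK /=.
by case: b; rewrite /= (lin0 hf) !hpart0 ?addr0 ?add0r.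
Qed.

(** Any projection onto P becomes even when only its two diagonal blocks are kept; it is still the
    identity on P because P is graded. *)
Lemma graded_proj (K : fieldType) (V : superModType K) (P : V -> Prop) :
  subsp P -> graded P -> exists f : V -> V,
  [/\ linear f, evenmap f, forall x, P (f x) & forall x, P x -> f x = x].
Proof.
move=> hP gP; have [f [hf fP Pf]] := proj_on hP.
have [hf' ef'] := evenmap_of hf.
exists (fun x => \sum_(b : bool) hpart b (f (hpart b x))); split=> //.
  by move=> x; apply: subsp_sum => // b _; apply: gP.
move=> x Px; rewrite -[RHS]hpart_bool; apply: eq_bigr => b _.
by rewrite Pf ?hpartK ?eqxx //; apply: gP.
Qed.

(** * Tensor products of superalgebras *)

Section HomogeneousTensors.
Variables (K : fieldType) (V W : superModType K).

Lemma thpart_homog c i j (v : V) (w : W) : homogeneous i v -> homogeneous j w ->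
  hpart c (tens v w : tensor V W) = if c == i (+) j then tens v w else 0.
Proof.
move=> hv hw; rewrite [LHS]thpart_tens big_bool /= !(homogP _ hv) !(homogP _ hw).
by case: c i j {hv hw} => [] [] []; rewrite /= ?tens0l ?tens0r ?addr0 ?add0r.
Qed.

Lemma tensor_hind (P : tensor V W -> Prop) : subsp P ->
  (forall i j v w, homogeneous i v -> homogeneous j w -> P (tens v w)) ->
  forall t, P t.
Proof.
move=> hP h; apply: tensor_sumP => // v w.
rewrite -(hpart_bool v) -(hpart_bool w).
rewrite (lin_sum (lin_tensl _)); apply: subsp_sum => // i _.
rewrite (lin_sum (lin_tensr _)); apply: subsp_sum => // j _.
by apply: (h i j); apply: hpart_homog.
Qed.

Lemma tensor_hext (U : lmodType K) (f g : tensor V W -> U) :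
  linear f -> linear g ->
  (forall i j v w, homogeneous i v -> homogeneous j w ->
    f (tens v w) = g (tens v w)) -> f =1 g.
Proof.
move=> hf hg h; apply: tensor_hind => //; split; first by rewrite !lin0.
by move=> a x y hx hy; rewrite hf hg hx hy.
Qed.
End HomogeneousTensors.

Lemma homogM (K : fieldType) (A : salgType K) i j (x y : A) :
  homogeneous i x -> homogeneous j y -> homogeneous (i (+) j) (x * y).
Proof. exact: hpart_mul. Qed.

Lemma homog1 (K : fieldType) (A : salgType K) : homogeneous false (1 : A).
Proof. exact: hpart_one. Qed.

Lemma lin_mull (K : fieldType) (A : algType K) (y : A) : linear (fun x => x * y).
Proof. by move=> a u v; rewrite mulrDl -scalerAl. Qed.

Lemma lin_mulr (K : fieldType) (A : algType K) (x : A) : linear (fun y => x * y).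
Proof. by move=> a u v; rewrite mulrDr -scalerAr. Qed.

Section TensorAlgebra.
Variables (K : fieldType) (A B : salgType K).
Implicit Types s t u : tensor A B.

Let tmul2 (a : A) (b : B) (c : A) (d : B) : tensor A B :=
  \sum_(i : bool) \sum_(j : bool)
    (-1) ^+ (i && j) *: tens (a * hpart j c) (hpart i b * d).

Let tmul2_bilin a b : bilin (tmul2 a b).
Proof.
split=> [d|c] k x y; rewrite /tmul2 scaler_sumr -big_split; apply: eq_bigr => i _ /=;
  rewrite scaler_sumr -big_split; apply: eq_bigr => j _ /=;
  rewrite !scalerA [k * _]mulrC -scalerA -scalerDr; congr (_ *: _).
  by rewrite hpart_linear lin_mulr lin_tensl.
by rewrite lin_mulr lin_tensr.
Qed.

Let tmul1_bilin t : bilin (fun a b => tlift (tmul2 a b) t).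
Proof.
split=> [b|a] k x y; move: t; apply: tensor_ext;
  try by [apply: tlift_linear; apply: tmul2_bilin |
    apply: lin_add; [apply: lin_scaler|]; apply: tlift_linear; apply: tmul2_bilin];
  move=> c d; rewrite !tlift_tens; try exact: tmul2_bilin;
  rewrite /tmul2 scaler_sumr -big_split; apply: eq_bigr => i _ /=;
  rewrite scaler_sumr -big_split; apply: eq_bigr => j _ /=;
  rewrite !scalerA [k * _]mulrC -scalerA -scalerDr; congr (_ *: _).
  by rewrite lin_mull lin_tensl.
by rewrite hpart_linear lin_mull lin_tensr.
Qed.

Lemma tmul_linl t : linear (fun s => tmul s t).
Proof. by apply: tlift_linear; apply: tmul1_bilin. Qed.

Lemma tmul_linr s : linear (fun t => tmul s t).
Proof.
move=> k t u; move: s; apply: tensor_ext.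
- exact: tmul_linl.
- by apply: lin_add; [apply: lin_scaler|]; apply: tmul_linl.
- move=> a b; rewrite /tmul !tlift_tens; try exact: tmul1_bilin.
  exact: (tlift_linear (tmul2_bilin a b)).
Qed.

Lemma tmul_tens a b c d : tmul (tens a b) (tens c d) =
  \sum_(i : bool) \sum_(j : bool)
    (-1) ^+ (i && j) *: tens (a * hpart j c) (hpart i b * d) :> tensor A B.
Proof.
by rewrite [LHS]tlift_tens; [rewrite tlift_tens //; apply: tmul2_bilin|apply: tmul1_bilin].
Qed.

Lemma tmul_homog i j a b c d : homogeneous i b -> homogeneous j c ->
  tmul (tens a b) (tens c d) =
  (-1) ^+ (i && j) *: tens (a * c) (b * d) :> tensor A B.
Proof.
move=> hb hc; rewrite tmul_tens (bigD1 i) //= [X in _ + X]big1; last first.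
  move=> i' /negbTE ii; apply: big1 => j' _.
  by rewrite (homogP i' hb) ii mul0r tens0r scaler0.
rewrite addr0 (bigD1 j) //= [X in _ + X]big1 ?addr0 ?hb ?hc //.
by move=> j' /negbTE jj; rewrite (homogP j' hc) jj mulr0 tens0l scaler0.
Qed.

Lemma tmul1 : left_id (tens 1 1) (@tmul K A B).
Proof.
apply: tensor_hext => [||i j v w hv hw]; [exact: tmul_linr|by []|].
by rewrite (tmul_homog _ _ (homog1 B) hv) scale1r !mul1r.
Qed.

Lemma tmulr1 : right_id (tens 1 1) (@tmul K A B).
Proof.
apply: tensor_hext => [||i j v w hv hw]; [exact: tmul_linl|by []|].
by rewrite (tmul_homog _ _ hw (homog1 A)) andbF scale1r !mulr1.
Qed.

Lemma tmulA : associative (@tmul K A B).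
Proof.
move=> s t u; move: s; apply: tensor_hext => [||i j a b ha hb].
- exact: tmul_linl.
- by apply: (lin_comp (tmul_linl u)); apply: tmul_linl.
move: t; apply: tensor_hext => [||i' j' c d hc hd].
- by apply: (lin_comp (tmul_linr _)); apply: tmul_linl.
- by apply: (lin_comp (tmul_linl u)); apply: tmul_linr.
move: u; apply: tensor_hext => [||i'' j'' e f he hf].
- by apply: (lin_comp (tmul_linr _)); apply: tmul_linr.
- exact: tmul_linr.
rewrite (tmul_homog _ _ hd he) (tmul_homog _ _ hb hc).
rewrite (linZ (tmul_linr _)) (linZ (tmul_linl _)).
rewrite (tmul_homog _ _ hb (homogM hc he)) (tmul_homog _ _ (homogM hb hd) he).
rewrite !mulrA !scalerA -!signr_addb; congr (_ ^+ _ *: _).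
by case: (j); case: (i'); case: (j'); case: (i'').
Qed.

Lemma tens1_neq0 : tens 1 1 != 0 :> tensor A B.
Proof.
have s0 (V : lmodType K) : subsp (fun x : V => x = 0).
  by split=> // a x y -> ->; rewrite scaler0 addr0.
have [|f [hf f1 _]] := @separate K A _ 1 (s0 A); first by apply/eqP/oner_neq0.
apply/eqP => /(congr1 (lsl f)); rewrite lsl_tens // f1 scale1r (lin0 (lsl_linear hf)).
by apply/eqP/oner_neq0.
Qed.

HB.instance Definition _ := GRing.Zmodule_isNzRing.Build (tensor A B)
  tmulA tmul1 tmulr1 (fun s s' t => linD (tmul_linl t) s s')
  (fun s t t' => linD (tmul_linr s) t t') tens1_neq0.

Lemma tmul_scalel k s t : k *: (s * t) = (k *: s) * t.
Proof. by rewrite -(linZ (tmul_linl t)). Qed.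

Lemma tmul_scaler k s t : k *: (s * t) = s * (k *: t).
Proof. by rewrite -(linZ (tmul_linr s)). Qed.

HB.instance Definition _ :=
  GRing.Lmodule_isLalgebra.Build K (tensor A B) tmul_scalel.
HB.instance Definition _ :=
  GRing.Lalgebra_isAlgebra.Build K (tensor A B) tmul_scaler.

Lemma tensor_hpart1 : hpart false (1 : tensor A B) = 1.
Proof. by rewrite (thpart_homog _ (homog1 A) (homog1 B)). Qed.

Lemma tensor_supermul (i j : bool) (x y : tensor A B) :
  let x' := hpart i x in let y' := hpart j y in
  hpart (i (+) j) (x' * y') = x' * y' /\ x' * y' = (-1) ^+ (i && j) *: (y' * x').
Proof.
move=> x' y'; rewrite {}/x' {}/y'; move: x; apply: tensor_hind.
  split; first by rewrite hpart0 mul0r mulr0 hpart0 scaler0.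
  move=> k x x' [h1 h2] [h3 h4]; rewrite hpart_linear lin_mull lin_mulr.
  by rewrite hpart_linear h1 h3; split=> //; rewrite h2 h4 scalerDr !scalerA mulrC.
move=> a b v w hv hw; move: y; apply: tensor_hind.
  split; first by rewrite hpart0 mul0r mulr0 hpart0 scaler0.
  move=> k x x' [h1 h2] [h3 h4]; rewrite hpart_linear lin_mull lin_mulr.
  by rewrite hpart_linear h1 h3; split=> //; rewrite h2 h4 scalerDr !scalerA mulrC.
move=> c d v' w' hv' hw'; rewrite (thpart_homog _ hv hw) (thpart_homog _ hv' hw').
case: eqP => [->|_]; last by rewrite mul0r mulr0 hpart0 scaler0.
case: eqP => [->|_]; last by rewrite mul0r mulr0 hpart0 scaler0.
have e1 : tens v w * tens v' w' = (-1) ^+ (b && c) *: tens (v * v') (w * w') :> tensor A B.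
  exact: tmul_homog.
have e2 : tens v' w' * tens v w = (-1) ^+ (d && a) *: tens (v' * v) (w' * w) :> tensor A B.
  exact: tmul_homog.
split.
  rewrite e1 (linZ (@hpart_linear K _ _)) (thpart_homog _ (homogM hv hv') (homogM hw hw')).
  by rewrite addbACA eqxx.
rewrite e1 e2 (supercomm _ _ _ _ hv hv') (supercomm _ _ _ _ hw hw') tensZl tensZr !scalerA.
rewrite -!signr_addb; congr (_ ^+ _ *: _).
by case: (a); case: (b); case: (c); case: (d).
Qed.

Lemma tensor_homogM (i j : bool) (x y : tensor A B) :
  homogeneous i x -> homogeneous j y -> homogeneous (i (+) j) (x * y).
Proof. by move=> hx hy; have [+ _] := tensor_supermul i j x y; rewrite hx hy. Qed.

Lemma tensor_supercomm (i j : bool) (x y : tensor A B) :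
  homogeneous i x -> homogeneous j y -> x * y = (-1) ^+ (i && j) *: (y * x).
Proof. by move=> hx hy; have [_] := tensor_supermul i j x y; rewrite hx hy. Qed.

HB.instance Definition _ := isSAlg.Build K (tensor A B)
  tensor_hpart1 tensor_homogM tensor_supercomm.

Lemma tensM i j a b c d : homogeneous i b -> homogeneous j c ->
  tens a b * tens c d = (-1) ^+ (i && j) *: tens (a * c) (b * d) :> tensor A B.
Proof. exact: tmul_homog. Qed.
End TensorAlgebra.

(** * Convolution and the antipode *)

Definition shom (K : fieldType) (A R : salgType K) (f : A -> R) : Prop :=
  [/\ linear f, evenmap f, f 1 = 1 & forall x y, f (x * y) = f x * f y].

Section Shom.
Variables (K : fieldType).
Implicit Types A B R : salgType K.

Lemma shom_lin A R (f : A -> R) : shom f -> linear f. Proof. by case. Qed.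
Lemma shom_even A R (f : A -> R) : shom f -> evenmap f. Proof. by case. Qed.
Lemma shom1 A R (f : A -> R) : shom f -> f 1 = 1. Proof. by case. Qed.
Lemma shomM A R (f : A -> R) : shom f -> forall x y, f (x * y) = f x * f y.
Proof. by case. Qed.

Lemma shom_id A : shom (@idfun A). Proof. by []. Qed.

Lemma shom_comp A B R (g : B -> R) (f : A -> B) : shom g -> shom f -> shom (g \o f).
Proof.
move=> [hg eg g1 gM] [hf ef f1 fM]; split.
- exact: lin_comp.
- by move=> b x; rewrite /= ef eg.
- by rewrite /= f1.
- by move=> x y; rewrite /= fM.
Qed.

Lemma shom_salg A R (f : salg_hom A R) : shom f.
Proof.
split; first exact: linearP.
- by move=> b x; rewrite salg_hom_hpart.
- exact: rmorph1.
- exact: rmorphM.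
Qed.

Lemma even_homog A R (f : A -> R) b x : evenmap f -> homogeneous b x ->
  homogeneous b (f x).
Proof. by move=> ef hx; rewrite /homogeneous -ef hx. Qed.

Definition iota1 A B (a : A) : tensor A B := tens a 1.
Definition iota2 A B (b : B) : tensor A B := tens 1 b.

Lemma shom_iota1 A B : shom (@iota1 A B).
Proof.
split=> [|b x||x y]; [exact: lin_tensl| |by []|].
  rewrite /iota1 [RHS]thpart_tens big_bool /= !(homogP _ (homog1 B)).
  by case: b; rewrite /= ?tens0r ?addr0 ?add0r.
rewrite -[y]hpart_bool mulr_sumr /iota1 !(lin_sum (lin_tensl _)) mulr_sumr.
by apply: eq_bigr => j _; rewrite (tensM _ _ (homog1 B) (hpart_homog j y)) scale1r mulr1.
Qed.

Lemma shom_iota2 A B : shom (@iota2 A B).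
Proof.
split=> [|b x||x y]; [exact: lin_tensr| |by []|].
  rewrite /iota2 [RHS]thpart_tens big_bool /= !(homogP _ (homog1 A)).
  by case: b; rewrite /= ?tens0l ?addr0 ?add0r.
rewrite -[x]hpart_bool mulr_suml /iota2 !(lin_sum (lin_tensr _)) mulr_suml.
apply: eq_bigr => j _; rewrite (tensM _ _ (hpart_homog j x) (homog1 A)).
by rewrite andbF scale1r mulr1.
Qed.

Lemma iota12 A B (a : A) (b : B) : iota1 B a * iota2 A b = tens a b.
Proof. by rewrite (tensM _ _ (homog1 B) (homog1 A)) scale1r mulr1 mul1r. Qed.

Definition cv A B R (f : A -> R) (g : B -> R) : tensor A B -> R :=
  tlift (fun a b => f a * g b).

Lemma bilin_mul (V W : lmodType K) (R : algType K) (f : V -> R) (g : W -> R) :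
  linear f -> linear g -> bilin (fun a b => f a * g b).
Proof.
move=> hf hg; split=> [w|v]; first exact: (lin_comp (lin_mull (g w)) hf).
exact: (lin_comp (lin_mulr (f v)) hg).
Qed.

Section Cv.
Variables (A B R : salgType K) (f : A -> R) (g : B -> R).
Hypotheses (hf : linear f) (hg : linear g).

Lemma cv_lin : linear (cv f g).
Proof. exact/tlift_linear/bilin_mul. Qed.

Lemma cv_tens a b : cv f g (tens a b) = f a * g b.
Proof. exact/tlift_tens/bilin_mul. Qed.

Lemma cv_sum n (v : 'I_n -> A) (w : 'I_n -> B) :
  cv f g (\sum_i tens (v i) (w i)) = \sum_i f (v i) * g (w i).
Proof. by rewrite (lin_sum cv_lin); apply: eq_bigr => i _; apply: cv_tens. Qed.

Lemma cv_even : evenmap f -> evenmap g -> evenmap (cv f g).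
Proof.
move=> ef eg b; apply: tensor_hext.
- exact: (lin_comp cv_lin (hpart_linear b)).
- exact: (lin_comp (hpart_linear b) cv_lin).
move=> i j v w hv hw; rewrite (thpart_homog _ hv hw) cv_tens.
rewrite (homogP _ (homogM (even_homog ef hv) (even_homog eg hw))).
by case: eqP => _; rewrite ?cv_tens // (lin0 cv_lin).
Qed.
End Cv.

Lemma cv_comp A B R R' (f : A -> R) (g : B -> R) (h : R -> R') :
  linear f -> linear g -> linear h -> (forall x y, h (x * y) = h x * h y) ->
  forall t, h (cv f g t) = cv (h \o f) (h \o g) t.
Proof.
move=> hf hg hh hM t; rewrite /cv lin_tlift //; last exact: bilin_mul.
by apply: tlift_eq => a b; rewrite hM.
Qed.

Definition inr_ (V W : lmodType K) (H : W -> Prop) (t : tensor V W) : Prop :=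
  exists n (v : 'I_n -> V) (w : 'I_n -> W),
    t = \sum_i tens (v i) (w i) /\ forall i, H (w i).

(* The sign rule makes [cv f g] semilinear for the left action of [A (x) H]. *)
Lemma cvM A B R (f : A -> R) (g' g : B -> R) (H M : B -> Prop) :
  shom f -> linear g' -> evenmap g' -> linear g -> graded H ->
  (forall h m, H h -> M m -> g (h * m) = g' h * g m) ->
  forall s t, inr_ H s -> inr_ M t ->
    cv f g (s * t) = cv f g' s * cv f g t.
Proof.
move=> [hf ef _ fM] hg' eg' hg gH gM s t [n [a [h [-> Hh]]]] [m [c [z [-> Mz]]]].
rewrite !cv_sum // !mulr_suml (lin_sum (cv_lin hf hg)).
apply: eq_bigr => k _; rewrite !mulr_sumr (lin_sum (cv_lin hf hg)).
apply: eq_bigr => l _; rewrite [_ * _]tmul_tens (lin_sum (cv_lin hf hg)).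
transitivity (f (a k) * (g' (h k) * f (c l)) * g (z l)); last by rewrite !mulrA.
rewrite -[h k in RHS]hpart_bool -[c l in RHS]hpart_bool.
rewrite (lin_sum hg') (lin_sum hf) mulr_suml mulr_sumr mulr_suml; apply: eq_bigr => i _.
rewrite (lin_sum (cv_lin hf hg)) mulr_sumr mulr_sumr mulr_suml.
apply: eq_bigr => j _; rewrite (linZ (cv_lin hf hg)) cv_tens // gM; [|exact: gH|exact: Mz].
have -> := supercomm _ _ _ _ (even_homog eg' (hpart_homog i (h k)))
  (even_homog ef (hpart_homog j (c l))).
by rewrite fM -!scalerAr -!scalerAl !mulrA.
Qed.

Lemma inr_True (V W : lmodType K) (t : tensor V W) : inr_ (fun=> True) t.
Proof. by have [n [v [w [-> _ _]]]] := tensor_rep t; exists n, v, w. Qed.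

Lemma shom_cv A B R (f : A -> R) (g : B -> R) : shom f -> shom g -> shom (cv f g).
Proof.
move=> sf sg; have [hf ef f1 fM] := sf; have [hg eg g1 gM] := sg; split.
- exact: cv_lin.
- exact: cv_even.
- by rewrite [LHS]cv_tens // f1 g1 mulr1.
- by move=> s t; apply: (cvM sf hg eg hg (H := fun=> True) (M := fun=> True)) => //;
    apply: inr_True.
Qed.
End Shom.

Section Convolution.
Variables (K : fieldType) (A : hopfSAlgType K).

Lemma counit_lin : linear (counit : A -> K^o).
Proof. exact: counit_scalar. Qed.

Lemma comul_lin : linear (@comul K A). Proof. exact: comul_linear. Qed.

Definition eps (R : salgType K) (x : A) : R := (counit x)%:A.

Lemma shom_eps (R : salgType K) : shom (eps R).
Proof.
split.
- exact: (@lin_scalel K A R counit 1 counit_lin).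
- move=> b x; rewrite /eps (linZ (@hpart_linear _ _ _)) (homogP _ (homog1 R)).
  case: b; first by rewrite counit_odd scale0r scaler0.
  rewrite eqxx -{2}(hpart_sum x) (linD counit_lin) counit_odd.
  by rewrite [_ + 0]addr0.
- by rewrite /eps counit1 scale1r.
- by move=> x y; rewrite /eps counitM -scalerAl mul1r scalerA.
Qed.

Lemma shom_comul : shom (@comul K A).
Proof.
split; first exact: comul_linear.
- by move=> b x; rewrite comul_hpart.
- exact: comul1.
- exact: comulM.
Qed.

Lemma pt_mulE (R : salgType K) (f g : A -> R) x : pt_mul f g x = cv f g (comul x).
Proof. by []. Qed.

Lemma shom_mul (R : salgType K) (f g : A -> R) : shom f -> shom g -> shom (pt_mul f g).
Proof. by move=> hf hg; apply: (shom_comp (shom_cv hf hg) shom_comul). Qed.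

Lemma pt_mul_lin (R : salgType K) (f g : A -> R) : linear f -> linear g ->
  linear (pt_mul f g).
Proof. by move=> hf hg; apply: (lin_comp (cv_lin hf hg) comul_lin). Qed.

Lemma eq_pt_mul (R : salgType K) (f f' g g' : A -> R) : f =1 f' -> g =1 g' ->
  pt_mul f g =1 pt_mul f' g'.
Proof. by move=> ef eg x; apply: tlift_eq => a b; rewrite ef eg. Qed.

Lemma pt_mulA (R : salgType K) (f g h : A -> R) :
  linear f -> linear g -> linear h ->
  pt_mul (pt_mul f g) h =1 pt_mul f (pt_mul g h).
Proof.
move=> hf hg hh x.
pose T := tlift (fun a t => f a * cv g h t) : tensor A (tensor A A) -> R.
have bT : bilin (fun a t => f a * cv g h t) by apply: bilin_mul => //; apply: cv_lin.
have hT : linear T by apply: tlift_linear.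
have -> : pt_mul f (pt_mul g h) x = T (tmap idfun comul (comul x)).
  rewrite [RHS](lin_tlift hT).
    by apply: tlift_eq => a b; rewrite [RHS]tlift_tens.
  by apply: bilin_tens; [apply: lin_id|apply: comul_lin].
rewrite -comulA [RHS](lin_tlift (lin_comp hT (@tassoc_linear _ _ _ _))); last first.
  by apply: bilin_tens; [apply: comul_lin|apply: lin_id].
apply: tlift_eq => a b; rewrite /= tassoc_tens (lin_tlift hT); last first.
  exact: bilin_assoc_pure.
rewrite pt_mulE /cv (lin_tlift (lin_mull (h b))); last exact: bilin_mul.
by apply: tlift_eq => u v; rewrite /T tlift_tens // cv_tens // mulrA.
Qed.

Lemma pt_mul1l (R : salgType K) (f : A -> R) : linear f -> pt_mul (eps R) f =1 f.
Proof.
move=> hf x; rewrite -[in RHS](counitl x) (lin_tlift hf); last first.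
  exact: (bilin_scalel _ counit_lin).
by apply: tlift_eq => a b; rewrite /eps -scalerAl mul1r (linZ hf).
Qed.

Lemma pt_mul1r (R : salgType K) (f : A -> R) : linear f -> pt_mul f (eps R) =1 f.
Proof.
move=> hf x; rewrite -[in RHS](counitr x) (lin_tlift hf); last first.
  exact: (bilin_scaler _ counit_lin).
by apply: tlift_eq => a b; rewrite /eps -scalerAr mulr1 (linZ hf).
Qed.

Lemma pt_mul_comp (R R' : salgType K) (f g : A -> R) (h : R -> R') :
  linear f -> linear g -> linear h -> (forall x y, h (x * y) = h x * h y) ->
  h \o pt_mul f g =1 pt_mul (h \o f) (h \o g).
Proof. by move=> hf hg hh hM x; apply: cv_comp. Qed.

Lemma antipode_lin : linear (@antipode K A). Proof. exact: antipode_linear. Qed.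

Lemma pt_mulVl (R : salgType K) (f : A -> R) : shom f ->
  pt_mul (f \o antipode) f =1 eps R.
Proof.
move=> [hf _ f1 fM] x; rewrite pt_mulE.
transitivity (f (cv antipode idfun (comul x))).
  by rewrite cv_comp //; apply: antipode_lin.
by rewrite [cv _ _ _]antipodel (linZ hf) f1.
Qed.

Lemma pt_mulVr (R : salgType K) (f : A -> R) : shom f ->
  pt_mul f (f \o antipode) =1 eps R.
Proof.
move=> [hf _ f1 fM] x; rewrite pt_mulE.
transitivity (f (cv idfun antipode (comul x))).
  by rewrite cv_comp //; apply: antipode_lin.
by rewrite [cv _ _ _]antipoder (linZ hf) f1.
Qed.

Lemma pt_inv_unique (R : salgType K) (f l r : A -> R) :
  linear f -> linear l -> linear r ->
  pt_mul l f =1 eps R -> pt_mul f r =1 eps R -> l =1 r.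
Proof.
move=> hf hl hr lf fr x; rewrite -(pt_mul1r hl) -(pt_mul1l hr).
transitivity (pt_mul l (pt_mul f r) x); first exact: eq_pt_mul.
by rewrite -pt_mulA //; apply: eq_pt_mul.
Qed.

Lemma comul_iota : comul =1 pt_mul (@iota1 _ A A) (@iota2 _ A A).
Proof.
move=> x; rewrite pt_mulE; move: (comul x) => t.
transitivity (idfun t) => //; move: t; apply: tensor_ext => //.
  by apply: cv_lin; [case: (shom_iota1 A A)|case: (shom_iota2 A A)].
move=> a b; rewrite cv_tens ?iota12 //.
  by case: (shom_iota1 A A).
by case: (shom_iota2 A A).
Qed.

(* The algebra endomorphism [a (x) b |-> a b_1 (x) b_2] of [A (x) A] is bijective
   and its inverse restricts to [b |-> S b_1 (x) b_2], so [S] is multiplicative. *)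
Lemma shom_antipode : shom (@antipode K A).
Proof.
have s1 := shom_iota1 A A; have s2 := shom_iota2 A A.
have [h1 _ _ M1] := s1; have [h2 _ _ M2] := s2.
have hS := antipode_lin; have hD := comul_lin.
have h1S := lin_comp h1 hS.
pose u := pt_mul (@iota1 _ A A \o antipode) (@iota2 _ A A).
have hu : linear u by apply: pt_mul_lin.
pose can := cv (@iota1 _ A A) (@comul K A).
pose can' := cv (@iota1 _ A A) u.
have scan : shom can by apply: shom_cv => //; apply: shom_comul.
have [hc _ c1 cM] := scan.
have hc' : linear can' by apply: cv_lin.
have can1 a : can (iota1 A a) = iota1 A a.
  by rewrite [LHS]cv_tens // comul1 (mulr1 (iota1 A a)).
have can2 b : can (iota2 A b) = comul b.
  by rewrite [LHS]cv_tens // [iota1 A 1](shom1 s1) mul1r.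
have canu b : can (u b) = iota2 A b.
  rewrite [LHS](pt_mul_comp h1S h2 hc cM b).
  rewrite (@eq_pt_mul _ _ (@iota1 _ A A \o antipode) _
    (pt_mul (@iota1 _ A A) (@iota2 _ A A))); last first.
  - by move=> c; rewrite /= can2 comul_iota.
  - by move=> c; rewrite /= can1.
  rewrite -pt_mulA // (@eq_pt_mul _ _ (eps _) _ (@iota2 _ A A)) ?pt_mul1l //.
  exact: pt_mulVl.
have cancan' t : can (can' t) = t.
  transitivity (idfun t) => //; move: t; apply: tensor_ext => //.
    exact: lin_comp.
  by move=> a b; rewrite [can' _]cv_tens // cM can1 canu iota12.
have can'comul b : can' (comul b) = iota2 A b.
  rewrite -[LHS]/(pt_mul _ u b) -pt_mulA //.
  rewrite (@eq_pt_mul _ _ (eps _) _ (@iota2 _ A A)) ?pt_mul1l //.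
  exact: pt_mulVr.
have can'M a t : can' (iota1 A a * t) = iota1 A a * can' t.
  move: t; apply: tensor_ext.
  - exact: (lin_comp hc' (lin_mulr _)).
  - exact: (lin_comp (lin_mulr _) hc').
  - move=> c d; have -> : iota1 A a * tens c d = tens (a * c) d.
      by rewrite -(iota12 c d) mulrA -M1 iota12.
    by rewrite /can' !cv_tens // M1 mulrA.
have can'can t : can' (can t) = t.
  transitivity (idfun t) => //; move: t; apply: tensor_ext => //.
    exact: lin_comp.
  by move=> a b; rewrite [can _]cv_tens // can'M can'comul iota12.
have can'mul s t : can' (s * t) = can' s * can' t.
  by rewrite -[RHS]can'can cM !cancan'.
pose E := cv (@idfun A) (@eps A).
have [hE _ E1 EM] : shom E by apply: shom_cv; [apply: shom_id|apply: shom_eps].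
have he := shom_lin (shom_eps A).
have Ei1 a : E (iota1 A a) = a.
  by rewrite [LHS]cv_tens // (shom1 (shom_eps _)) mulr1.
have Ei2 a : E (iota2 A a) = eps A a by rewrite [LHS]cv_tens // mul1r.
have SE b : antipode b = E (can' (iota2 A b)).
  rewrite [can' _]cv_tens // [iota1 A 1](shom1 s1) mul1r.
  rewrite [RHS](pt_mul_comp h1S h2 hE EM b).
  rewrite (@eq_pt_mul _ _ antipode _ (eps _)) ?pt_mul1r //.
  by move=> c; apply: Ei1.
split=> // [b x||x y]; first by rewrite antipode_hpart.
  have := antipodel (1 : A); rewrite comul1 counit1 scale1r tlift_tens ?mulr1 //.
  by apply: (@bilin_mul _ _ _ _ antipode idfun).
by rewrite !SE M2 can'mul EM.
Qed.

(** Both sides are convolution inverses of the point [comul] of A (x) A. As [comul] is the product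
    of the points [iota1] and [iota2], its inverse is the product of their inverses in the opposite
    order; the sign of the flip is hidden in the multiplication of A (x) A. *)
Lemma comul_antipode :
  @comul K A \o antipode =1 pt_mul (@iota2 _ A A \o antipode) (@iota1 _ A A \o antipode).
Proof.
have s1 := shom_iota1 A A; have s2 := shom_iota2 A A; have sD := shom_comul.
have [h1 _ _ _] := s1; have [h2 _ _ _] := s2; have [hD _ _ _] := sD.
have h1S := lin_comp h1 antipode_lin; have h2S := lin_comp h2 antipode_lin.
apply: (@pt_inv_unique _ (@comul K A)) => //; try exact: pt_mul_lin.
- exact: (lin_comp hD antipode_lin).
- exact: pt_mulVl.
move=> x; rewrite (eq_pt_mul comul_iota (fun=> erefl)) pt_mulA //; last exact: pt_mul_lin.
rewrite (@eq_pt_mul _ _ (@iota1 _ A A) _ (@iota1 _ A A \o antipode)) //.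
  exact: pt_mulVr.
move=> y; rewrite -pt_mulA // (@eq_pt_mul _ _ (eps _) _ (@iota1 _ A A \o antipode)) //.
  by rewrite pt_mul1l.
exact: pt_mulVr.
Qed.
End Convolution.

Section HopfHom.
Variables (K : fieldType) (A B : hopfSAlgType K) (i : hopf_hom B A).

Lemma shom_hopf : shom i. Proof. exact: shom_salg. Qed.

Lemma hopf_pt_mul (R : salgType K) (f g : A -> R) : linear f -> linear g ->
  pt_mul f g \o i =1 pt_mul (f \o i) (g \o i).
Proof.
have [hi _ _ _] := shom_hopf.
move=> hf hg x; rewrite /= pt_mulE hopf_hom_comul.
rewrite (lin_tlift (cv_lin hf hg)); last exact: bilin_tens.
by apply: tlift_eq => a b; rewrite cv_tens.
Qed.

Lemma hopf_antipode x : i (antipode x) = antipode (i x).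
Proof.
have [hi _ _ _] := shom_hopf; have hS := @antipode_lin K A.
apply: (@pt_inv_unique _ B A i (i \o antipode) (antipode \o i)) => //.
- exact: (lin_comp hi (@antipode_lin K B)).
- exact: lin_comp.
- exact: pt_mulVl shom_hopf.
- move=> y; rewrite -(@hopf_pt_mul _ idfun antipode) //= (pt_mulVr (shom_id A)).
  by rewrite /eps hopf_hom_counit.
Qed.
End HopfHom.

(** * Elimination over supercommutative superalgebras *)

Lemma addb_cancel (b c d : bool) : (b (+) c) (+) (c (+) d) = b (+) d.
Proof. by case: b c d => [] [] []. Qed.

Section Elimination.
Variables (L : nzRingType) (hom : bool -> L -> Prop) (J : L -> Prop).
Hypotheses (hom0 : forall b, hom b 0) (hom1 : hom false 1)
  (homD : forall b x y, hom b x -> hom b y -> hom b (x + y))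
  (homN : forall b x, hom b x -> hom b (- x))
  (homM : forall b c x y, hom b x -> hom c y -> hom (b (+) c) (x * y))
  (homC : forall x, hom false x -> forall y, x * y = y * x).
Hypotheses (J0 : J 0) (JD : forall x y, J x -> J y -> J (x + y))
  (JMl : forall x y, J y -> J (x * y)) (JMr : forall x y, J x -> J (x * y)).

Let JN x : J x -> J (- x). Proof. by move=> h; rewrite -mulN1r; apply: JMl. Qed.

Let hom_sum b n (F : 'I_n -> L) : (forall i, hom b (F i)) -> hom b (\sum_i F i).
Proof. by move=> h; apply: big_ind => //; apply: homD. Qed.

Let central_scale m n p (a : L) (X : 'M_(m, n)) (Y : 'M_(n, p)) :
  hom false a -> X *m (a *: Y) = a *: (X *m Y).
Proof.
move=> ha; apply/matrixP => i j; rewrite !mxE mulr_sumr; apply: eq_bigr => k _.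
by rewrite mxE !mulrA (homC ha).
Qed.

Let central_scalar m n (a : L) (X : 'M_(m, n)) : hom false a -> X *m a%:M = a *: X.
Proof.
move=> ha; have -> : a%:M = a *: 1%:M :> 'M_n by rewrite scalemx1.
by rewrite central_scale // mulmx1.
Qed.

(* A substitute for the adjugate: Gaussian elimination only uses the central
   diagonal entries. *)
Lemma elimination n (C : 'M[L]_n) (deg : 'I_n -> bool) (s : L) :
  hom false s -> (forall i j, hom (deg i (+) deg j) (C i j)) ->
  (forall i j, J (C i j - s *+ (i == j))) ->
  exists (D : 'M[L]_n) (f : L) (N : nat),
    [/\ D *m C = f%:M, hom false f, J (f - s ^+ N) &
        forall i j, hom (deg i (+) deg j) (D i j)].
Proof.
elim: n C deg s => [|n IHn] C deg s hs hC JC.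
  exists C, 1, 0%N; split=> //; last by rewrite expr0 subrr.
  by apply/matrixP; case.
rewrite -[n.+1]/(1 + n)%N in C deg hC JC *.
pose a := C (lshift n ord0) (lshift n ord0).
pose u := ursubmx C; pose v := dlsubmx C; pose C' := drsubmx C.
have eC : C = block_mx a%:M u v C'.
  rewrite -[LHS]submxK; congr block_mx.
  by rewrite [LHS]mx11_scalar !mxE.
pose d0 := deg (lshift n ord0); pose d' i := deg (rshift 1 i).
have ha : hom false a by have := hC (lshift n ord0) (lshift n ord0); rewrite addbb.
have hu i j : hom (d0 (+) d' j) (u i j).
  by rewrite !mxE ord1; apply: hC.
have hv i j : hom (d' i (+) d0) (v i j).
  by rewrite !mxE ord1; apply: hC.
have hC' i j : hom (d' i (+) d' j) (C' i j) by rewrite !mxE; apply: hC.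
have Ja : J (a - s) by have := JC (lshift n ord0) (lshift n ord0); rewrite eqxx.
have Jv i j : J (v i j).
  rewrite !mxE ord1; have := JC (rshift 1 i) (lshift n ord0).
  by rewrite eq_rlshift subr0.
have JC' i j : J (C' i j - s *+ (i == j)).
  by rewrite !mxE; have := JC (rshift 1 i) (rshift 1 j); rewrite eq_rshift.
clearbody a u v C'; clear hC JC.
(* The Schur complement of the pivot a, cleared of denominators. Modulo J one has a = s, v = 0 and
   C' = s, so it reduces to s s times the identity. *)
have [] := IHn (a *: C' - v *m u) d' (s * s).
- exact: (homM hs hs).
- move=> i j; rewrite !mxE; apply: homD; first exact: (homM ha (hC' i j)).
  apply: homN; apply: hom_sum => k.
  by have := homM (hv i k) (hu k j); rewrite addb_cancel.
- move=> i j; rewrite !mxE.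
  have -> : a * C' i j - \sum_k v i k * u k j - (s * s) *+ (i == j) =
      (a - s) * C' i j + s * (C' i j - s *+ (i == j)) + - \sum_k v i k * u k j.
    rewrite mulrBl mulrBr mulrnAr addrA subrK [RHS]addrAC.
    by [].
  apply: JD; first by apply: JD; [apply: JMr|apply: JMl].
  by apply: JN; apply: big_ind => // k _; apply: JMr.
move=> D' [f' [N' [eD' hf' Jf' hD']]].
(* The block inverse through the Schur complement, multiplied by f' a. Modulo J, f' is (s s)^N' and
   a is s, whence the exponent 2N' + 1. *)
exists (block_mx (f'%:M + u *m D' *m v) (- (a *: (u *m D')))
   (- (a *: (D' *m v))) ((a * a) *: D')), (f' * a), (2 * N').+1.
have hdd i j k x y : hom (i (+) j) x -> hom (j (+) k) y -> hom (i (+) k) (x * y).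
  by move=> hx hy; have := homM hx hy; rewrite addb_cancel.
split.
- rewrite eC mulmx_block [RHS]scalar_mx_block; congr block_mx.
  + rewrite central_scalar // mulNmx -scalemxAl scalerDr addrK.
    by rewrite scale_scalar_mx (homC ha).
  + rewrite mulmxDl mul_scalar_mx mulNmx -scalemxAl -!mulmxA.
    rewrite -(central_scale u (D' *m C') ha) -addrA -mulmxBr.
    have -> : D' *m (v *m u) - a *: (D' *m C') = - f'%:M.
      by rewrite -eD' mulmxBr opprB central_scale.
    by rewrite mulmxN central_scalar // subrr.
  + by rewrite mulNmx central_scalar // -scalemxAl scalerA addNr.
  + rewrite mulNmx -!scalemxAl -scalerA -mulmxA addrC -scalerBr.
    by rewrite -(central_scale D' C' ha) -mulmxBr eD' scale_scalar_mx (homC ha).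
- exact: (homM hf' ha).
- have -> : f' * a - s ^+ (2 * N').+1 =
      (f' - (s * s) ^+ N') * a + (s * s) ^+ N' * (a - s).
    by rewrite mulrBl mulrBr addrA subrK exprSr exprM expr2.
  by apply: JD; [apply: JMr|apply: JMl].
- move=> i j; case: (split_ordP i) => i' ->; case: (split_ordP j) => j' ->;
    rewrite ?block_mxEul ?block_mxEur ?block_mxEdl ?block_mxEdr ?ord1 !mxE.
  + rewrite addbb mulr1n; apply: homD => //; apply: hom_sum => k.
    rewrite -(addbb d0); apply: (hdd _ (d' k)); last exact: hv.
    by rewrite mxE; apply: hom_sum => l; apply: (hdd _ (d' l)).
  + apply: homN; apply: (homM ha (c := d0 (+) d' j')).
    by apply: hom_sum => k; apply: (hdd _ (d' k)).
  + apply: homN; apply: (homM ha (c := d' i' (+) d0)).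
    by apply: hom_sum => k; apply: (hdd _ (d' k)).
  + exact: (homM (homM ha ha) (hD' i' j')).
Qed.
End Elimination.

Section SuperLinearAlgebra.
Variables (K : fieldType) (A : salgType K).

Lemma homog0 (V : superModType K) b : homogeneous b (0 : V).
Proof. exact: hpart0. Qed.

Lemma homogD (V : superModType K) b (x y : V) :
  homogeneous b x -> homogeneous b y -> homogeneous b (x + y).
Proof. by move=> hx hy; rewrite /homogeneous hpartD hx hy. Qed.

Lemma homogN (V : superModType K) b (x : V) : homogeneous b x -> homogeneous b (- x).
Proof. by move=> hx; rewrite /homogeneous (linN (hpart_linear b)) hx. Qed.

Lemma homogZ (V : superModType K) b a (x : V) :
  homogeneous b x -> homogeneous b (a *: x).
Proof. by move=> hx; rewrite /homogeneous (linZ (hpart_linear b)) hx. Qed.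

Lemma homog_sum (V : superModType K) b I (r : seq I) (P : pred I) (F : I -> V) :
  (forall i, P i -> homogeneous b (F i)) -> homogeneous b (\sum_(i <- r | P i) F i).
Proof. by move=> h; apply: big_ind => //; [apply: homog0|apply: homogD]. Qed.

Lemma even_central (x y : A) : homogeneous false x -> x * y = y * x.
Proof.
move=> hx; rewrite -(hpart_bool y) mulr_suml mulr_sumr; apply: eq_bigr => b _.
by rewrite (supercomm _ _ _ _ hx (hpart_homog b y)) scale1r.
Qed.

Lemma hpartMr b c (x y : A) : homogeneous c y ->
  hpart b (x * y) = hpart (b (+) c) x * y.
Proof.
move=> hy; rewrite -{1}(hpart_bool x) mulr_suml (lin_sum (hpart_linear b)).
rewrite (bigD1 (b (+) c)) //= [X in _ + X]big1 ?addr0.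
  by rewrite (homogP _ (homogM (hpart_homog _ x) hy)) -addbA addbb addbF eqxx.
move=> d /negbTE hd; rewrite (homogP _ (homogM (hpart_homog _ x) hy)).
case: eqP => // e; move: hd; rewrite e -addbA addbb addbF eqxx.
by [].
Qed.

Lemma mul_even_scalar m n (y : 'M[A]_(m, n)) (s : A) : homogeneous false s ->
  y *m s%:M = s *: y.
Proof.
move=> hs; apply/matrixP => i j; rewrite !mxE (bigD1 j) //= big1 ?addr0.
  by rewrite mxE eqxx mulr1n -(even_central _ hs).
by move=> k kj; rewrite mxE (negbTE kj) mulr0n mulr0.
Qed.

(* Over a commutative ring this is [det D * det B = s ^ r]. *)
Lemma right_cancel r (B D : 'M[A]_r) (s : A) (deg : 'I_r -> bool) :
  homogeneous false s -> (forall i j, homogeneous (deg i (+) deg j) (D i j)) ->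
  D *m B = s%:M ->
  exists N, forall x : 'rV[A]_r, x *m B = 0 -> (s ^+ N) *: x = 0.
Proof.
move=> hs hD DB.
(* [elimination] is applied over A[X], modulo X, to C = s - X D; it gives E with E C = f and
   constant coefficient f_0 = s^N. Put z_n = x E_n. Comparing coefficients, f_n x = s z_n - z_(n-1)
   D. Multiplying on the right by B, where x B = 0 and D B = s, shows that s z_(n+1) = 0 implies s
   z_n = 0. As z_n = 0 for large n, descending induction gives s z_0 = 0, that is s^N x = 0. *)
pose hom b (p : {poly A}) := forall n, homogeneous b p`_n.
pose J (p : {poly A}) := p`_0 = 0.
pose C : 'M[{poly A}]_r := \matrix_(i, j) (s%:P *+ (i == j) - 'X * (D i j)%:P).
have [|||||||||||||E [f [N [EC hf Jf _]]]] :=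
  @elimination {poly A} hom J _ _ _ _ _ _ _ _ _ _ r C deg s%:P.
- by move=> b n; rewrite coef0; apply: homog0.
- move=> [|n]; rewrite coef1 /=; [exact: homog1|exact: homog0].
- by move=> b p q hp hq n; rewrite coefD; apply: homogD.
- by move=> b p hp n; rewrite coefN; apply: homogN.
- move=> b c p q hp hq n; rewrite coefM; apply: homog_sum => i _.
  exact: homogM.
- move=> p hp q; apply/polyP => n; rewrite coefM coefMr; apply: eq_bigr => i _.
  exact: even_central.
- exact: coef0.
- by move=> p q hp hq; rewrite /J coefD hp hq addr0.
- by move=> p q hq; rewrite /J coef0M hq mulr0.
- by move=> p q hp; rewrite /J coef0M hp mul0r.
- by move=> [|n]; rewrite coefC //=; apply: homog0.
- move=> i j n; rewrite mxE coefB coefMn coefXM coefC.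
  apply: homogD.
    have [->|_] := eqVneq i j; last by rewrite mulr0n; apply: homog0.
    by rewrite addbb mulr1n; case: (n == 0%N) => //; apply: homog0.
  apply: homogN; case: n => [|n] /=; first exact: homog0.
  rewrite coefC; case: (n == 0%N) => //; exact: homog0.
- move=> i j; rewrite /J mxE coefB coefB coefXM /= subr0 subrr.
  by [].
exists N.+1 => x xB.
pose z n : 'rV[A]_r := x *m (\matrix_(i, j) (E i j)`_n).
have key n : f`_n *: x = s *: z n - (if n is m.+1 then z m *m D else 0).
  have e : (\matrix_(i, j) (E i j)`_n) *m s%:M -
      (if n is m.+1 then (\matrix_(i, j) (E i j)`_m) *m D else 0) = (f`_n)%:M.
    apply/matrixP => i j; have /(congr1 (fun p : {poly A} => p`_n)) := congr1 (fun M : 'M_r => M i j) EC.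
    rewrite !mxE coefMn => <-; rewrite coef_sum.
    have -> : (if n is m.+1 then (\matrix_(i, j) (E i j)`_m) *m D else 0) i j =
        \sum_k (if n is m.+1 then (E i k)`_m * D k j else 0).
      case: n => [|m]; first by rewrite mxE big1.
      by rewrite mxE; apply: eq_bigr => k _; rewrite mxE.
    rewrite -sumrB; apply: eq_bigr => k _; rewrite !mxE mulrBr coefB.
    congr (_ - _).
      by case: eqP => _; rewrite ?mulr0n ?mulr0 ?coef0 // !mulr1n coefMC.
    rewrite mulrA commr_polyX -mulrA coefXM; case: n => // m /=.
    by rewrite coefMC.
  rewrite -(mul_even_scalar x (hf n)) -e mulmxBr; congr (_ - _).
    by rewrite mulmxA mul_even_scalar.
  by case: (n) => [|m]; rewrite ?mulmx0 // mulmxA.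
have step n : s *: z n.+1 = 0 -> s *: z n = 0.
  move=> sz; have := congr1 (fun y : 'rV_r => y *m B) (key n.+1).
  rewrite /= -scalemxAl xB scaler0 sz add0r mulNmx -mulmxA DB => /esym/eqP.
  by rewrite oppr_eq0 mul_even_scalar // => /eqP.
have top : s *: z (\max_i \max_j size (E i j))%N = 0.
  suff -> : z (\max_i \max_j size (E i j))%N = 0 by rewrite scaler0.
  rewrite /z [X in _ *m X](_ : _ = 0) ?mulmx0 //; apply/matrixP => i j; rewrite !mxE.
  by apply: nth_default; apply: leq_trans (leq_bigmax i); apply: (leq_bigmax j).
have sz0 : s *: z 0%N = 0.
  by move: top; elim: (\max_i _)%N => // n IHn /step.
have := key 0%N; rewrite subr0 sz0.
have -> : f`_0 = s ^+ N.
  apply/eqP; rewrite -subr_eq0; apply/eqP; rewrite -[RHS]Jf coefB; congr (_ - _).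
  by elim: (N) => [|n IHn]; rewrite ?expr0 ?coef1 // !exprS coef0M coefC IHn.
by move=> e; rewrite exprS -scalerA e scaler0.
Qed.
End SuperLinearAlgebra.

(** * Slices of the comultiplication *)

Section GradedSlices.
Variables (K : fieldType) (V W : superModType K).

Definition fdeg (X : superModType K) (d : bool) (f : X -> K^o) : Prop :=
  forall b x, f (hpart b x) = if b == d then f x else 0.

Lemma fdeg_part (X : superModType K) d (f : X -> K^o) : linear f ->
  linear (f \o hpart d) /\ fdeg d (f \o hpart d).
Proof.
move=> hf; split; first by apply: lin_comp => //; apply: hpart_linear.
by move=> b x; rewrite /= hpartK eq_sym; case: eqP => [->|_] //; rewrite (lin0 hf).
Qed.

Lemma rsl_fdeg d (w : W -> K^o) b (t : tensor V W) : linear w -> fdeg d w ->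
  rsl w (hpart b t) = hpart (b (+) d) (rsl w t).
Proof.
move=> hw ew; move: t; apply: tensor_hext.
- exact: (lin_comp (rsl_linear hw) (hpart_linear b)).
- exact: (lin_comp (hpart_linear _) (rsl_linear hw)).
move=> i j x y hx hy; rewrite (thpart_homog _ hx hy) (rsl_tens _ _ hw).
rewrite (linZ (hpart_linear _)) (homogP _ hx).
have -> : w y = if j == d then w y else 0 by rewrite -ew hy.
have [jd|jd] := eqVneq j d.
  rewrite jd; have -> : (b (+) d == i) = (b == i (+) d) by move: (b) (i) (d) => [] [] [].
  case: ifP => _; last by rewrite (lin0 (rsl_linear hw)) scaler0.
  rewrite rsl_tens //.
rewrite scale0r; case: ifP => _; last by rewrite (lin0 (rsl_linear hw)).
by rewrite rsl_tens // -hy ew (negbTE jd) scale0r.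
Qed.

Lemma lsl_fdeg d (w : V -> K^o) b (t : tensor V W) : linear w -> fdeg d w ->
  lsl w (hpart b t) = hpart (b (+) d) (lsl w t).
Proof.
move=> hw ew; move: t; apply: tensor_hext.
- exact: (lin_comp (lsl_linear hw) (hpart_linear b)).
- exact: (lin_comp (hpart_linear _) (lsl_linear hw)).
move=> i j x y hx hy; rewrite (thpart_homog _ hx hy) (lsl_tens _ _ hw).
rewrite (linZ (hpart_linear _)) (homogP _ hy).
have -> : w x = if i == d then w x else 0 by rewrite -ew hx.
have [jd|jd] := eqVneq i d.
  rewrite jd; have -> : (b (+) d == j) = (b == d (+) j) by move: (b) (j) (d) => [] [] [].
  case: ifP => _; last by rewrite (lin0 (lsl_linear hw)) scaler0.
  rewrite lsl_tens //.
rewrite scale0r; case: ifP => _; last by rewrite (lin0 (lsl_linear hw)).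
by rewrite lsl_tens // -hx ew (negbTE jd) scale0r.
Qed.
Lemma hpart_lsl f b c (t : tensor V W) : linear f ->
  hpart c (lsl f (hpart b t)) = lsl (f \o hpart (b (+) c)) (hpart b t).
Proof.
move=> hf; have hf' d : linear (f \o hpart d) by exact: (lin_comp hf (hpart_linear _)).
have hb : linear (hpart b : tensor V W -> tensor V W) by apply: hpart_linear.
move: t; apply: tensor_hext.
- exact: (lin_comp (hpart_linear _) (lin_comp (lsl_linear hf) hb)).
- exact: (lin_comp (lsl_linear (hf' _)) hb).
move=> i j x y hx hy; rewrite (thpart_homog _ hx hy).
case: eqP => [->|_]; last by rewrite !(lin0 (lsl_linear _)) // hpart0.
rewrite !lsl_tens //.
rewrite (linZ (hpart_linear _)) (homogP _ hy) /= (homogP _ hx).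
have -> : (i (+) j (+) c == i) = (c == j) by move: (i) (j) (c) => [] [] [].
by case: eqP => // _; rewrite (lin0 hf) scale0r scaler0.
Qed.
End GradedSlices.

Section Actions.
Variables (K : fieldType) (A : hopfSAlgType K).
Implicit Types (f g : A -> K^o).

(* The right and left actions of the dual algebra on [A]. *)
Definition ract f (x : A) : A := lsl f (comul x).
Definition lact g (x : A) : A := rsl g (comul x).
Definition fconv f g (x : A) : K^o := f (lact g x).

Lemma ract_lin f : linear f -> linear (ract f).
Proof. by move=> hf; apply: (lin_comp (lsl_linear hf) (@comul_lin _ A)). Qed.

Lemma lact_lin g : linear g -> linear (lact g).
Proof. by move=> hg; apply: (lin_comp (rsl_linear hg) (@comul_lin _ A)). Qed.

Lemma fconv_lin f g : linear f -> linear g -> linear (fconv f g).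
Proof. by move=> hf hg; apply: (lin_comp hf (lact_lin hg)). Qed.

Lemma fconvE f g x : linear f -> linear g -> fconv f g x = g (ract f x).
Proof. by move=> hf hg; rewrite /fconv /ract lsl_rsl. Qed.

(** With a functional viewed as an algebra-valued map, both actions become convolutions, and their
    commutation and associativity follow from [pt_mulA]. *)
Definition fsc (R : salgType K) f (x : A) : R := (f x : K) *: (1 : R).

Lemma fsc_lin (R : salgType K) f : linear f -> linear (fsc R f).
Proof. by move=> hf; apply: (@lin_scalel K A R f 1). Qed.

Lemma ractE f x : linear f -> ract f x = pt_mul (fsc A f) idfun x.
Proof.
by move=> hf; apply: tlift_eq => a b; rewrite /fsc -scalerAl mul1r.
Qed.

Lemma lactE g x : linear g -> lact g x = pt_mul idfun (fsc A g) x.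
Proof.
by move=> hf; apply: tlift_eq => a b; rewrite /fsc -scalerAr mulr1.
Qed.

Lemma lin_pt_mulr (R R' : salgType K) (h : R -> R') (u : A -> R) g x :
  linear h -> linear u -> linear g ->
  h (pt_mul u (fsc R g) x) = pt_mul (h \o u) (fsc R' g) x.
Proof.
move=> hh hu hg; rewrite pt_mulE [LHS](lin_tlift hh); last first.
  by apply: bilin_mul => //; apply: fsc_lin.
by apply: tlift_eq => a b; rewrite /fsc -!scalerAr !mulr1 (linZ hh).
Qed.

Lemma lin_pt_mull (R R' : salgType K) (h : R -> R') (u : A -> R) g x :
  linear h -> linear u -> linear g ->
  h (pt_mul (fsc R g) u x) = pt_mul (fsc R' g) (h \o u) x.
Proof.
move=> hh hu hg; rewrite pt_mulE [LHS](lin_tlift hh); last first.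
  by apply: bilin_mul => //; apply: fsc_lin.
by apply: tlift_eq => a b; rewrite /fsc -!scalerAl !mul1r (linZ hh).
Qed.

Lemma fsc_conv f g : linear f -> linear g ->
  pt_mul (fsc A f) (fsc A g) =1 fsc A (fconv f g).
Proof.
move=> hf hg x; rewrite /fsc /fconv lactE //.
have hF := fsc_lin A hf.
by rewrite -[RHS]/(fsc A f _) lin_pt_mulr.
Qed.

Lemma ract_lact f g x : linear f -> linear g ->
  ract f (lact g x) = lact g (ract f x).
Proof.
move=> hf hg; have hF := fsc_lin A hf; have hG := fsc_lin A hg.
have hr := ract_lin hf; have hl := lact_lin hg.
rewrite [lact g x]lactE // [ract f x]ractE // lin_pt_mulr // lin_pt_mull //.
rewrite (@eq_pt_mul _ _ _ _ (pt_mul (fsc A f) idfun) _ (fsc A g)) //.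
  rewrite pt_mulA //; apply: eq_pt_mul => // y.
  by rewrite /= lactE.
by move=> y; rewrite /= ractE.
Qed.

Lemma ract_ract f g x : linear f -> linear g ->
  ract g (ract f x) = ract (fconv f g) x.
Proof.
move=> hf hg; have hF := fsc_lin A hf; have hG := fsc_lin A hg.
have hr := ract_lin hg; rewrite [ract f x]ractE // lin_pt_mull //.
rewrite [RHS]ractE; last exact: fconv_lin.
rewrite -(eq_pt_mul (fsc_conv hf hg) (fun=> erefl)) pt_mulA //.
by apply: eq_pt_mul => // y; rewrite /= ractE.
Qed.

Lemma lact_lact f g x : linear f -> linear g ->
  lact g (lact f x) = lact (fconv g f) x.
Proof.
move=> hf hg; have hF := fsc_lin A hf; have hG := fsc_lin A hg.
have hr := lact_lin hg; rewrite [lact f x]lactE // lin_pt_mulr //.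
rewrite [RHS]lactE; last exact: fconv_lin.
rewrite -(eq_pt_mul (fun=> erefl) (fsc_conv hg hf)) -pt_mulA //.
by apply: eq_pt_mul => // y; rewrite /= lactE.
Qed.

Lemma ract_hpart d f b x : linear f -> fdeg d f ->
  ract f (hpart b x) = hpart (b (+) d) (ract f x).
Proof. by move=> hf ef; rewrite /ract -comul_hpart (lsl_fdeg _ _ hf ef). Qed.

Lemma lact_hpart d f b x : linear f -> fdeg d f ->
  lact f (hpart b x) = hpart (b (+) d) (lact f x).
Proof. by move=> hf ef; rewrite /lact -comul_hpart (rsl_fdeg _ _ hf ef). Qed.

Lemma ract_counit x : ract counit x = x.
Proof. exact: counitl. Qed.

Lemma lact_counit x : lact counit x = x.
Proof. exact: counitr. Qed.

End Actions.

Section Coideals.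
Variables (K : fieldType) (A : hopfSAlgType K).

Definition homog_fam n (v : 'I_n -> A) (deg : 'I_n -> bool) : Prop :=
  forall i, homogeneous (deg i) (v i).

Definition lcoideal (S : A -> Prop) : Prop :=
  forall f : A -> K^o, linear f -> forall x, S x -> S (ract f x).

Definition rcoideal (S : A -> Prop) : Prop :=
  forall f : A -> K^o, linear f -> forall x, S x -> S (lact f x).

Let splitl n m (i : 'I_n) : split (lshift m i) = inl i.
Proof. exact: (unsplitK (inl i)). Qed.

Let splitr n m (i : 'I_m) : split (rshift n i) = inr i.
Proof. exact: (unsplitK (inr i)). Qed.

Lemma span_cat n m (v : 'I_n -> A) (w : 'I_m -> A) x :
  span_fam (fun k => match split k with inl i => v i | inr j => w j end) x <->
  exists y z, [/\ span_fam v y, span_fam w z & x = y + z].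
Proof.
have e (c : 'I_(n + m) -> K) :
    \sum_k c k *: (match split k with inl i => v i | inr j => w j end) =
    \sum_i c (lshift m i) *: v i + \sum_j c (rshift n j) *: w j.
  by rewrite big_split_ord; congr (_ + _); apply: eq_bigr => i _;
    rewrite ?splitl ?splitr.
split=> [[c ->]|[_ [_ [[c ->] [d ->] ->]]]].
  rewrite e; do 2 eexists; split; last by []; by eexists.
exists (fun k => match split k with inl i => c i | inr j => d j end).
rewrite e; congr (_ + _); apply: eq_bigr => i _; by rewrite ?splitl ?splitr.
Qed.

(** The finiteness theorem for comodules: the second factors of a shortest expression of Delta x
    span all slices of x, and a slice of a slice is a slice. Since x is homogeneous, the homogeneous
    parts of these factors are again slices of x, so the family can be made homogeneous. *)
Lemma fin_coideal1 b (x : A) : homogeneous b x ->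
  exists n (v : 'I_n -> A) deg,
    [/\ homog_fam v deg, lcoideal (span_fam v) & span_fam v x].
Proof.
move=> hx; have [n [a [y [e fa _]]]] := tensor_rep (comul x).
have [f [hf fE]] := dual_fam fa.
pose S z := exists g : A -> K^o, linear g /\ z = ract g x.
have Sy g : linear g -> span_fam y (ract g x).
  by move=> hg; exists (g \o a); rewrite /ract e lsl_sum.
have yS i : y i = ract (f i) x by rewrite /ract e lsl_sum // (@dual_sum _ _ _ _ _ i).
pose v (k : 'I_(n + n)) := match split k with
  inl i => hpart false (y i) | inr i => hpart true (y i) end.
pose deg (k : 'I_(n + n)) := match split k with inl i => false | inr i => true end.
have hv : homog_fam v deg by move=> k; rewrite /v /deg; case: split => i; apply: hpart_homog.
have yv z : span_fam y z -> span_fam v z.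
  move=> [c ->]; apply/span_cat; exists (hpart false (\sum_i c i *: y i)).
  exists (hpart true (\sum_i c i *: y i)); rewrite hpart_sum; split=> //;
    by exists c; rewrite (lin_sum (hpart_linear _)); apply: eq_bigr => i _;
      rewrite (linZ (hpart_linear _)).
exists (n + n)%N, v, deg; split=> //; last first.
  by rewrite -(ract_counit x); apply: yv; apply: Sy; apply: counit_lin.
have vS k : exists2 g : A -> K^o, linear g & v k = ract g x.
  have e2 : comul x = hpart b (comul x) by rewrite comul_hpart hx.
  rewrite /v; case: split => i; rewrite yS /ract e2 hpart_lsl //;
    by eexists; last by []; apply: (lin_comp (hf i) (hpart_linear _)).
move=> g hg z [c ->]; rewrite (lin_sum (ract_lin hg)).
apply: subsp_sum => [|k _]; first exact: subsp_span.
rewrite (linZ (ract_lin hg)); apply: subspZ; first exact: subsp_span.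
have [h hh ->] := vS k; rewrite ract_ract //; apply: yv; apply: Sy.
exact: fconv_lin.
Qed.

Lemma fin_coideal (xs : seq A) :
  exists n (v : 'I_n -> A) deg,
    [/\ homog_fam v deg, lcoideal (span_fam v) & forall x, x \in xs -> span_fam v x].
Proof.
have cat n m (v : 'I_n -> A) dv (w : 'I_m -> A) dw :
    homog_fam v dv -> lcoideal (span_fam v) -> homog_fam w dw -> lcoideal (span_fam w) ->
    exists k (u : 'I_k -> A) deg, [/\ homog_fam u deg, lcoideal (span_fam u) &
      forall x y, span_fam v x -> span_fam w y -> span_fam u (x + y)].
  move=> hv cv hw cw; eexists; eexists; exists (fun k => match split k with
    inl i => dv i | inr j => dw j end); split; last first.
  - by move=> x y hx hy; apply/(span_cat v w); exists x, y.
  - move=> f hf x /(span_cat v w)[y [z [hy hz ->]]]; apply/(span_cat v w).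
    exists (ract f y), (ract f z); split; [exact: cv|exact: cw|].
    by rewrite (linD (ract_lin hf)).
  - by move=> k; case: split.
elim: xs => [|x xs [n [v [dv [hv cv sv]]]]].
  exists 0%N, (fun=> 0), (fun=> false); split=> // [i|]; first exact: homog0.
  move=> f hf x [c ->]; rewrite big_ord0 (lin0 (ract_lin hf)).
  exact: subsp0 (subsp_span _).
have [n0 [v0 [d0 [hv0 cv0 sv0]]]] := fin_coideal1 (hpart_homog false x).
have [n1 [v1 [d1 [hv1 cv1 sv1]]]] := fin_coideal1 (hpart_homog true x).
have [n2 [v2 [d2 [hv2 cv2 sv2]]]] := cat _ _ _ _ _ _ hv0 cv0 hv1 cv1.
have [n3 [v3 [d3 [hv3 cv3 sv3]]]] := cat _ _ _ _ _ _ hv2 cv2 hv cv.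
exists n3, v3, d3; split=> // y; rewrite inE => /orP[/eqP->|/sv hy].
  rewrite -[x]addr0; apply: sv3; last exact: subsp0 (subsp_span _).
  by rewrite -(hpart_sum x); apply: sv2.
rewrite -[y]add0r; apply: sv3 => //; exact: subsp0 (subsp_span _).
Qed.
End Coideals.

(** * Purity of Hopf super-subalgebras *)

Lemma basis_mod (K : fieldType) (V : lmodType K) (S : V -> Prop) n (v : 'I_n -> V) :
  subsp S -> exists r (e : 'I_r -> 'I_n), free_mod S (v \o e) /\
    forall i, exists c : 'I_r -> K, S (v i - \sum_j c j *: v (e j)).
Proof.
move=> hS.
have key m : (m <= n)%N -> exists r (e : 'I_r -> 'I_n), free_mod S (v \o e) /\
    forall i : 'I_n, (i < m)%N -> exists c : 'I_r -> K, S (v i - \sum_j c j *: v (e j)).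
  elim: m => [|k IHk] kn.
    by exists 0%N, (fun j : 'I_0 => match j with Ordinal _ h => False_rect _ (notF h) end);
      split=> // c _ [].
  have [r [e [fe se]]] := IHk (ltnW kn).
  pose i0 := Ordinal kn.
  have [[c hc]|hn] := pselect (exists c : 'I_r -> K, S (v i0 - \sum_j c j *: v (e j))).
    exists r, e; split=> // i; rewrite ltnS leq_eqVlt => /orP[/eqP ik|]; last exact: se.
    by exists c; have -> : i = i0 by apply: val_inj.
  pose e' (j : 'I_r.+1) := if unlift ord0 j is Some j' then e j' else i0.
  have e'0 : e' ord0 = i0 by rewrite /e' unlift_none.
  have e'S j : e' (lift ord0 j) = e j by rewrite /e' liftK.
  exists r.+1, e'; split.
    move=> c; rewrite big_ord_recl /= e'0 => hc.
    have c0 : c ord0 = 0.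
      apply/eqP; apply: contrapT => /negP c0; apply: hn.
      exists (fun j => - ((c ord0)^-1 * c (lift ord0 j))).
      rewrite -sumrN (eq_bigr (fun j => (c ord0)^-1 *: (c (lift ord0 j) *: v (e j)))).
        have -> : v i0 = (c ord0)^-1 *: (c ord0 *: v i0).
          by rewrite scalerA mulVf ?scale1r.
        rewrite -scaler_sumr -scalerDr; apply: subspZ => //.
        by under eq_bigr => j _ do rewrite -e'S.
      by move=> j _; rewrite scaleNr opprK scalerA.
    move=> j; case: (unliftP ord0 j) => [j'|] -> //.
    apply: (fe (fun j => c (lift ord0 j))).
    move: hc; rewrite c0 scale0r add0r.
    by under eq_bigr => l _ do rewrite e'S.
  move=> i; rewrite ltnS leq_eqVlt => /orP[/eqP ik|ik].
    exists (fun j => (j == ord0)%:R); rewrite big_ord_recl eqxx scale1r big1.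
      by rewrite addr0 e'0 (_ : i = i0) ?subrr; [apply: subsp0|apply: val_inj].
    by move=> j _; rewrite scale0r.
  have [c hc] := se i ik.
  exists (fun j => if unlift ord0 j is Some j' then c j' else 0).
  rewrite big_ord_recl unlift_none scale0r add0r.
  by under eq_bigr => l _ do rewrite liftK e'S.
have [r [e [fe se]]] := key n (leqnn n).
by exists r, e; split=> // i; apply: se.
Qed.

Section SubHopf.
Variables (K : fieldType) (A : hopfSAlgType K).

(** Together, [sh_left] and [sh_right] say that Delta maps H into H (x) H. *)
Record subhopf (H : A -> Prop) : Prop := SubHopf {
  sh_subsp : subsp H;
  sh_graded : graded H;
  sh_one : H 1;
  sh_mul : forall x y, H x -> H y -> H (x * y);
  sh_left : lcoideal H;
  sh_right : rcoideal H;
  sh_antipode : forall x, H x -> H (antipode x)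
}.

Lemma inr_lsl (S : A -> Prop) (t : tensor A A) : subsp S ->
  (forall f : A -> K^o, linear f -> S (lsl f t)) -> inr_ S t.
Proof. by move=> hS /(lsl_in hS)[n [v [w [-> _ h]]]]; exists n, v, w. Qed.

Lemma lsl_inr (S : A -> Prop) (t : tensor A A) f : subsp S -> linear f ->
  inr_ S t -> S (lsl f t).
Proof.
move=> hS hf [n [v [w [-> h]]]]; rewrite lsl_sum //; apply: subsp_sum => // i _.
exact: subspZ.
Qed.

Lemma inr_mul (S T N : A -> Prop) (s t : tensor A A) : subsp N -> graded S ->
  (forall h m, S h -> T m -> N (h * m)) -> inr_ S s -> inr_ T t -> inr_ N (s * t).
Proof.
move=> hN gS SN [n [a [h [-> Sh]]]] [m [c [z [-> Tz]]]].
apply: inr_lsl => // f hf; rewrite mulr_suml (lin_sum (lsl_linear hf)).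
apply: subsp_sum => // i _; rewrite mulr_sumr (lin_sum (lsl_linear hf)).
apply: subsp_sum => // j _; rewrite [_ * _]tmul_tens (lin_sum (lsl_linear hf)).
apply: subsp_sum => // k _; rewrite (lin_sum (lsl_linear hf)).
apply: subsp_sum => // l _; rewrite (linZ (lsl_linear hf)) lsl_tens //.
by apply: subspZ => //; apply: subspZ => //; apply: SN => //; apply: gS.
Qed.

Lemma inr_comul (S : A -> Prop) x : subsp S -> lcoideal S -> S x -> inr_ S (comul x).
Proof. by move=> hS cS Sx; apply: inr_lsl => // f hf; apply: cS. Qed.

Section Module.
Variables (H : A -> Prop) (hH : subhopf H).
Variables (n : nat) (v : 'I_n -> A) (deg : 'I_n -> bool).
Hypotheses (hv : homog_fam v deg) (cv : lcoideal (span_fam v)).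

Let sH := sh_subsp hH.

Definition hspan (x : A) : Prop :=
  exists h : 'I_n -> A, (forall i, H (h i)) /\ x = \sum_i h i * v i.
(** This is H^+ M for M = [hspan], so that M modulo it is the fibre of M at the unit element. *)
Definition hspan0 (x : A) : Prop :=
  exists h : 'I_n -> A, (forall i, H (h i) /\ counit (h i) = 0) /\ x = \sum_i h i * v i.

Lemma subsp_hspan : subsp hspan.
Proof.
split; first by exists (fun=> 0); split=> [i|]; [exact: subsp0|rewrite big1 // => i _; rewrite mul0r].
move=> a _ _ [h [hh ->]] [k [hk ->]]; exists (fun i => a *: h i + k i); split.
  by move=> i; case: sH => _; apply.
rewrite scaler_sumr -big_split; apply: eq_bigr => i _ /=.
by rewrite mulrDl -scalerAl.
Qed.

Lemma subsp_hspan0 : subsp hspan0.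
Proof.
split.
  exists (fun=> 0); split=> [i|]; last by rewrite big1 // => i _; rewrite mul0r.
  by split; [exact: subsp0|exact: (lin0 (@counit_lin _ A))].
move=> a _ _ [h [hh ->]] [k [hk ->]]; exists (fun i => a *: h i + k i); split.
  move=> i; have [h1 h2] := hh i; have [h3 h4] := hk i; split.
    by case: sH => _; apply.
  by rewrite (@counit_lin _ A) h2 h4 scaler0 addr0.
rewrite scaler_sumr -big_split; apply: eq_bigr => i _ /=.
by rewrite mulrDl -scalerAl.
Qed.

Lemma hspan_mul h m : H h -> hspan m -> hspan (h * m).
Proof.
move=> Hh [k [hk ->]]; exists (fun i => h * k i); split=> [i|]; first exact: sh_mul.
by rewrite mulr_sumr; apply: eq_bigr => i _; rewrite mulrA.
Qed.

Lemma hspan_gen i : hspan (v i).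
Proof.
exists (fun j => if j == i then 1 else 0); split.
  by move=> j; case: ifP => _; [apply: sh_one|apply: subsp0].
rewrite (bigD1 i) //= eqxx mul1r big1 ?addr0 // => j /negbTE->.
by rewrite mul0r.
Qed.

Lemma span_hspan x : span_fam v x -> hspan x.
Proof. by apply: span_sub; [apply: subsp_hspan|apply: hspan_gen]. Qed.

Lemma hspan_lcoideal : lcoideal hspan.
Proof.
move=> f hf _ [h [hh ->]]; rewrite (lin_sum (ract_lin hf)).
apply: subsp_sum => [|i _]; first exact: subsp_hspan.
rewrite /ract comulM; apply: lsl_inr => //; first exact: subsp_hspan.
apply: (@inr_mul H (span_fam v)); [exact: subsp_hspan|exact: sh_graded| | |].
- by move=> k m Hk /span_hspan; apply: hspan_mul.
- by apply: inr_comul => //; apply: sh_left.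
- by apply: inr_comul; [apply: subsp_span|apply: cv|apply: span_mem].
Qed.

Lemma counit_hpart b (x : A) : counit x = 0 -> counit (hpart b x) = 0.
Proof.
case: b; first by move=> _; apply: counit_odd.
by rewrite -{1}(hpart_sum x) (linD (@counit_lin _ A)) counit_odd [_ + 0]addr0.
Qed.

Lemma hspan0_graded : graded hspan0.
Proof.
move=> b _ [h [hh ->]]; exists (fun i => hpart (b (+) deg i) (h i)); split.
  move=> i; have [h1 h2] := hh i; split; first exact: sh_graded.
  exact: counit_hpart.
by rewrite (lin_sum (hpart_linear _)); apply: eq_bigr => i _; apply: hpartMr.
Qed.

Lemma counit_hspan0 x : hspan0 x -> counit x = 0.
Proof.
move=> [h [hh ->]]; rewrite (lin_sum (@counit_lin _ A)) big1 // => i _.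
by rewrite counitM (proj2 (hh i)) mul0r.
Qed.

(* Nakayama's lemma at the unit element. *)
Lemma local_generators r (e : 'I_r -> 'I_n) :
  (forall i, exists c : 'I_r -> K, hspan0 (v i - \sum_j c j *: v (e j))) ->
  exists s, [/\ H s, homogeneous false s, counit s = 1 &
    forall i, exists k : 'I_r -> A, (forall j, H (k j)) /\
      s * v i = \sum_j k j * v (e j)].
Proof.
move=> gen.
(* Passing to homogeneous components gives the matrix C below entries of degree deg i + deg j, as
   [elimination] requires. *)
have {}gen i : exists cq : ('I_r -> K) * ('I_n -> A),
    [/\ forall k, H (cq.2 k), forall k, homogeneous (deg i (+) deg k) (cq.2 k),
    forall k, counit (cq.2 k) = 0 &
    v i = \sum_j cq.1 j *: v (e j) + \sum_k cq.2 k * v k].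
  have [c [q [hq E]]] := gen i.
  exists (fun j => if deg (e j) == deg i then c j else 0,
          fun k => hpart (deg i (+) deg k) (q k)); split=> /= [k|k|k|].
  - by apply: sh_graded => //; have [] := hq k.
  - exact: hpart_homog.
  - by apply: counit_hpart; have [] := hq k.
  have {1}-> : v i = hpart (deg i) (v i) by rewrite hv.
  have -> : v i = \sum_j c j *: v (e j) + \sum_k q k * v k.
    by rewrite -E addrC subrK.
  rewrite hpartD !(lin_sum (hpart_linear _)); congr (_ + _).
    apply: eq_bigr => j _; rewrite (linZ (hpart_linear _)) (homogP _ (hv _)) eq_sym.
    by case: eqP => _; rewrite ?scale0r ?scaler0.
  by apply: eq_bigr => k _; apply: hpartMr.
pose cq i := sval (cid (gen i)).
have cqP i : [/\ forall k, H ((cq i).2 k),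
    forall k, homogeneous (deg i (+) deg k) ((cq i).2 k),
    forall k, counit ((cq i).2 k) = 0 &
    v i = \sum_j (cq i).1 j *: v (e j) + \sum_k (cq i).2 k * v k].
  by rewrite /cq; case: (cid _).
clearbody cq; clear gen.
pose hom b x := H x /\ homogeneous b x.
(* C is the identity modulo the kernel of the counit, so elimination inverts it up to an even
   element s of counit 1. *)
pose C : 'M[A]_n := \matrix_(i, j) ((i == j)%:R - (cq i).2 j).
have [|||||||||||||D [s [N [DC [Hs es] Js hD]]]] :=
  @elimination A hom (fun x => counit x = 0) _ _ _ _ _ _ _ _ _ _ n C deg 1.
- by move=> b; split; [apply: subsp0|apply: homog0].
- by split; [apply: sh_one|apply: homog1].
- by move=> b x y [h1 h2] [h3 h4]; split; [apply: (subspD sH)|apply: homogD].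
- by move=> b x [h1 h2]; split; [apply: (subspN sH)|apply: homogN].
- by move=> b c x y [h1 h2] [h3 h4]; split; [apply: sh_mul|apply: homogM].
- by move=> x [h1 h2] y; apply: even_central.
- exact: (lin0 (@counit_lin _ A)).
- by move=> x y hx hy; rewrite (linD (@counit_lin _ A)) hx hy addr0.
- by move=> x y hy; rewrite counitM hy mulr0.
- by move=> x y hx; rewrite counitM hx mul0r.
- by split; [apply: sh_one|apply: homog1].
- move=> i j; rewrite mxE; have [h1 h2 _ _] := cqP i.
  have [ij|ij] := eqVneq i j.
    rewrite mulr1n; split; first by apply: (subspB sH) => //; apply: (sh_one hH).
    apply: homogD; last exact: homogN.
    by rewrite -ij addbb; apply: homog1.
  by rewrite sub0r; split; [apply: (subspN sH)|apply: homogN].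
- move=> i j; rewrite mxE addrAC subrr sub0r (linN (@counit_lin _ A)).
  by have [_ _ -> _] := cqP i; rewrite oppr0.
exists s; split=> //.
  have : counit (s - 1 ^+ N) = 0 := Js.
  by rewrite expr1n (linB (@counit_lin _ A)) counit1 => /eqP; rewrite subr_eq0 => /eqP.
move=> i; exists (fun j => \sum_k (cq k).1 j *: D i k); split.
  move=> j; apply: subsp_sum => // k _; apply: subspZ => //.
  by have [] := hD i k.
have Cv k : \sum_j C k j * v j = \sum_j (cq k).1 j *: v (e j).
  have [_ _ _ E] := cqP k.
  rewrite -[RHS](addrK (\sum_j (cq k).2 j * v j)) -E.
  rewrite -[v k in RHS](@dual_sum K A n (fun j => (k == j)%:R)) //.
  rewrite -sumrB; apply: eq_bigr => j _; rewrite mxE mulrBl; congr (_ - _).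
  by case: eqP => _; rewrite ?mul1r ?mul0r ?scale1r ?scale0r.
have -> : s * v i = \sum_k D i k * \sum_j C k j * v j.
  have -> : \sum_k D i k * \sum_j C k j * v j = \sum_j (D *m C) i j * v j.
    under eq_bigr => k _ do rewrite mulr_sumr.
    rewrite exchange_big; apply: eq_bigr => j _; rewrite mxE mulr_suml.
    by apply: eq_bigr => k _; rewrite mulrA.
  rewrite DC (bigD1 i) //= mxE eqxx mulr1n big1 ?addr0 // => j ij.
  by rewrite mxE eq_sym (negbTE ij) mulr0n mul0r.
under [RHS]eq_bigr => j _ do rewrite mulr_suml.
rewrite exchange_big; apply: eq_bigr => k _; rewrite Cv mulr_sumr.
by apply: eq_bigr => j _; rewrite -scalerAr scalerAl.
Qed.
End Module.
End SubHopf.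

Section Purity.
Variables (K : fieldType) (A : hopfSAlgType K).
Variables (H : A -> Prop) (hH : subhopf H).

Let sH := sh_subsp hH.
Let gH := sh_graded hH.

Definition hlinear (M : A -> Prop) (f : A -> A) : Prop :=
  [/\ linear f, forall h m, H h -> M m -> f (h * m) = h * f m &
      forall m, M m -> H (f m)].

(* [m |-> (S m_1) f(m_2)_1 (x) f(m_2)_2] commutes with [H] acting on the second
   factor; this spreads a retraction near the unit element over the group. *)
Lemma translate_retraction (M : A -> Prop) f : subsp M -> lcoideal M -> M 1 ->
  hlinear M f -> counit (f 1) = 1 -> exists2 f', hlinear M f' & f' 1 = 1.
Proof.
move=> sM cM M1 [hf fM fH] ef.
have s1 := shom_iota1 A A; have s2 := shom_iota2 A A; have sD := shom_comul A.
have sS := shom_antipode A; have s1S := shom_comp s1 sS.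
have [h1 _ i11 i1M] := s1; have [h2 _ i21 i2M] := s2; have [hD eD D1 DM] := sD.
have [hS eS S1 SM] := sS; have h1S := shom_lin s1S.
have hDf : linear (@comul K A \o f) by apply: lin_comp.
have [p [hp ep pH Hp]] := graded_proj sH gH.
pose g := pt_mul (@iota1 _ A A \o antipode) (comul \o f).
have hg : linear g by apply: pt_mul_lin.
(* The new retraction is m |-> P(u) w, where u (x) w stands for [g] m. The even projection [p]
   brings the first factor into H; H-linearity survives because H acts on the second factor alone.
   At m = 1 the formula becomes S(c_1) c_2 with c = f(1), which is the counit of c. *)
pose P := antipode \o p.
have hP : linear P by apply: lin_comp.
have eP : evenmap P by move=> b x; rewrite /P /= ep eS.
have PH x : H (P x) by apply: sh_antipode.
have hc : linear (cv P (@idfun A)) by apply: cv_lin.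
have gM h m : H h -> M m -> g (h * m) = iota2 A h * g m.
  move=> Hh Mm; rewrite /g pt_mulE comulM.
  rewrite (cvM s1S (g' := comul) (H := H) (M := M)) //; first last.
  - exact: inr_comul.
  - by apply: inr_comul => //; apply: sh_left.
  - by move=> k l Hk Ml; rewrite /= fM // DM.
  congr (_ * _); rewrite -[LHS]/(pt_mul _ _ h).
  rewrite (eq_pt_mul (fun=> erefl) (@comul_iota _ A)) -pt_mulA //.
  rewrite (@eq_pt_mul _ _ _ _ (eps _) _ (@iota2 _ A A)) ?pt_mul1l //.
  exact: pt_mulVl.
have cM2 h t : cv P idfun (iota2 A h * t) = h * cv P idfun t.
  move: t; apply: tensor_hext.
  - exact: (lin_comp hc (lin_mulr _)).
  - exact: (lin_comp (lin_mulr h) hc).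
  move=> i j a b ha hb; rewrite -(hpart_bool h) (lin_sum h2) !mulr_suml (lin_sum hc).
  apply: eq_bigr => c _; have hhc := hpart_homog c h.
  rewrite (tensM _ _ hhc ha) (linZ hc) !cv_tens // mul1r mulrA.
  have -> := supercomm _ _ _ _ hhc (even_homog eP ha).
  by rewrite mulrA scalerAl.
exists (cv P idfun \o g); last first.
  rewrite /= /g pt_mulE comul1 cv_tens //= S1 i11 mul1r.
  have [m [a [b [e _ Ha]]]] := rsl_in sH (fun k hk => sh_right hH hk (fH 1 M1)).
  rewrite e cv_sum //; transitivity (cv antipode idfun (comul (f 1))).
    by rewrite e cv_sum //; apply: eq_bigr => i _; rewrite /P /= Hp.
  by rewrite [LHS]antipodel ef scale1r.
split; first exact: lin_comp.
  by move=> h m Hh Mm; rewrite /= gM.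
move=> m Mm; rewrite /= /g pt_mulE.
have [k [a [b [-> Mb]]]] := inr_comul sM cM Mm.
rewrite cv_sum // (lin_sum hc); apply: subsp_sum => // i _ /=.
have [l [c [d [-> Hd]]]] := inr_comul sH (sh_left hH) (fH _ (Mb i)).
rewrite mulr_sumr (lin_sum hc); apply: subsp_sum => // j _.
rewrite -iota12 mulrA -i1M iota12 cv_tens //.
by apply: (sh_mul hH); [apply: PH|apply: Hd].
Qed.

Section Fam.
Variables (n : nat) (v : 'I_n -> A) (deg : 'I_n -> bool).
Hypotheses (hv : homog_fam v deg) (cvv : lcoideal (span_fam v)) (v1 : span_fam v 1).

Let M := hspan H v.
Let M0 := hspan0 H v.

(** M is free near the unit. Lifts v(e_j) of a basis of the fibre generate M after multiplication by
    some s of counit 1. The dual functionals of the fibre extend to H-linear maps M -> A, which show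
    that relations among the v(e_j) are killed by a power of s. A coordinate that does not vanish at
    1 then gives an H-linear map M -> H whose value at 1 has counit 1, and [translate_retraction]
    finishes. *)
Lemma hspan_retraction : exists2 f, hlinear M f & f 1 = 1.
Proof.
have sM : subsp M by apply: subsp_hspan.
have sM0 : subsp M0 by apply: subsp_hspan0.
have cM : lcoideal M by apply: hspan_lcoideal cvv.
have M1 : M 1 by apply: span_hspan v1.
have hC := @counit_lin _ A.
suff [f hf ef] : exists2 f, hlinear M f & counit (f 1) = 1.
  exact: translate_retraction hf ef.
have [r [e [fe se]]] := basis_mod v sM0.
have [s [Hs es cs gen]] := local_generators hH hv se.
have [w0 [hw0 w0v w00]] := dual_mod sM0 fe.
pose w j : A -> K^o := w0 j \o hpart (deg (e j)).
have hw j : linear (w j) by have [] := fdeg_part (deg (e j)) (hw0 j).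
have dw j : fdeg (deg (e j)) (w j) by have [] := fdeg_part (deg (e j)) (hw0 j).
have wv i j : w i (v (e j)) = (i == j)%:R.
  rewrite /w /= (homogP _ (hv _)); case: eqP => [_|ne]; first exact: w0v.
  by rewrite (lin0 (hw0 i)); case: eqP => // ij; case: ne; rewrite ij.
have wM0 i x : M0 x -> w i x = 0.
  by move=> hx; apply: w00; apply: (hspan0_graded hH hv).
have wM i h m : H h -> M m -> w i (h * m) = counit h * w i m.
  move=> Hh [k [hk ->]].
  have -> : h * \sum_i k i * v i =
      (h - (counit h)%:A) * (\sum_i k i * v i) + counit h *: \sum_i k i * v i.
    by rewrite mulrBl -scalerAl mul1r subrK.
  rewrite (linD (hw i)) wM0 ?add0r ?(linZ (hw i)) //.
  exists (fun i => (h - (counit h)%:A) * k i); split.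
    move=> j; split.
      apply: sh_mul => //; apply: (subspB sH) => //.
      by apply: subspZ => //; apply: sh_one.
    by rewrite counitM (linB hC) (linZ hC) counit1 [_ *: _]mulr1 subrr mul0r.
  by rewrite mulr_sumr; apply: eq_bigr => j _; rewrite mulrA.
(* The map m |-> m_1 w_i(m_2). It is H-linear because w_i(h m) = eps(h) w_i(m): the functional on
   the fibre is spread over the group. *)
pose om i := lact (w i).
have hom i : linear (om i) by apply: lact_lin.
have omM i h m : H h -> M m -> om i (h * m) = h * om i m.
  move=> Hh Mm; rewrite /om !lactE // !pt_mulE comulM.
  rewrite (cvM (shom_id A) (g' := @eps _ A A) (H := H) (M := M)) //; first last.
  - exact: inr_comul.
  - by apply: inr_comul => //; apply: sh_left.
  - move=> k l Hk Ml; rewrite /fsc wM // /eps -scalerAl mul1r scalerA.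
    by [].
  - exact: fsc_lin.
  - exact: (shom_even (shom_eps A A)).
  - exact: (shom_lin (shom_eps A A)).
  by congr (_ * _); apply: pt_mul1r.
pose al : 'M[A]_r := \matrix_(j, l) om l (v (e j)).
have hal j l : homogeneous (deg (e j) (+) deg (e l)) (al j l).
  by rewrite mxE /homogeneous -(lact_hpart _ _ (hw l) (dw l)) hv.
pose k i := sval (cid (gen i)).
have kP i : (forall j, H (k i j)) /\ s * v i = \sum_j k i j * v (e j).
  by rewrite /k; case: (cid _).
have omg i l : \sum_j k i j * om l (v (e j)) = s * om l (v i).
  have [hk E] := kP i; have hg := hspan_gen hH v.
  rewrite -(omM l s (v i) Hs (hg i)) E (lin_sum (hom l)); apply: eq_bigr => j _.
  by rewrite omM //; apply: hg.
(* With Delta v(e_i) = sum_l c_il (x) v_l and s v_l = sum_j k_lj v(e_j), take d_ij = sum_l S(c_il)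
   k_lj. The identity S(m_1) m_2 w_l(m_3) = w_l(m) at m = v(e_i), multiplied by s, is the (i, l)
   entry of d al = s. *)
have [d dal] : exists d : 'M[A]_r, d *m al = s%:M.
  have ex i : exists c : 'I_n -> A, comul (v (e i)) = \sum_l tens (c l) (v l).
    have [|m [a [b [-> _ hb]]]] := @lsl_in _ _ _ (span_fam v) (comul (v (e i)))
      (subsp_span v).
      by move=> f hf; apply: cvv => //; apply: span_mem.
    pose c j := sval (cid (hb j)).
    have cE j : b j = \sum_l c j l *: v l by rewrite /c; case: (cid _).
    exists (fun l => \sum_j c j l *: a j).
    under [RHS]eq_bigr => l _ do rewrite (lin_sum (lin_tensl _)).
    rewrite exchange_big; apply: eq_bigr => j _; rewrite cE (lin_sum (lin_tensr _)).
    by apply: eq_bigr => l _; rewrite tensZr tensZl.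
  pose c i := sval (cid (ex i)).
  have cE i : comul (v (e i)) = \sum_l tens (c i l) (v l) by rewrite /c; case: (cid _).
  exists (\matrix_(i, j) \sum_l antipode (c i l) * k l j).
  apply/matrixP => i l; rewrite !mxE.
  have := pt_mulA (@antipode_lin _ A) (@lin_id _ A) (fsc_lin A (hw l)) (v (e i)).
  rewrite (eq_pt_mul (f' := eps A) (g' := fsc A (w l)) (pt_mulVl (shom_id A))) //.
  rewrite pt_mul1l; last exact: fsc_lin.
  rewrite (eq_pt_mul (f' := antipode) (g' := om l) (fun=> erefl)); last first.
    by move=> x; rewrite -lactE.
  rewrite pt_mulE cE cv_sum //; last exact: antipode_lin.
  rewrite /fsc wv => E.
  have -> : s *+ (i == l) = s * ((l == i)%:R : K)%:A.
    by rewrite eq_sym; case: eqP => _; rewrite ?scale1r ?scale0r ?mulr1 ?mulr0.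
  rewrite E mulr_sumr.
  transitivity (\sum_j \sum_m antipode (c i m) * (k m j * om l (v (e j)))).
    apply: eq_bigr => j _; rewrite !mxE mulr_suml.
    by apply: eq_bigr => m _; rewrite mulrA.
  rewrite exchange_big; apply: eq_bigr => m _.
  by rewrite -mulr_sumr omg !mulrA (even_central _ es).
have {d dal}[d [hd dal]] : exists d : 'M[A]_r,
    (forall i j, homogeneous (deg (e i) (+) deg (e j)) (d i j)) /\ d *m al = s%:M.
  exists (\matrix_(i, j) hpart (deg (e i) (+) deg (e j)) (d i j)); split.
    by move=> i j; rewrite mxE; apply: hpart_homog.
  apply/matrixP => i l; have := congr1 (fun x : 'M_r => x i l) dal; rewrite !mxE.
  move=> /(congr1 (hpart (deg (e i) (+) deg (e l)))).
  have -> : hpart (deg (e i) (+) deg (e l)) (s *+ (i == l)) = s *+ (i == l).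
    case: eqP => [->|_]; last by rewrite mulr0n hpart0.
    by rewrite mulr1n addbb.
  move=> <-; rewrite (lin_sum (hpart_linear _)); apply: eq_bigr => j _.
  by rewrite (hpartMr _ _ (hal j l)) [deg (e j) (+) _]addbC addb_cancel mxE.
have [N cancelN] := right_cancel es hd dal.
have rel (x : 'I_r -> A) : (forall j, H (x j)) -> \sum_j x j * v (e j) = 0 ->
    forall j, s ^+ N * x j = 0.
  move=> Hx ex j; have := cancelN (\row_j x j).
  suff -> : (\row_j x j) *m al = 0.
    by move=> /(_ erefl)/matrixP/(_ ord0 j); rewrite !mxE.
  apply/matrixP => i l; rewrite [LHS]mxE [RHS]mxE.
  transitivity (om l (\sum_j x j * v (e j))); last by rewrite ex (lin0 (hom l)).
  rewrite (lin_sum (hom l)).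
  by apply: eq_bigr => m _; rewrite !mxE omM //; apply: hspan_gen.
(* The counit vanishes on H^+ M but not at 1, so 1 has a nonzero coordinate in the fibre. *)
have [l wl1] : exists l, w l 1 <> 0.
  apply: contrapT => nl; have : M0 1.
    have [c hc] : exists c : 'I_r -> K, M0 (1 - \sum_j c j *: v (e j)).
      have [a ->] := v1.
      pose c i := sval (cid (se i)).
      have cP i : M0 (v i - \sum_j c i j *: v (e j)) by rewrite /c; case: (cid _).
      exists (fun j => \sum_i a i * c i j).
      have -> : \sum_j (\sum_i a i * c i j) *: v (e j) =
          \sum_i a i *: \sum_j c i j *: v (e j).
        under eq_bigr => j _ do rewrite scaler_suml.
        rewrite exchange_big; apply: eq_bigr => i _; rewrite scaler_sumr.
        by apply: eq_bigr => j _; rewrite scalerA.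
      rewrite -sumrB; apply: subsp_sum => // i _; rewrite -scalerBr.
      exact: subspZ.
    suff c0 j : c j = 0.
      by move: hc; rewrite big1 ?subr0 // => j _; rewrite c0 scale0r.
    have := wM0 j _ hc; rewrite (linB (hw j)) (lin_sum (hw j)).
    rewrite (bigD1 j) //= big1 => [|m mj]; last first.
      by rewrite (linZ (hw j)) wv eq_sym (negbTE mj) scaler0.
    rewrite (linZ (hw j)) wv eqxx addr0.
    have -> : w j 1 = 0 by apply: contrapT => ne; apply: nl; exists j.
    by rewrite sub0r => /eqP; rewrite oppr_eq0 [_ *: _]mulr1 => /eqP.
  by move=> /counit_hspan0; rewrite counit1 => /eqP; rewrite oner_eq0.
(* The l-th coordinate of s m. The factor s^N makes it independent of the expansion, by [rel], and
   the division by w_l(1) gives it counit 1 at m = 1. *)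
pose F (m y : A) : Prop := exists x : 'I_r -> A, [/\ forall j, H (x j),
  s * m = \sum_j x j * v (e j) & y = ((w l 1 : K)^-1) *: (s ^+ N * x l : A)].
have FH m y : F m y -> H y.
  move=> [x [Hx _ ->]]; apply: subspZ => //; apply: sh_mul => //.
  by elim: (N) => [|n' IH]; rewrite ?expr0 ?exprS; [apply: sh_one|apply: sh_mul].
have FD a m m' y y' : F m y -> F m' y' -> F (a *: m + m') (a *: y + y').
  move=> [x [Hx ex ->]] [x' [Hx' ex' ->]]; exists (fun j => a *: x j + x' j); split.
  - by move=> j; case: sH => _; apply.
  - rewrite mulrDr -scalerAr ex ex' scaler_sumr -big_split; apply: eq_bigr => j _.
    by rewrite /= mulrDl -scalerAl.
  - by rewrite mulrDr -scalerAr [RHS]scalerDr !scalerA [a * _]mulrC.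
have FM h m y : H h -> F m y -> F (h * m) (h * y).
  move=> Hh [x [Hx ex ->]]; exists (fun j => h * x j); split.
  - by move=> j; apply: sh_mul.
  - rewrite mulrA (even_central h es) -mulrA ex mulr_sumr.
    by apply: eq_bigr => j _; rewrite mulrA.
  - rewrite -scalerAr !mulrA; congr (_ *: (_ * _)); symmetry; apply: even_central.
    by elim: (N) => [|n' IH]; rewrite ?expr0 ?exprS; [apply: homog1|apply: (homogM es IH)].
have F0 y : F 0 y -> y = 0.
  move=> [x [Hx ex ->]]; rewrite rel ?scaler0 // -ex mulr0.
  by [].
have Funiq m y y' : F m y -> F m y' -> y = y'.
  move=> h h'; have := FD (-1) _ _ _ _ h h'; rewrite scaleN1r addNr => /F0.
  by rewrite scaleN1r => /eqP; rewrite addrC subr_eq0 => /eqP.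
have Fex m : M m -> exists y, F m y.
  move=> [h [Hh ->]]; exists ((w l 1 : K)^-1 *: (s ^+ N * \sum_i h i * k i l)).
  exists (fun j => \sum_i h i * k i j); split=> //.
    move=> j; apply: subsp_sum => // i _; apply: sh_mul => //.
    by have [] := kP i.
  transitivity (\sum_i h i * \sum_j k i j * v (e j)).
    rewrite mulr_sumr; apply: eq_bigr => i _.
    by rewrite mulrA (even_central _ es) -mulrA; have [_ ->] := kP i.
  under [RHS]eq_bigr => j _ do rewrite mulr_suml.
  rewrite [RHS]exchange_big; apply: eq_bigr => i _; rewrite mulr_sumr.
  by apply: eq_bigr => j _; rewrite mulrA.
have [p [hp pM Mp]] := proj_on sM.
pose f x := sval (cid (Fex _ (pM x))).
have fE x : F (p x) (f x) by rewrite /f; case: (cid _).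
exists f.
  split.
  - move=> a x y; apply: (@Funiq (p (a *: x + y))) => //.
    by rewrite hp; apply: FD.
  - move=> h m Hh Mm; apply: (@Funiq (p (h * m))) => //.
    rewrite Mp; last exact: hspan_mul.
    by apply: FM => //; rewrite -{1}(Mp _ Mm).
  - by move=> m _; apply: FH (fE m).
have := fE 1; rewrite Mp // => -[x [Hx ex ->]].
have := congr1 (w l) ex; rewrite (wM l s 1 Hs M1) cs mul1r (lin_sum (hw l)).
rewrite (bigD1 l) //= big1 => [|m ml]; last first.
  by rewrite wM ?wv 1?eq_sym ?(negbTE ml) ?mulr0 //; apply: hspan_gen.
rewrite wM ?wv ?eqxx ?mulr1 ?addr0 //; last exact: hspan_gen.
move=> E; rewrite (linZ hC) counitM -E.
have -> : counit (s ^+ N) = 1.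
  by elim: (N) => [|n' IH]; rewrite ?expr0 ?counit1 // exprS counitM cs IH mulr1.
by rewrite mul1r [_ *: _]mulVf //; apply/eqP.
Qed.
End Fam.

(* Super version of the faithful flatness of a commutative Hopf algebra over its
   Hopf subalgebras, in the form in which it is used. *)
Theorem purity (xs : seq A) : exists M f, [/\ forall x, x \in xs -> M x,
  subsp M, lcoideal M & [/\ M 1, forall h m, H h -> M m -> M (h * m), hlinear M f & f 1 = 1]].
Proof.
have [n [v [deg [hv cvv hx]]]] := fin_coideal (1 :: xs).
have v1 : span_fam v 1 by apply: hx; rewrite mem_head.
have [f hf f1] := hspan_retraction hv cvv v1.
exists (hspan H v), f; split.
- by move=> x xxs; apply: span_hspan => //; apply: hx; rewrite inE xxs orbT.
- exact: subsp_hspan.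
- exact: hspan_lcoideal cvv.
- split=> //; first exact: span_hspan.
  by move=> h m; apply: hspan_mul.
Qed.
End Purity.

(** * The filtration of a unipotent extension *)

Section Filtration.
Variables (K : fieldType) (A : hopfSAlgType K).
Variables (H : A -> Prop) (hH : subhopf H).

Let sH := sh_subsp hH.
Let gH := sh_graded hH.

Definition augideal (x : A) : Prop :=
  exists s : seq (A * A), (forall u, u \in s -> H u.1 /\ counit u.1 = 0) /\
    x = \sum_(u <- s) u.1 * u.2.

(* Invariants of the closed subgroup with ideal [H^+ A]. *)
Lemma coinv_in b :
  (forall f : A -> K^o, linear f -> augideal (ract f b - (f b : K)%:A)) -> H b.
Proof.
move=> hb; have [n [x [y [e fx _]]]] := tensor_rep (comul b).
have [g [hg gx]] := dual_fam fx.
have yE i : y i = ract (g i) b by rewrite /ract e lsl_sum // (@dual_sum _ _ _ _ _ i).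
have aug i := hb _ (hg i).
pose s i := sval (cid (aug i)).
have sP i : (forall u, u \in s i -> H u.1 /\ counit u.1 = 0) /\
    y i - (g i b : K)%:A = \sum_(u <- s i) u.1 * u.2.
  by rewrite yE /s; case: (cid _).
have [M [f [Mx sM cM [M1 MM [hf fM fH] f1]]]] :=
  purity hH (flatten [seq unzip2 (s i) | i <- enum 'I_n]).
have Ms i u : u \in s i -> M u.2.
  move=> us; apply: Mx; apply/flattenP; exists (unzip2 (s i)).
    by apply: map_f; rewrite mem_enum.
  exact: map_f.
have yM i : M (y i).
  have [hs E] := sP i; rewrite -[y i](subrK (g i b : K)%:A) E.
  apply: subspD => //; last exact: subspZ.
  rewrite big_seq; apply: subsp_sum => // u us.
  by apply: MM; [have [] := hs u us|apply: Ms us].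
have hS := @antipode_lin _ A; have hC := @counit_lin _ A.
(* k(m) = S(m_1) f(m_2) satisfies k(h m) = eps(h) k(m) and k(1) = 1, so it agrees with the counit on
   K 1 + H^+ M, where the y_i lie. Hence f(b) = b_1 k(b_2) = b_1 eps(b_2) = b. Since b is a
   combination of the y_i it lies in M, where f takes values in H. *)
pose k := pt_mul antipode f.
have hk : linear k by apply: pt_mul_lin.
have kM h m : H h -> M m -> k (h * m) = counit h *: k m.
  move=> Hh Mm; rewrite /k pt_mulE comulM.
  rewrite (cvM (shom_antipode A) (g' := idfun) (H := H) (M := M)) //; first last.
  - exact: inr_comul.
  - by apply: inr_comul => //; apply: sh_left.
  have E : cv antipode idfun (comul h) = eps A h := pt_mulVl (shom_id A) h.
  by rewrite E /eps -scalerAl mul1r.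
have k1 : k 1 = 1.
  by rewrite /k pt_mulE comul1 cv_tens // f1 mulr1 (shom1 (shom_antipode A)).
have ky i : k (y i) = (g i b : K)%:A.
  have [hs E] := sP i; rewrite -[y i](subrK (g i b : K)%:A) E (linD hk) (linZ hk) k1.
  rewrite (lin_sum hk) big_seq big1 ?add0r // => u us.
  by have [h1 h2] := hs u us; rewrite kM ?h2 ?scale0r //; apply: Ms us.
have ey i : counit (y i) = g i b.
  have [hs E] := sP i; rewrite -[y i](subrK (g i b : K)%:A) E (linD hC) (linZ hC) counit1.
  rewrite (lin_sum hC) big_seq big1 ?add0r ?[_ *: _]mulr1 // => u us.
  by have [h1 h2] := hs u us; rewrite counitM h2 mul0r.
have fb : f b = b.
  transitivity (pt_mul idfun k b).
    rewrite /k -pt_mulA // (eq_pt_mul (f' := eps A) (g' := f) (pt_mulVr (shom_id A))) //.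
    by rewrite pt_mul1l.
  rewrite -[RHS]lact_counit /lact pt_mulE e cv_sum // rsl_sum //.
  by apply: eq_bigr => i _; rewrite ky ey -scalerAr mulr1.
rewrite -fb; apply: fH; rewrite -(ract_counit b) /ract e lsl_sum //.
by apply: subsp_sum => // i _; apply: subspZ.
Qed.

(** An H-linear retraction f that fixes 1 and is defined at a carries q = j a to q = j f(a). *)
Lemma ideal_contract (q j a : A) : H q -> H j -> q = j * a ->
  exists2 h, H h & q = j * h.
Proof.
move=> Hq Hj e; have [M [f [Mx sM _ [M1 _ [_ fM fH] f1]]]] := purity hH [:: a].
have Ma : M a by apply: Mx; rewrite mem_head.
exists (f a); first exact: fH.
by rewrite -fM // -e -[q in RHS]mulr1 fM // f1 mulr1.
Qed.

(** The wedge filtration: step n+1 is the preimage under Delta of Fil n (x) A + A (x) H, tested by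
    slicing with the functionals that vanish on Fil n. *)
Fixpoint Fil (n : nat) (x : A) : Prop :=
  if n is m.+1 then
    forall f : A -> K^o, linear f -> (forall y, Fil m y -> f y = 0) -> H (ract f x)
  else H x.

Lemma subsp_Fil n : subsp (Fil n).
Proof.
case: n => [|n] //; split=> [f hf _|a x y hx hy f hf f0].
  by rewrite (lin0 (ract_lin hf)); apply: subsp0.
by rewrite (ract_lin hf); case: sH => _; apply; [apply: hx|apply: hy].
Qed.

Lemma Fil_S n x : Fil n x -> Fil n.+1 x.
Proof.
elim: n x => [|n IHn] x hx f hf f0; first exact: sh_left.
by apply: hx => // y /IHn; apply: f0.
Qed.

Lemma Fil_leq m n x : (m <= n)%N -> Fil m x -> Fil n x.
Proof.
move=> /subnK <-; elim: (n - m)%N => // k IHk hx.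
by rewrite addSn; apply: Fil_S; apply: IHk.
Qed.

Lemma Fil_rcoideal n : rcoideal (Fil n).
Proof.
case: n => [|n] g hg x hx; first exact: sh_right.
by move=> f hf f0; rewrite ract_lact //; apply: sh_right => //; apply: hx.
Qed.

Lemma ract_parts (f : A -> K^o) x : linear f ->
  ract f x = \sum_(c : bool) ract (f \o hpart c) x.
Proof.
move=> hf; have hfc c : linear (f \o hpart c) by exact: (lin_comp hf (hpart_linear _)).
rewrite /ract; move: (comul x); apply: tensor_ext.
- exact: lsl_linear.
- by apply: lin_big => c; apply: lsl_linear.
- move=> v w; rewrite lsl_tens // -{1}(hpart_bool v) (lin_sum hf) scaler_suml.
  by apply: eq_bigr => c _; rewrite lsl_tens.
Qed.

Lemma Fil_graded n : graded (Fil n).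
Proof.
elim: n => [|n IHn] b x hx; first exact: gH.
move=> f hf f0; rewrite ract_parts //; apply: subsp_sum => // c _.
have [h1 h2] := fdeg_part c hf; rewrite (ract_hpart _ _ h1 h2); apply: gH.
by apply: hx => // y hy; apply: f0; apply: IHn.
Qed.

Definition Filu (x : A) : Prop := exists n, Fil n x.

Lemma subsp_Filu : subsp Filu.
Proof.
split; first by exists 0%N; apply: subsp0.
move=> a x y [m hm] [n hn]; exists (maxn m n).
have [_ h] := subsp_Fil (maxn m n); apply: h.
  by apply: Fil_leq hm; apply: leq_maxl.
by apply: Fil_leq hn; apply: leq_maxr.
Qed.

Lemma Filu_graded : graded Filu.
Proof. by move=> b x [n hn]; exists n; apply: Fil_graded. Qed.

Lemma Filu_rcoideal : rcoideal Filu.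
Proof. by move=> f hf x [n hn]; exists n; apply: Fil_rcoideal. Qed.

Lemma sepS (V : lmodType K) (S : V -> Prop) x : subsp S ->
  (forall f : V -> K^o, linear f -> (forall y, S y -> f y = 0) -> f x = 0) -> S x.
Proof.
move=> hS h; apply: contrapT => /(separate hS)[f [hf fx fS]].
by move/eqP: (h f hf fS); rewrite fx oner_eq0.
Qed.

(** Modulo H in the second factor, Delta y is a finite sum whose first factors lie in the union.
    These finitely many elements lie in a common step n, so y lies in step n+1. *)
Lemma Filu_ract y :
  (forall f : A -> K^o, linear f -> (forall z, Filu z -> f z = 0) -> H (ract f y)) ->
  Filu y.
Proof.
move=> hy; have [p [hp pH Hp]] := proj_on sH.
pose c x := x - p x.
have hc : linear c by apply: lin_add => //; apply: lin_opp.
have cH x : c x = 0 -> H x by move=> /eqP; rewrite subr_eq0 => /eqP ->; apply: pH.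
have Hc x : H x -> c x = 0 by move=> /Hp; rewrite /c => ->; rewrite subrr.
have [n [a [b [e _ fb]]]] := tensor_rep (tmap idfun c (comul y)).
have rE f : linear f -> c (ract f y) = \sum_i f (a i) *: b i.
  move=> hf; rewrite -lsl_sum // -e /ract (lin_tlift hc); last exact: bilin_scalel.
  rewrite /tmap (lin_tlift (lsl_linear hf)); last exact: bilin_tens.
  by apply: tlift_eq => u w; rewrite lsl_tens // (linZ hc).
have aF i : Filu (a i).
  apply: sepS => [|f hf f0]; first exact: subsp_Filu.
  by apply: (fb (fun i => f (a i))); rewrite -rE // Hc //; apply: hy.
pose d i := sval (cid (aF i)).
have dP i : Fil (d i) (a i) by rewrite /d; case: (cid _).
exists (\max_i d i).+1 => f hf f0; apply: cH; rewrite rE // big1 // => i _.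
by rewrite f0 ?scale0r //; apply: Fil_leq (dP i); apply: (leq_bigmax i).
Qed.
End Filtration.

(** * Finite-dimensional supercomodules given by matrices of coefficients *)

Section GradedRows.
Variables (K : fieldType) (m : nat) (deg : 'I_m -> bool).

(** Row vectors tagged with a degree function, so that the grading can be attached to the type. *)
Definition gvec (d : 'I_m -> bool) : Type := 'rV[K]_m.
HB.instance Definition _ (d : 'I_m -> bool) := GRing.Lmodule.on (gvec d).

Definition gvec_part (b : bool) (v : gvec deg) : gvec deg :=
  \row_j (if deg j == b then (v : 'rV_m) ord0 j else 0).

Lemma gvec_part_linear b : linear (gvec_part b).
Proof.
move=> a u v; apply/rowP => j; rewrite !mxE.
by case: ifP => _; rewrite ?mulr0 ?addr0.
Qed.

Lemma gvec_partK b c x :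
  gvec_part b (gvec_part c x) = if b == c then gvec_part c x else 0.
Proof.
apply/rowP => j; rewrite !mxE.
case: (eqVneq b c) => [->|bc]; rewrite !mxE; first by case: eqP.
have [e|//] := eqVneq (deg j) b; by rewrite e (negbTE bc).
Qed.

Lemma gvec_part_sum x : gvec_part false x + gvec_part true x = x.
Proof. by apply/rowP => j; rewrite !mxE; case: (deg j); rewrite ?addr0 ?add0r. Qed.

HB.instance Definition _ :=
  isSuper.Build K (gvec deg) gvec_part_linear gvec_partK gvec_part_sum.

Definition gcoef (j : 'I_m) (v : gvec deg) : K^o := (v : 'rV_m) ord0 j.
Definition gdelta (j : 'I_m) : gvec deg := delta_mx ord0 j.

Lemma gcoef_lin j : linear (gcoef j).
Proof. by move=> a u v; rewrite /gcoef !mxE. Qed.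

Lemma gvec_sum (v : gvec deg) : v = \sum_j (gcoef j v : K) *: gdelta j.
Proof. exact: row_sum_delta. Qed.

Lemma gdelta_homog j : homogeneous (deg j) (gdelta j).
Proof.
apply/rowP => k; rewrite !mxE eqxx /=.
by have [->|_] := eqVneq k j; rewrite ?eqxx // if_same.
Qed.

Lemma gvec_ext (W : lmodType K) (f g : gvec deg -> W) : linear f -> linear g ->
  (forall j, f (gdelta j) = g (gdelta j)) -> f =1 g.
Proof.
move=> hf hg h v; rewrite (gvec_sum v) (lin_sum hf) (lin_sum hg).
by apply: eq_bigr => j _; rewrite (linZ hf) (linZ hg) h.
Qed.
End GradedRows.

Section MatrixComodule.
Variables (K : fieldType) (U : hopfSAlgType K) (m : nat) (deg : 'I_m -> bool).
Variable c : 'I_m -> 'I_m -> U.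
Hypotheses (hc : forall i j, homogeneous (deg i (+) deg j) (c i j))
  (cD : forall i j, comul (c i j) = \sum_k tens (c i k) (c k j))
  (ce : forall i j, counit (c i j) = (i == j)%:R).

Local Notation V := (gvec K deg).

Definition mcoact (v : V) : tensor V U :=
  \sum_j (gcoef j v : K) *: \sum_i tens (gdelta K deg i) (c i j).

Lemma mcoact_linear : linear mcoact.
Proof. by apply: lin_big => j; apply: lin_scalel; apply: gcoef_lin. Qed.

Lemma mcoact_delta j : mcoact (gdelta K deg j) = \sum_i tens (gdelta K deg i) (c i j).
Proof.
rewrite /mcoact; apply: (@dual_sum _ _ _ _ (fun j => \sum_i tens (gdelta K deg i) (c i j))).
by move=> k; rewrite /gcoef mxE eqxx /= eq_sym.
Qed.

Lemma mcoact_hpart b x : hpart b (mcoact x) = mcoact (hpart b x).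
Proof.
move: x; apply: gvec_ext.
- exact: (lin_comp (hpart_linear b) mcoact_linear).
- exact: (lin_comp mcoact_linear (hpart_linear b)).
move=> j; rewrite mcoact_delta (homogP _ (gdelta_homog K deg j)).
rewrite (lin_sum (hpart_linear b)).
under eq_bigr => i _ do rewrite (thpart_homog b (gdelta_homog K deg i) (hc i j))
  addbA addbb addFb.
case: eqP => _; first by rewrite mcoact_delta.
by rewrite (lin0 mcoact_linear) big1.
Qed.

Lemma mcoactA x :
  tassoc (tmap mcoact idfun (mcoact x)) = tmap idfun comul (mcoact x).
Proof.
have hm := mcoact_linear; have hi (X : lmodType K) : linear (@idfun X) by [].
have hD := @comul_lin _ U.
move: x; apply: gvec_ext.
- exact: (lin_comp (@tassoc_linear _ _ _ _) (lin_comp (tmap_linear hm (hi _)) hm)).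
- exact: (lin_comp (tmap_linear (hi _) hD) hm).
move=> j; rewrite mcoact_delta !(lin_sum (tmap_linear _ _)) //.
rewrite (lin_sum (@tassoc_linear _ _ _ _)).
transitivity (\sum_i \sum_k tens (gdelta K deg k) (tens (c k i) (c i j))).
  apply: eq_bigr => i _; rewrite tmap_tens // tassoc_tens mcoact_delta.
  rewrite (lin_sum (tlift_linear (@bilin_assoc_pure K V U U (c i j)))); apply: eq_bigr => k _.
  by rewrite tlift_tens //; apply: bilin_assoc_pure.
rewrite exchange_big; apply: eq_bigr => k _; rewrite tmap_tens // cD.
by rewrite (lin_sum (lin_tensr _)).
Qed.

Lemma mcoact_counit x : tlift (fun v a => counit a *: v) (mcoact x) = x.
Proof.
have hC := @counit_lin _ U; have hm := mcoact_linear.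
rewrite -[LHS]/(rsl (counit : U -> K^o) (mcoact x)).
transitivity (idfun x) => //; move: x; apply: gvec_ext => //.
  exact: (lin_comp (rsl_linear hC) hm).
move=> j; rewrite mcoact_delta rsl_sum //; apply: dual_sum => i.
by rewrite ce eq_sym.
Qed.

Definition mcomod : supermodule U :=
  Supermodule mcoact_linear mcoact_hpart mcoactA mcoact_counit.
End MatrixComodule.

Lemma hpart_rsl (K : fieldType) (V W : superModType K) (f : W -> K^o) b c
    (t : tensor V W) : linear f ->
  hpart c (rsl f (hpart b t)) = rsl (f \o hpart (b (+) c)) (hpart b t).
Proof.
move=> hf; have hf' d : linear (f \o hpart d) by exact: (lin_comp hf (hpart_linear _)).
have hb : linear (hpart b : tensor V W -> tensor V W) by apply: hpart_linear.
move: t; apply: tensor_hext.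
- exact: (lin_comp (hpart_linear _) (lin_comp (rsl_linear hf) hb)).
- exact: (lin_comp (rsl_linear (hf' _)) hb).
move=> i j x y hx hy; rewrite (thpart_homog _ hx hy).
case: eqP => [->|_]; last by rewrite !(lin0 (rsl_linear _)) // hpart0.
rewrite !rsl_tens //.
rewrite (linZ (hpart_linear _)) (homogP _ hx) /= (homogP _ hy).
have -> : (i (+) j (+) c == j) = (c == i) by move: (i) (j) (c) => [] [] [].
by case: eqP => // _; rewrite (lin0 hf) scale0r scaler0.
Qed.

(** * Invariants under a unipotent closed subgroup *)

Section Unipotent.
Variables (K : fieldType) (A U : hopfSAlgType K) (p : hopf_hom A U).

Let hp : linear p. Proof. exact: shom_lin (shom_hopf p). Qed.

Let hpart_p b x : hpart b (p x) = p (hpart b x).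
Proof. by have [_ e _ _] := shom_hopf p; rewrite e. Qed.

Let pf_lin (f : U -> K^o) : linear f -> linear (f \o p : A -> K^o).
Proof. by move=> hf; apply: lin_comp. Qed.

Lemma fconv_hopf (f g : U -> K^o) x : linear f -> linear g ->
  fconv f g (p x) = fconv (f \o p) (g \o p) x.
Proof.
move=> hf hg; rewrite /fconv /lact hopf_hom_comul /=.
rewrite (lin_tlift (rsl_linear hg)); last exact: bilin_tens.
have hs : linear (fun v => f v) := hf.
rewrite (lin_tlift hf); last first.
  by split=> [w|v] a u u'; rewrite !rsl_tens //= ?hp ?(linD hg) ?(linZ hg) ?scalerDl
    ?scalerDr ?scalerA // mulrC.
rewrite (lin_tlift hp); last by apply: bilin_scaler; apply: pf_lin.
rewrite (lin_tlift hf); last first.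
  by split=> [w|v] a u u'; rewrite ?(linD hp) ?(linZ hp) /= ?hp ?(linD hg) ?(linZ hg)
    ?(linZ hp) ?scalerDr ?scalerDl ?scalerA // mulrC.
by apply: tlift_eq => a b; rewrite rsl_tens // (linZ hp).
Qed.

Section Invariant.
Variables (F : A -> Prop) (sF : subsp F) (gF : graded F) (cF : rcoideal F).

(* Families spanning a finite-dimensional subcomodule of [A / F] over [U]. *)
Definition comod_fam m (e : 'I_m -> A) (deg : 'I_m -> bool) : Prop :=
  [/\ homog_fam e deg, free_mod F e &
      forall (f : U -> K^o), linear f -> forall j,
        exists a : 'I_m -> K, F (lact (f \o p) (e j) - \sum_i a i *: e i)].

(** The slices of a homogeneous element outside F span a finite-dimensional subcomodule containing
    that element, so its image in A/F is nonzero; a basis modulo F is extracted from it. *)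
Lemma comod_fam_exists x : ~ F x -> exists m (e : 'I_m -> A) deg,
  comod_fam e deg /\ (0 < m)%N.
Proof.
move=> nFx; have [b {nFx}nFx] : exists b, ~ F (hpart b x).
  apply: contrapT => h; apply: nFx; rewrite -(hpart_bool x); apply: subsp_sum => // b _.
  by apply: contrapT => nb; apply: h; exists b.
move: (hpart b x) (hpart_homog b x) nFx => {}x hx nFx.
have [n [a [y [e _ fy]]]] := tensor_rep (comul x).
have [g [hg gE]] := dual_fam fy.
have aE i : a i = lact (g i) x by rewrite /lact e rsl_sum // (@dual_sum _ _ _ _ _ i).
have Sa h : linear h -> span_fam a (lact h x).
  by move=> hh; exists (h \o y); rewrite /lact e rsl_sum.
pose v (k : 'I_(n + n)) := match split k with
  inl i => hpart false (a i) | inr i => hpart true (a i) end.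
pose deg (k : 'I_(n + n)) := match split k with inl i => false | inr i => true end.
have hv : homog_fam v deg by move=> k; rewrite /v /deg; case: split => i; apply: hpart_homog.
have av z : span_fam a z -> span_fam v z.
  move=> [c ->]; apply/span_cat; exists (hpart false (\sum_i c i *: a i)).
  exists (hpart true (\sum_i c i *: a i)); rewrite hpart_sum; split=> //;
    by exists c; rewrite (lin_sum (hpart_linear _)); apply: eq_bigr => i _;
      rewrite (linZ (hpart_linear _)).
have vS k : exists2 h : A -> K^o, linear h & v k = lact h x.
  have e2 : comul x = hpart b (comul x) by rewrite comul_hpart hx.
  rewrite /v; case: split => i; rewrite aE /lact e2 hpart_rsl //;
    by eexists; last by []; apply: (lin_comp (hg i) (hpart_linear _)).
have [r [s [fs gen]]] := basis_mod v sF.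
have genS z : span_fam v z -> exists c : 'I_r -> K, F (z - \sum_j c j *: v (s j)).
  move=> [c ->]; pose d i := sval (cid (gen i)).
  have dP i : F (v i - \sum_j d i j *: v (s j)) by rewrite /d; case: (cid _).
  exists (fun j => \sum_i c i * d i j).
  have -> : \sum_j (\sum_i c i * d i j) *: v (s j) = \sum_i c i *: \sum_j d i j *: v (s j).
    under eq_bigr => j _ do rewrite scaler_suml.
    rewrite exchange_big; apply: eq_bigr => i _; rewrite scaler_sumr.
    by apply: eq_bigr => j _; rewrite scalerA.
  rewrite -sumrB; apply: subsp_sum => // i _; rewrite -scalerBr; exact: subspZ.
exists r, (v \o s), (deg \o s); split.
  split=> // [j|f hf j]; first exact: hv.
  apply: genS; have [h hh /= ->] := vS (s j).
  have hfp := pf_lin hf.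
  rewrite lact_lact //; apply: av; apply: Sa; exact: fconv_lin.
rewrite lt0n; apply/eqP => r0; apply: nFx.
have [|c] := genS x.
  rewrite -(lact_counit x); apply: av; apply: Sa; exact: counit_lin.
by rewrite big1 ?subr0 // => j _; have := ltn_ord j; rewrite [X in (_ < X)%N]r0.
Qed.

(** A nonzero finite-dimensional U-subcomodule of A/F of least dimension is simple, hence a trivial
    line because U is unipotent; y spans this line modulo F. The conclusion is the invariance of y
    modulo F, sliced by functionals on A/F. *)
Lemma unipotent_invariant : unipotent U -> (exists x, ~ F x) ->
  exists y, ~ F y /\ forall f : A -> K^o, linear f -> (forall z, F z -> f z = 0) ->
    p (ract f y) = (f y : K)%:A.
Proof.
move=> uU [x0 nFx0].
pose P m := exists (e : 'I_m -> A) deg, comod_fam e deg /\ (0 < m)%N.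
have exP : exists m, `[< P m >].
  by have [m [e [deg h]]] := comod_fam_exists nFx0; exists m; apply/asboolP; exists e, deg.
case: (ex_minnP exP) => m /asboolP[e [deg [[he fe ce] m0]]] minm.
have [w0 [hw0 w0e w00]] := dual_mod sF fe.
pose w i : A -> K^o := w0 i \o hpart (deg i).
have hw i : linear (w i) by have [] := fdeg_part (deg i) (hw0 i).
have dw i : fdeg (deg i) (w i) by have [] := fdeg_part (deg i) (hw0 i).
have we i j : w i (e j) = (i == j)%:R.
  rewrite /w /= (homogP _ (he _)); case: eqP => [_|ne]; first exact: w0e.
  by rewrite (lin0 (hw0 i)); case: eqP => // ij; case: ne; rewrite ij.
have wF i x : F x -> w i x = 0 by move=> hx; apply: w00; apply: gF.
pose c i j := p (ract (w i) (e j)).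
have cE (f : U -> K^o) i j : linear f -> f (c i j) = w i (lact (f \o p) (e j)).
  move=> hf; have hfp := pf_lin hf; rewrite -[RHS]/(fconv (w i) (f \o p) (e j)).
  by rewrite fconvE.
have lactE (f : U -> K^o) j : linear f ->
    F (lact (f \o p) (e j) - \sum_i (f (c i j) : K) *: e i).
  move=> hf; have [a Fa] := ce f hf j.
  suff aE i : a i = f (c i j) by under eq_bigr => i _ do rewrite -aE.
  have := wF i _ Fa; rewrite (linB (hw i)) -cE // (lin_sum (hw i)).
  rewrite (bigD1 i) //= big1 => [|k ki]; last first.
    by rewrite (linZ (hw i)) we eq_sym (negbTE ki) scaler0.
  by rewrite (linZ (hw i)) we eqxx addr0 [_ *: _]mulr1 => /eqP; rewrite subr_eq0 => /eqP.
have hc i j : homogeneous (deg i (+) deg j) (c i j).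
  by rewrite /homogeneous /c hpart_p addbC -(ract_hpart _ _ (hw i) (dw i)) he.
have cD i j : comul (c i j) = \sum_k tens (c i k) (c k j).
  apply: slice_ext => f g hf hg; have hfp := pf_lin hf; have hgp := pf_lin hg.
  rewrite lsl_sum // [RHS](lin_sum hg).
  transitivity (g (ract f (c i j))) => //; rewrite -fconvE //.
  rewrite fconv_hopf //.
  transitivity (w i (lact (f \o p) (lact (g \o p) (e j)))).
    rewrite -[RHS]/(fconv (w i) (f \o p) (lact (g \o p) (e j))) [RHS]fconvE //.
    by rewrite ract_lact.
  have hlf := lact_lin hfp; have hlg := lact_lin hgp.
  rewrite -[X in w i (lact _ X)](subrK (\sum_k (g (c k j) : K) *: e k)).
  rewrite (linD hlf) (linD (hw i)) wF ?add0r; last first.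
    by apply: cF => //; apply: lactE.
  rewrite (lin_sum hlf) (lin_sum (hw i)); apply: eq_bigr => k _.
  by rewrite (linZ hlf) (linZ (hw i)) -cE // (linZ hg) [LHS]mulrC.
have ceps i j : counit (c i j) = (i == j)%:R.
  by rewrite /c hopf_hom_counit -fconvE ?/fconv ?lact_counit //; apply: counit_lin.
pose V := mcomod hc cD ceps.
pose toA (v : gvec K deg) := \sum_j (gcoef j v : K) *: e j.
have htoA : linear toA by apply: lin_big => j; apply: lin_scalel; apply: gcoef_lin.
have toA0 v : F (toA v) -> v = 0.
  move=> /fe h; rewrite (gvec_sum v) big1 // => j _.
  by have -> : gcoef j v = 0 := h j; rewrite scale0r.
have toAE (f : U -> K^o) v : linear f ->
    F (lact (f \o p) (toA v) - toA (rsl f (mcoact c v))).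
  move=> hf; have hfp := pf_lin hf; have hl := lact_lin hfp.
  pose D v := lact (f \o p) (toA v) - toA (rsl f (mcoact c v)).
  have hD : linear D.
    apply: lin_add; first exact: lin_comp.
    apply: lin_opp; apply: (lin_comp htoA); apply: (lin_comp (rsl_linear hf)).
    exact: mcoact_linear.
  rewrite -/(D v) (gvec_sum v) (lin_sum hD); apply: subsp_sum => // j _.
  rewrite (linZ hD); apply: subspZ => //; rewrite /D mcoact_delta rsl_sum //.
  have toAd i : toA (gdelta K deg i) = e i.
    apply: (@dual_sum _ _ _ _ e) => k.
    by rewrite /gcoef mxE eqxx eq_sym.
  rewrite toAd (lin_sum htoA).
  under eq_bigr => i _ do rewrite (linZ htoA) toAd.
  exact: lactE.
have sV : simple_supermodule V.
  split.
  - split=> // x _; exists [seq (u.1, u.2) | u <- sval (cid (tensor_ind (coact x)))].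
    split=> //; case: (cid _) => s /= ->; rewrite big_map.
    by [].
  - move=> e0; have : (setT : set V) (gdelta K deg (Ordinal m0)) by [].
    rewrite e0 => /(congr1 (gcoef (Ordinal m0))).
    by rewrite (lin0 (gcoef_lin _)) /gcoef mxE !eqxx => /eqP; rewrite oner_eq0.
  move=> T hT _; have sT : subsp (T : V -> Prop).
    by split; [exact: (sub_smod0 hT)|exact: (sub_smod_linear hT)].
  have gT : graded (T : V -> Prop) by exact: (sub_smod_hpart hT).
  have [[z0 [Tz0 z00]]|nz] := pselect (exists z, T z /\ z <> 0); last first.
    left; apply/seteqP; split=> z /=; last by move=> ->; exact: (subsp0 sT).
    by move=> Tz; apply: contrapT => z1; apply: nz; exists z.
  right; apply/seteqP; split=> // z _.
  have [q [hq eq_ qT Tq]] := graded_proj sT gT.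
  pose t j := q (gdelta K deg j).
  have h0 : subsp (fun x : gvec K deg => x = 0).
    by split=> // a u u' -> ->; rewrite scaler0 addr0.
  have [r [s [fs gen]]] := basis_mod t h0.
  have genT x : T x -> exists a : 'I_r -> K, x = \sum_j a j *: t (s j).
    move=> Tx; pose d i := sval (cid (gen i)).
    have dP i : t i = \sum_j d i j *: t (s j).
      by rewrite /d; case: (cid _) => /= a /eqP; rewrite subr_eq0 => /eqP.
    exists (fun j => \sum_i (gcoef i x : K) * d i j).
    rewrite -{1}(Tq _ Tx) {1}(gvec_sum x) (lin_sum hq).
    under [RHS]eq_bigr => j _ do rewrite scaler_suml.
    rewrite exchange_big; apply: eq_bigr => i _; rewrite (linZ hq) -/(t i) dP scaler_sumr.
    by apply: eq_bigr => j _; rewrite scalerA.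
  have r0 : (0 < r)%N.
    rewrite lt0n; apply/eqP => r0; apply: z00; have [a ->] := genT _ Tz0.
    by rewrite big1 // => j _; have := ltn_ord j; rewrite [X in (_ < X)%N]r0.
  (* A basis of a nonzero subcomodule T is carried into A to a family that competes with the minimal
     one, so T has dimension at least m and is the whole of V. *)
  have mr : (m <= r)%N.
    apply: minm; apply/asboolP; exists (toA \o t \o s), (deg \o s); split=> //.
    split.
    - move=> l; rewrite /homogeneous /= /toA (lin_sum (hpart_linear _)).
      apply: eq_bigr => j _; rewrite (linZ (hpart_linear _)) (homogP _ (he j)).
      case: eqP => // ne.
      have -> : gcoef j (t (s l)) = 0.
        rewrite /t -(gdelta_homog K deg (s l)) eq_ /gcoef mxE; case: eqP => // e'.
        by case: ne; rewrite e'.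
      by rewrite !scale0r.
    - move=> a Fa; apply: fs; apply: toA0; rewrite (lin_sum htoA).
      by under eq_bigr => j _ do rewrite (linZ htoA).
    - move=> f hf j; have := toAE f (t (s j)) hf.
      have [a Ea] : exists a : 'I_r -> K, rsl f (mcoact c (t (s j))) = \sum_i a i *: t (s i).
        apply: genT; have [u [Tu e']] := sub_smod_coact hT (qT (gdelta K deg (s j))).
        rewrite /t -[mcoact c _]/(@coact _ _ V _) e' (lin_sum (rsl_linear hf)) big_seq.
        by apply: subsp_sum => // i iu; rewrite rsl_tens //; apply: subspZ => //; apply: Tu.
      rewrite Ea (lin_sum htoA) => Fa; exists a.
      by under eq_bigr => i _ do rewrite /= -(linZ htoA).
  pose M := \matrix_(l < r) (t (s l) : 'rV[K]_m).
  have fM : row_free M.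
    apply: inj_row_free => x; rewrite mulmx_sum_row => e'; apply/rowP => j; rewrite mxE.
    apply: (fs (fun j => x ord0 j)); rewrite -[RHS]e'; apply: eq_bigr => l _.
    by rewrite rowK.
  have /eqP rM : row_full M.
    by rewrite /row_full eqn_leq rank_leq_col /=; move: fM; rewrite /row_free => /eqP ->.
  have /submxP[D ->] : ((z : 'rV[K]_m) <= M)%MS by apply: submx_full; apply/eqP.
  rewrite mulmx_sum_row; apply: (subsp_sum (S := T)) => // l _.
  by rewrite rowK; apply: (subspZ sT); apply: qT.
have [b [v [v0 _ _ cv]]] := uU V sV.
exists (toA v); split; first by move=> /toA0.
move=> f hf fF; apply/eqP; rewrite -subr_eq0; apply/eqP; apply: separate0 => g hg.
have hgp := pf_lin hg; rewrite (linB hg) (linZ hg).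
have -> : g (p (ract f (toA v))) = f (lact (g \o p) (toA v)).
  by rewrite -[RHS]/(fconv f (g \o p) (toA v)) fconvE.
have := fF _ (toAE g v hg); rewrite (linB hf).
have -> : mcoact c v = tens v 1 := cv.
rewrite rsl_tens // (linZ htoA) (linZ hf) => /eqP; rewrite subr_eq0 => /eqP ->.
by rewrite [X in _ - X]mulrC subrr.
Qed.
End Invariant.

(** Otherwise some y outside the union is invariant modulo the union. For f vanishing on the union
    the slice f(y_1) y_2 is then truly invariant, so it lies in H by [coinv_in], and [Filu_ract]
    places y in the union. *)
Lemma unipotent_exhausts (H : A -> Prop) : subhopf H -> unipotent U ->
  (forall x, p x = 0 -> augideal H x) -> forall x, Filu H x.
Proof.
move=> hH uU kp x; apply: contrapT => nFx.
have [|y [nFy hy]] := unipotent_invariant (subsp_Filu hH) (Filu_graded hH)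
  (Filu_rcoideal hH) uU; first by exists x.
apply: nFy; apply: (Filu_ract hH) => f hf fF; apply: (coinv_in hH) => g hg; apply: kp.
have hfg := fconv_lin hf hg.
rewrite (linB hp) ract_ract // hy //; last first.
  by move=> z Fz; apply: fF; apply: (Filu_rcoideal hH).
have [_ _ p1 _] := shom_hopf p.
by rewrite (linZ hp) p1 fconvE // subrr.
Qed.
End Unipotent.

(** * Quotients by Hopf ideals *)

Section MakeHom.
Variables (K : fieldType).

Definition shom_lrmorphism (A B : salgType K) (f : A -> B) (sf : shom f) :
    {lrmorphism A -> B} :=
  HB.pack f (GRing.isLinear.Build K A B *:%R f (shom_lin sf))
    (GRing.isMonoidMorphism.Build A B f (pair (shom1 sf) (shomM sf))).

Definition shom_hom (A B : salgType K) (f : A -> B) (sf : shom f) : salg_hom A B :=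
  @SAlgHom K A B (shom_lrmorphism sf) (fun b x => esym (shom_even sf b x)).

Definition mk_hopf_hom (A B : hopfSAlgType K) (f : A -> B) (sf : shom f)
    (fD : forall x, comul (f x) = tmap f f (comul x))
    (fe : forall x, counit (f x) = counit x) : hopf_hom A B :=
  @HopfHom K A B (shom_hom sf) fD fe.
End MakeHom.

(** The ideal is the kernel of [inorm]. The idempotent provides a normal form for each class, which
    makes the quotient a subtype. *)
Record sideal (K : fieldType) (A : salgType K) := SIdeal {
  inorm :> A -> A;
  inorm_lin : linear inorm;
  inorm_even : evenmap inorm;
  inormK : forall x, inorm (inorm x) = inorm x;
  inormMl : forall x y, inorm y = 0 -> inorm (x * y) = 0;
  inormMr : forall x y, inorm x = 0 -> inorm (x * y) = 0;
  inorm1 : inorm 1 != 0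
}.

(* The quotient of [A] by the ideal [ker q], realised on the image of the
   idempotent [q]. *)
Record quo (K : fieldType) (A : salgType K) (q : sideal A) := Quo {
  qval : A;
  _ : q qval == qval
}.

Section Quotient.
Variables (K : fieldType) (A : salgType K) (q : sideal A).

HB.instance Definition _ := [isSub for @qval K A q].
HB.instance Definition _ := [Choice of quo q by <:].

Let hq := inorm_lin q.

Lemma cl_subproof x : q (q x) == q x. Proof. by rewrite inormK. Qed.
Definition cl (x : A) : quo q := Quo (cl_subproof x).

Lemma clK (a : quo q) : cl (qval a) = a.
Proof. by apply: val_inj => /=; case: a => x /= /eqP. Qed.

Lemma clP x y : q (x - y) = 0 <-> cl x = cl y.
Proof.
split=> [h|/(congr1 (@qval _ _ _)) /= h]; last by rewrite (linB hq) h subrr.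
by apply: val_inj => /=; apply/eqP; rewrite -subr_eq0 -(linB hq) h.
Qed.

Lemma clN x : q (q x - x) = 0.
Proof. by rewrite (linB hq) inormK subrr. Qed.

Definition qadd (a b : quo q) := cl (qval a + qval b).
Definition qopp (a : quo q) := cl (- qval a).
Definition qscale k (a : quo q) := cl (k *: qval a).
Definition qmul (a b : quo q) := cl (qval a * qval b).

Lemma qaddE x y : qadd (cl x) (cl y) = cl (x + y).
Proof. by apply/clP; rewrite /= opprD addrACA (linD hq) !clN addr0. Qed.

Lemma qoppE x : qopp (cl x) = cl (- x).
Proof. by apply/clP; rewrite /= -opprD (linN hq) clN oppr0. Qed.

Lemma qscaleE k x : qscale k (cl x) = cl (k *: x).
Proof. by apply/clP; rewrite /= -scalerBr (linZ hq) clN scaler0. Qed.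

Lemma qmulE x y : qmul (cl x) (cl y) = cl (x * y).
Proof.
apply/clP => /=.
have -> : q x * q y - x * y = q x * (q y - y) + (q x - x) * y.
  by rewrite mulrBr mulrBl addrA subrK.
by rewrite (linD hq) inormMl ?clN // inormMr ?clN // addr0.
Qed.

Lemma quo_ind (P : quo q -> Prop) : (forall x, P (cl x)) -> forall a, P a.
Proof. by move=> h a; rewrite -(clK a). Qed.

Lemma qaddA : associative qadd.
Proof.
elim/quo_ind=> x; elim/quo_ind=> y; elim/quo_ind=> z.
by rewrite !qaddE addrA.
Qed.
Lemma qaddC : commutative qadd.
Proof. by elim/quo_ind=> x; elim/quo_ind=> y; rewrite !qaddE addrC. Qed.
Lemma qadd0 : left_id (cl 0) qadd.
Proof. by elim/quo_ind=> x; rewrite qaddE add0r. Qed.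
Lemma qaddN : left_inverse (cl 0) qopp qadd.
Proof. by elim/quo_ind=> x; rewrite qoppE qaddE addNr. Qed.
HB.instance Definition _ := GRing.isZmodule.Build (quo q) qaddA qaddC qadd0 qaddN.

Lemma qscaleA k l a : qscale k (qscale l a) = qscale (k * l) a.
Proof. by elim/quo_ind: a => x; rewrite !qscaleE scalerA. Qed.
Lemma qscale1 : left_id 1 qscale.
Proof. by elim/quo_ind=> x; rewrite qscaleE scale1r. Qed.
Lemma qscaleDr : right_distributive qscale +%R.
Proof.
move=> k; elim/quo_ind=> x; elim/quo_ind=> y.
by rewrite [cl x + cl y]qaddE !qscaleE scalerDr [RHS]qaddE.
Qed.
Lemma qscaleDl a : {morph qscale^~ a : k l / k + l}.
Proof.
by elim/quo_ind: a => x k l; rewrite !qscaleE scalerDl [RHS]qaddE.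
Qed.
HB.instance Definition _ :=
  GRing.Zmodule_isLmodule.Build K (quo q) qscaleA qscale1 qscaleDr qscaleDl.

Lemma qmulA : associative qmul.
Proof.
elim/quo_ind=> x; elim/quo_ind=> y; elim/quo_ind=> z.
by rewrite !qmulE mulrA.
Qed.
Lemma qmul1 : left_id (cl 1) qmul.
Proof. by elim/quo_ind=> x; rewrite qmulE mul1r. Qed.
Lemma qmulr1 : right_id (cl 1) qmul.
Proof. by elim/quo_ind=> x; rewrite qmulE mulr1. Qed.
Lemma qmulDl : left_distributive qmul +%R.
Proof.
elim/quo_ind=> x; elim/quo_ind=> y; elim/quo_ind=> z.
by rewrite [cl x + cl y]qaddE !qmulE mulrDl [RHS]qaddE.
Qed.
Lemma qmulDr : right_distributive qmul +%R.
Proof.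
elim/quo_ind=> x; elim/quo_ind=> y; elim/quo_ind=> z.
by rewrite [cl y + cl z]qaddE !qmulE mulrDr [RHS]qaddE.
Qed.
Lemma qone_neq0 : cl 1 != 0.
Proof.
apply/eqP => /clP; rewrite subr0 => /eqP; apply/negP; exact: inorm1.
Qed.
HB.instance Definition _ := GRing.Zmodule_isNzRing.Build (quo q)
  qmulA qmul1 qmulr1 qmulDl qmulDr qone_neq0.

Lemma qscaleAl k (a b : quo q) : k *: (a * b) = (k *: a) * b.
Proof.
elim/quo_ind: a => x; elim/quo_ind: b => y.
by rewrite [cl x * cl y]qmulE [LHS]qscaleE [k *: cl x]qscaleE [RHS]qmulE scalerAl.
Qed.
Lemma qscaleAr k (a b : quo q) : k *: (a * b) = a * (k *: b).
Proof.
elim/quo_ind: a => x; elim/quo_ind: b => y.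
by rewrite [cl x * cl y]qmulE [LHS]qscaleE [k *: cl y]qscaleE [RHS]qmulE scalerAr.
Qed.
HB.instance Definition _ := GRing.Lmodule_isLalgebra.Build K (quo q) qscaleAl.
HB.instance Definition _ := GRing.Lalgebra_isAlgebra.Build K (quo q) qscaleAr.

Lemma cl_lin : linear cl.
Proof. by move=> k x y; rewrite [k *: cl x]qscaleE [RHS]qaddE. Qed.

Lemma clM x y : cl (x * y) = cl x * cl y.
Proof. by rewrite [RHS]qmulE. Qed.

Definition qpart b (a : quo q) := cl (hpart b (qval a)).

Lemma qpartE b x : qpart b (cl x) = cl (hpart b x).
Proof.
by apply/clP; rewrite /= -(linB (hpart_linear b)) inorm_even clN hpart0.
Qed.
Lemma qpart_linear b : linear (qpart b).
Proof.
move=> k; elim/quo_ind=> x; elim/quo_ind=> y.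
by rewrite -cl_lin !qpartE hpart_linear cl_lin.
Qed.
Lemma qpartK b c x : qpart b (qpart c x) = if b == c then qpart c x else 0.
Proof.
by elim/quo_ind: x => x; rewrite !qpartE hpartK; case: eqP.
Qed.
Lemma qpart_sum x : qpart false x + qpart true x = x.
Proof. by elim/quo_ind: x => x; rewrite !qpartE -(linD cl_lin) hpart_sum. Qed.
HB.instance Definition _ := isSuper.Build K (quo q) qpart_linear qpartK qpart_sum.

Lemma quo_homog b (a : quo q) : homogeneous b a ->
  exists2 x, homogeneous b x & a = cl x.
Proof.
elim/quo_ind: a => x; rewrite /homogeneous [hpart b _]qpartE => <-.
by exists (hpart b x) => //; apply: hpart_homog.
Qed.
Lemma cl_homog b x : homogeneous b x -> homogeneous b (cl x).
Proof. by move=> hx; rewrite /homogeneous [LHS]qpartE hx. Qed.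

Lemma qpart_one : hpart false (1 : quo q) = 1.
Proof. by apply: cl_homog; apply: homog1. Qed.
Lemma qpart_mul (i j : bool) (x y : quo q) :
  homogeneous i x -> homogeneous j y -> homogeneous (i (+) j) (x * y).
Proof.
move=> /quo_homog[x' hx ->] /quo_homog[y' hy ->]; rewrite -clM.
by apply: cl_homog; apply: homogM.
Qed.
Lemma qsupercomm (i j : bool) (x y : quo q) :
  homogeneous i x -> homogeneous j y -> x * y = (-1) ^+ (i && j) *: (y * x).
Proof.
move=> /quo_homog[x' hx ->] /quo_homog[y' hy ->]; rewrite -!clM.
by rewrite (supercomm _ _ _ _ hx hy) (linZ cl_lin).
Qed.
HB.instance Definition _ := isSAlg.Build K (quo q) qpart_one qpart_mul qsupercomm.

Lemma shom_cl : shom cl.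
Proof.
split; [exact: cl_lin| |by []|exact: clM].
by move=> b x; rewrite [RHS]qpartE.
Qed.

Lemma cl_eq0 x : cl x = 0 <-> q x = 0.
Proof. by rewrite -[X in _ <-> q X = _]subr0; symmetry; apply: clP. Qed.
End Quotient.

Lemma sideal_of (K : fieldType) (A : salgType K) (I : A -> Prop) :
  subsp I -> graded I -> (forall x y, I y -> I (x * y)) ->
  (forall x y, I x -> I (x * y)) -> ~ I 1 ->
  exists q : sideal A, forall x, q x = 0 <-> I x.
Proof.
move=> sI gI Il Ir nI1; have [p [hp ep pI Ip]] := graded_proj sI gI.
pose f x := x - p x.
have fP x : f x = 0 <-> I x.
  rewrite /f; split=> [/eqP|/Ip->]; last by rewrite subrr.
  by rewrite subr_eq0 => /eqP ->; apply: pI.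
have hf : linear f by apply: lin_add => //; apply: lin_opp.
have ef : evenmap f.
  by move=> b x; rewrite /f ep (linB (hpart_linear b)).
have fK x : f (f x) = f x.
  by rewrite {1}/f (_ : p (f x) = 0) ?subr0 // /f (linB hp) [p (p x)]Ip ?subrr.
have fl x y : f y = 0 -> f (x * y) = 0 by move=> /fP h; apply/fP; apply: Il.
have fr x y : f x = 0 -> f (x * y) = 0 by move=> /fP h; apply/fP; apply: Ir.
have f1 : f 1 != 0 by apply/eqP => /fP.
by exists (SIdeal hf ef fK fl fr f1).
Qed.

Section TensorMaps.
Variables (K : fieldType).
Implicit Types V W X : lmodType K.

Lemma tmap_comp V W V' W' V'' W'' (f : V -> V') (f' : V' -> V'')
    (g : W -> W') (g' : W' -> W'') t :
  linear f -> linear f' -> linear g -> linear g' ->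
  tmap f' g' (tmap f g t) = tmap (f' \o f) (g' \o g) t.
Proof.
move=> hf hf' hg hg'; rewrite [LHS](lin_tlift (tmap_linear hf' hg')); last exact: bilin_tens.
by apply: tlift_eq => v w; rewrite tmap_tens.
Qed.

Lemma eq_tmap V W V' W' (f f' : V -> V') (g g' : W -> W') :
  f =1 f' -> g =1 g' -> tmap f g =1 tmap f' g'.
Proof. by move=> ef eg t; apply: tlift_eq => v w; rewrite ef eg. Qed.

Lemma tassoc_nat V W X V' W' X' (f : V -> V') (g : W -> W') (h : X -> X') t :
  linear f -> linear g -> linear h ->
  tassoc (tmap (tmap f g) h t) = tmap f (tmap g h) (tassoc t).
Proof.
move=> hf hg hh; have hfg := tmap_linear hf hg; have hgh := tmap_linear hg hh.
move: t; apply: tensor_ext.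
- exact: (lin_comp (@tassoc_linear _ _ _ _) (tmap_linear hfg hh)).
- exact: (lin_comp (tmap_linear hf hgh) (@tassoc_linear _ _ _ _)).
move=> s x; rewrite tmap_tens //; move: s; apply: tensor_ext.
- exact: (lin_comp (@tassoc_linear _ _ _ _) (lin_comp (lin_tensl _) hfg)).
- exact: (lin_comp (tmap_linear hf hgh) (lin_comp (@tassoc_linear _ _ _ _) (lin_tensl _))).
move=> v w; rewrite tmap_tens // !tassoc_tens !tlift_tens; try exact: bilin_assoc_pure.
by rewrite !tmap_tens.
Qed.

Lemma tmap_cv (A B A' B' : salgType K) (f : A -> A') (g : B -> B') :
  tmap f g =1 cv (@iota1 _ A' B' \o f) (@iota2 _ A' B' \o g).
Proof. by move=> t; apply: tlift_eq => a b; rewrite /= iota12. Qed.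

Lemma shom_tmap (A B A' B' : salgType K) (f : A -> A') (g : B -> B') :
  shom f -> shom g -> shom (tmap f g).
Proof.
move=> sf sg.
have [h1 h2 h3 h4] : shom (cv (@iota1 _ A' B' \o f) (@iota2 _ A' B' \o g)).
  by apply: shom_cv; apply: shom_comp => //; [apply: shom_iota1|apply: shom_iota2].
split.
- by apply: tmap_linear; [apply: shom_lin sf|apply: shom_lin sg].
- by move=> b x; rewrite !tmap_cv h2.
- by rewrite tmap_cv h3.
- by move=> x y; rewrite !tmap_cv h4.
Qed.
End TensorMaps.

(** [hi_comul] says that Delta I is contained in I (x) A + A (x) I, tested on pairs of functionals
    vanishing on I. *)
Record hideal (K : fieldType) (A : hopfSAlgType K) := HIdeal {
  hi_ideal :> sideal A;
  hi_counit : forall x, hi_ideal x = 0 -> counit x = 0;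
  hi_antipode : forall x, hi_ideal x = 0 -> hi_ideal (antipode x) = 0;
  hi_comul : forall x, hi_ideal x = 0 -> forall f g : A -> K^o,
    linear f -> linear g -> (forall y, hi_ideal y = 0 -> f y = 0) ->
    (forall y, hi_ideal y = 0 -> g y = 0) -> g (ract f x) = 0
}.

Definition hquo (K : fieldType) (A : hopfSAlgType K) (I : hideal A) : Type := quo I.

Section HopfQuotient.
Variables (K : fieldType) (A : hopfSAlgType K) (I : hideal A).

HB.instance Definition _ := SAlg.on (hquo I).

Definition hcl (x : A) : hquo I := cl I x.

Lemma shom_hcl : shom hcl. Proof. exact: shom_cl. Qed.

Lemma hcl_eq0 x : hcl x = 0 <-> I x = 0. Proof. exact: cl_eq0. Qed.

Let hc : linear hcl := shom_lin shom_hcl.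

Lemma hquo_ind (P : hquo I -> Prop) : (forall x, P (hcl x)) -> forall a, P a.
Proof. exact: quo_ind. Qed.

Lemma ideal_diff x : I (qval (hcl x) - x) = 0.
Proof. exact: clN. Qed.

Lemma lift_hcl (W : lmodType K) (f : A -> W) x : linear f ->
  (forall y, I y = 0 -> f y = 0) -> f (qval (hcl x)) = f x.
Proof. by move=> hf f0; apply/eqP; rewrite -subr_eq0 -(linB hf) f0 // ideal_diff. Qed.

Lemma tmap_hcl_comul x : I x = 0 -> tmap hcl hcl (comul x) = 0.
Proof.
move=> Ix; apply: slice_eq0 => f g hf hg.
have hfc : linear (f \o hcl : A -> K^o) by apply: lin_comp.
have hgc : linear (g \o hcl : A -> K^o) by apply: lin_comp.
transitivity ((g \o hcl) (ract (f \o hcl) x)).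
  rewrite /tmap (lin_tlift (lsl_linear hf)); last exact: bilin_tens.
  rewrite (lin_tlift hgc); last exact: bilin_scalel.
  rewrite (lin_tlift hg); last first.
    by split=> [w|v] a u u'; rewrite !lsl_tens //= hc;
      rewrite ?hf ?scalerDl ?scalerDr ?scalerA // mulrC.
  apply: tlift_eq => a b; rewrite lsl_tens //= (linZ hc).
  by [].
apply: (hi_comul Ix) => //= y /hcl_eq0->; exact: lin0.
Qed.

Definition hcomul (a : hquo I) : tensor (hquo I) (hquo I) := tmap hcl hcl (comul (qval a)).
Definition hcounit (a : hquo I) : K := counit (qval a).
Definition hantipode (a : hquo I) : hquo I := hcl (antipode (qval a)).

Let hcc : linear (tmap hcl hcl) := tmap_linear hc hc.

Lemma hcomulE x : hcomul (hcl x) = tmap hcl hcl (comul x).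
Proof.
apply: (@lift_hcl _ (tmap hcl hcl \o comul)); last exact: tmap_hcl_comul.
by apply: (lin_comp hcc); apply: comul_lin.
Qed.

Lemma hcounitE x : hcounit (hcl x) = counit x.
Proof. by apply: (@lift_hcl K^o (counit : A -> K^o)); [apply: counit_lin|apply: hi_counit]. Qed.

Lemma hantipodeE x : hantipode (hcl x) = hcl (antipode x).
Proof.
apply: (@lift_hcl _ (hcl \o antipode)); first by apply: (lin_comp hc); apply: antipode_lin.
by move=> y Iy /=; apply/hcl_eq0; apply: hi_antipode.
Qed.

Lemma hcomul_linear : linear hcomul.
Proof.
move=> k; elim/hquo_ind=> x; elim/hquo_ind=> y.
by rewrite -hc !hcomulE comul_linear hcc.
Qed.

Lemma hcomul_hpart b x : hpart b (hcomul x) = hcomul (hpart b x).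
Proof.
elim/hquo_ind: x => x; have [_ e _ _] := shom_hcl; have [_ e' _ _] := shom_tmap shom_hcl shom_hcl.
by rewrite -e !hcomulE -e' comul_hpart.
Qed.

Lemma hcomul1 : hcomul 1 = tens 1 1.
Proof.
by have [_ _ e _] := shom_hcl; rewrite -{1}e hcomulE comul1 tmap_tens // e.
Qed.

Lemma hcomulM x y : hcomul (x * y) = tmul (hcomul x) (hcomul y).
Proof.
elim/hquo_ind: x => x; elim/hquo_ind: y => y.
have [_ _ _ e] := shom_hcl; have [_ _ _ e'] := shom_tmap shom_hcl shom_hcl.
by rewrite -e !hcomulE comulM e'.
Qed.

Lemma hcounit_scalar : scalar hcounit.
Proof.
move=> k; elim/hquo_ind=> x; elim/hquo_ind=> y.
by rewrite -hc !hcounitE counit_scalar.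
Qed.

Lemma hcounit_odd x : hcounit (hpart true x) = 0.
Proof.
elim/hquo_ind: x => x; have [_ e _ _] := shom_hcl.
by rewrite -e hcounitE counit_odd.
Qed.

Lemma hcounit1 : hcounit 1 = 1.
Proof. by have [_ _ e _] := shom_hcl; rewrite -e hcounitE counit1. Qed.

Lemma hcounitM x y : hcounit (x * y) = hcounit x * hcounit y.
Proof.
elim/hquo_ind: x => x; elim/hquo_ind: y => y; have [_ _ _ e] := shom_hcl.
by rewrite -e !hcounitE counitM.
Qed.

Lemma hantipode_linear : linear hantipode.
Proof.
move=> k; elim/hquo_ind=> x; elim/hquo_ind=> y.
by rewrite -hc !hantipodeE antipode_linear hc.
Qed.

Lemma hantipode_hpart b x : hpart b (hantipode x) = hantipode (hpart b x).
Proof.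
elim/hquo_ind: x => x; have [_ e _ _] := shom_hcl.
by rewrite hantipodeE -!e hantipodeE antipode_hpart.
Qed.

Lemma hcomulA x :
  tassoc (tmap hcomul idfun (hcomul x)) = tmap idfun hcomul (hcomul x).
Proof.
have hi (X : lmodType K) : linear (@idfun X) by [].
have hD := @comul_lin _ A; have hD' := hcomul_linear.
elim/hquo_ind: x => x; rewrite hcomulE !tmap_comp //.
rewrite (@eq_tmap _ _ _ _ _ _ (tmap hcl hcl \o comul) _ (hcl \o idfun) hcomulE) //.
rewrite (@eq_tmap _ _ _ _ _ (idfun \o hcl) (hcl \o idfun) _ (tmap hcl hcl \o comul) _ hcomulE) //.
by rewrite -!tmap_comp // tassoc_nat // comulA.
Qed.

Lemma hcounitl x : tlift (fun a b => hcounit a *: b) (hcomul x) = x.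
Proof.
have hC := @counit_lin _ A.
elim/hquo_ind: x => x; rewrite hcomulE -[in RHS](counitl x) (lin_tlift hc); last first.
  exact: (bilin_scalel _ hC).
rewrite [in LHS]/tmap [LHS](lin_tlift (@lsl_linear _ _ _ _ hcounit_scalar)); last first.
  exact: bilin_tens.
apply: tlift_eq => a b; rewrite lsl_tens; last exact: hcounit_scalar.
by rewrite hcounitE (linZ hc).
Qed.

Lemma hcounitr x : tlift (fun a b => hcounit b *: a) (hcomul x) = x.
Proof.
have hC := @counit_lin _ A.
elim/hquo_ind: x => x; rewrite hcomulE -[in RHS](counitr x) (lin_tlift hc); last first.
  exact: (bilin_scaler _ hC).
rewrite [in LHS]/tmap [LHS](lin_tlift (@rsl_linear _ _ _ _ hcounit_scalar)); last first.
  exact: bilin_tens.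
apply: tlift_eq => a b; rewrite rsl_tens; last exact: hcounit_scalar.
by rewrite hcounitE (linZ hc).
Qed.

Lemma hantipodel x :
  tlift (fun a b => hantipode a * b) (hcomul x) = (hcounit x)%:A.
Proof.
have hS := @antipode_lin _ A; have hS' := hantipode_linear.
have [_ _ e1 eM] := shom_hcl.
elim/hquo_ind: x => x; rewrite hcomulE hcounitE.
have -> : (counit x)%:A = hcl (counit x)%:A by rewrite (linZ hc) e1.
rewrite -antipodel (lin_tlift hc); last exact: (bilin_mul (g := idfun)).
rewrite [in LHS]/tmap [LHS](lin_tlift (cv_lin hS' (@lin_id _ _))); last exact: bilin_tens.
by apply: tlift_eq => a b; rewrite cv_tens // hantipodeE eM.
Qed.

Lemma hantipoder x :
  tlift (fun a b => a * hantipode b) (hcomul x) = (hcounit x)%:A.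
Proof.
have hS := @antipode_lin _ A; have hS' := hantipode_linear.
have [_ _ e1 eM] := shom_hcl.
elim/hquo_ind: x => x; rewrite hcomulE hcounitE.
have -> : (counit x)%:A = hcl (counit x)%:A by rewrite (linZ hc) e1.
rewrite -antipoder (lin_tlift hc); last exact: (bilin_mul (f := idfun)).
rewrite [in LHS]/tmap [LHS](lin_tlift (cv_lin (@lin_id _ _) hS')); last exact: bilin_tens.
by apply: tlift_eq => a b; rewrite cv_tens // hantipodeE eM.
Qed.

HB.instance Definition _ := isHopfSAlg.Build K (hquo I) hcomul_linear hcomul_hpart
  hcomul1 hcomulM hcounit_scalar hcounit_odd hcounit1 hcounitM hantipode_linear
  hantipode_hpart hcomulA hcounitl hcounitr hantipodel hantipoder.

Definition hquo_hom : hopf_hom A (hquo I) :=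
  @mk_hopf_hom K A (hquo I) hcl shom_hcl hcomulE hcounitE.

Lemma hquo_homE x : hquo_hom x = hcl x. Proof. by []. Qed.
End HopfQuotient.

Record hopf_ideal (K : fieldType) (A : hopfSAlgType K) (I : A -> Prop) : Prop := HopfIdeal {
  hid_subsp : subsp I;
  hid_graded : graded I;
  hid_mull : forall a x, I x -> I (a * x);
  hid_mulr : forall a x, I x -> I (x * a);
  hid_counit : forall x, I x -> counit x = 0;
  hid_antipode : forall x, I x -> I (antipode x);
  hid_comul : forall x, I x -> forall f g : A -> K^o, linear f -> linear g ->
    (forall y, I y -> f y = 0) -> (forall y, I y -> g y = 0) -> g (ract f x) = 0
}.

Lemma hideal_of (K : fieldType) (A : hopfSAlgType K) (I : A -> Prop) :
  hopf_ideal I -> exists J : hideal A, forall x, J x = 0 <-> I x.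
Proof.
move=> [sI gI Il Ir I1 I2 I3].
have nI : ~ I 1 by move=> /I1/eqP; rewrite counit1 oner_eq0.
have [q qE] := sideal_of sI gI Il (fun x y h => Ir y x h) nI.
have q1 x : q x = 0 -> counit x = 0 by move=> /qE/I1.
have q2 x : q x = 0 -> q (antipode x) = 0 by move=> /qE h; apply/qE; apply: I2.
have q3 x : q x = 0 -> forall f g : A -> K^o,
    linear f -> linear g -> (forall y, q y = 0 -> f y = 0) ->
    (forall y, q y = 0 -> g y = 0) -> g (ract f x) = 0.
  by move=> /qE h f g hf hg f0 g0; apply: I3 => // y /qE; [apply: f0|apply: g0].
by exists (HIdeal q1 q2 q3).
Qed.

(** * Coinvariants and the ideals they generate *)

Section Coinvariants.
Variables (K : fieldType) (A : hopfSAlgType K).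
Variables (H : A -> Prop) (hH : subhopf H).

Let sH := sh_subsp hH.

(* [Delta x - 1 (x) x] lies in [A (x) H]. *)
Definition coinvmod (x : A) : Prop :=
  forall f : A -> K^o, linear f -> H (ract f x - (f 1 : K) *: x).

Lemma subsp_coinvmod : subsp coinvmod.
Proof.
split=> [f hf|a x y hx hy f hf].
  by rewrite (lin0 (ract_lin hf)) scaler0 subrr; apply: subsp0.
rewrite (ract_lin hf) scalerDr opprD addrACA scalerA mulrC -scalerA -scalerBr.
by case: sH => _; apply; [apply: hx|apply: hy].
Qed.

Lemma coinvmod_H x : H x -> coinvmod x.
Proof.
by move=> Hx f hf; apply: subspB => //; [apply: sh_left|apply: subspZ].
Qed.

Lemma coinvmod_graded : graded coinvmod.
Proof.
move=> b x hx f hf; rewrite (ract_parts _ hf).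
have -> : f 1 = \sum_(c : bool) (f \o hpart c) 1.
  by rewrite -{1}(hpart_bool (1 : A)) (lin_sum hf).
rewrite scaler_suml -sumrB; apply: subsp_sum => // c _.
have [h1 h2] := fdeg_part c hf; rewrite (ract_hpart _ _ h1 h2).
have -> : ((f \o hpart c) 1 : K) *: hpart b x =
    hpart (b (+) c) (((f \o hpart c) 1 : K) *: x).
  rewrite (linZ (hpart_linear _)) /= (homogP _ (homog1 A)).
  by case: c {h1 h2}; rewrite /= ?(lin0 hf) ?scale0r ?addbF.
rewrite -(linB (hpart_linear _)); apply: sh_graded => //; exact: hx.
Qed.

(** The first step modulo H is a Hopf module over H, hence generated by coinvariants. Explicitly,
    let eta = 1 - p for a projection p onto H and z(x) = S(x_1) eta(x_2), the usual projection to
    coinvariants; then eta(x) = x_1 z(x_2). If z took the first step into H, so would eta, and the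
    first step would be H. *)
Lemma exists_coinvmod : (forall x, Filu H x) -> (exists x, ~ H x) ->
  exists x, coinvmod x /\ ~ H x.
Proof.
move=> exh [x0 nHx0].
have [x1 [Dx1 nHx1]] : exists x, Fil H 1 x /\ ~ H x.
  apply: contrapT => nex.
  have FH n x : Fil H n x -> H x.
    elim: n x => // n IHn x hx; apply: contrapT => nHx; apply: nex; exists x; split=> //.
    by move=> f hf f0; apply: hx => // y /IHn; apply: f0.
  by have [n /FH] := exh x0.
have [p [hp ep pH Hp]] := graded_proj sH (sh_graded hH).
pose eta x := x - p x.
have he : linear eta by apply: lin_add => //; apply: lin_opp.
have eH x : H x -> eta x = 0 by move=> /Hp; rewrite /eta => ->; rewrite subrr.
have He x : eta x = 0 -> H x by move=> /eqP; rewrite subr_eq0 => /eqP ->; apply: pH.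
have pE x : x = eta x + p x by rewrite subrK.
have hS := @antipode_lin _ A; have hi := @lin_id _ A; have hD := @comul_lin _ A.
have D_left x g : linear g -> Fil H 1 x -> Fil H 1 (ract g x).
  move=> hg Dx f hf f0; rewrite ract_ract //; apply: Dx; first exact: fconv_lin.
  by move=> y Hy; rewrite fconvE //; apply: f0; apply: sh_left.
(* Once [eta] is applied to the second factor, the first factors lie in H, because functionals
   vanishing on H slice x into H; the second factors lie in the first step, which is stable under
   left slices. *)
have rep x : Fil H 1 x -> exists n (a b : 'I_n -> A),
    [/\ tmap idfun eta (comul x) = \sum_i tens (a i) (b i), forall i, H (a i) &
        forall i, Fil H 1 (b i)].
  move=> Dx; have [n [a [b [e fa fb]]]] := tensor_rep (tmap idfun eta (comul x)).
  have rE f : linear f -> eta (ract f x) = \sum_i (f (a i) : K) *: b i.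
    move=> hf; rewrite -lsl_sum // -e /ract (lin_tlift he); last exact: bilin_scalel.
    rewrite /tmap (lin_tlift (lsl_linear hf)); last exact: bilin_tens.
    by apply: tlift_eq => u w; rewrite lsl_tens // (linZ he).
  exists n, a, b; split=> // i.
    apply: sepS => // f hf f0; apply: (fb (fun i => f (a i))).
    by rewrite -rE // eH //; apply: Dx.
  have [g [hg gE]] := dual_fam fa.
  have -> : b i = eta (ract (g i) x) by rewrite rE // (@dual_sum _ _ _ _ _ i).
  apply: (subspB (subsp_Fil hH 1)); first exact: D_left.
  by apply: (Fil_S hH (n := 0)); apply: pH.
have cvE (R : salgType K) (f h : A -> R) x n (a b : 'I_n -> A) :
    linear f -> linear h -> (forall y, H y -> h y = 0) ->
    tmap idfun eta (comul x) = \sum_i tens (a i) (b i) ->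
    pt_mul f h x = \sum_i f (a i) * h (b i).
  move=> hf hh h0 e; rewrite -cv_sum // -e /tmap (lin_tlift (cv_lin hf hh)); last first.
    exact: bilin_tens.
  apply: tlift_eq => u w; rewrite cv_tens //; congr (_ * _).
  by rewrite {1}(pE w) (linD hh) (h0 (p w)) // addr0.
pose z := pt_mul antipode eta.
have hz : linear z by apply: pt_mul_lin.
have zero (R : salgType K) (f h : A -> R) : linear f -> linear h ->
    (forall y, H y -> h y = 0) -> forall y, H y -> pt_mul f h y = 0.
  move=> hf hh h0 y Hy; rewrite pt_mulE.
  have [n [a [b [-> Hb]]]] := inr_comul sH (sh_left hH) Hy.
  by rewrite cv_sum // big1 // => i _; rewrite h0 ?mulr0.
have zH : forall y, H y -> z y = 0 by apply: zero.
have [x [Dx nHz]] : exists x, Fil H 1 x /\ ~ H (z x).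
  apply: contrapT => nex; apply: nHx1; apply: He.
  have Hz x : Fil H 1 x -> H (z x).
    by move=> Dx; apply: contrapT => nHz; apply: nex; exists x.
  suff : H (eta x1) by move=> h; rewrite (pE x1) (linD he) (eH (p x1)) // addr0 eH.
  have -> : eta x1 = pt_mul idfun z x1.
    rewrite /z -pt_mulA // (eq_pt_mul (f' := eps A) (g' := eta) (pt_mulVr (shom_id A))) //.
    by rewrite pt_mul1l.
  have [n [a [b [e Ha Db]]]] := rep _ Dx1; rewrite (cvE _ _ _ _ _ _ _ hi hz zH e).
  by apply: subsp_sum => // i _; apply: (sh_mul hH (Ha i) (Hz _ (Db i))).
exists (z x); split=> //.
have s1 := shom_iota1 A A; have s2 := shom_iota2 A A.
have [h1 _ i11 _] := s1; have [h2 _ _ i2M] := s2.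
pose s1S := @iota1 _ A A \o antipode; pose s2S := @iota2 _ A A \o antipode.
have h1S : linear s1S by apply: lin_comp.
have h2S : linear s2S by apply: lin_comp.
have hDe : linear (@comul K A \o eta) by apply: lin_comp.
have sT : subsp (fun t : tensor A A => forall f : A -> K^o, linear f -> H (lsl f t)).
  split=> [f hf|a t t' ht ht' f hf]; first by rewrite (lin0 (lsl_linear hf)); apply: subsp0.
  by rewrite (lsl_linear hf); case: sH => _; apply; [apply: ht|apply: ht'].
set T := (fun t : tensor A A => _) in sT.
have TM s t : inr_ H s -> T t -> T (s * t).
  move=> hs ht f hf; apply: lsl_inr => //.
  apply: (inr_mul (S := H) (T := H)) => //; [exact: sh_graded|exact: sh_mul|].
  exact: inr_lsl.
have T1 a t : T t -> T (iota1 A a * t).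
  move=> ht; apply: TM => //; exists 1%N, (fun=> a), (fun=> 1).
  by rewrite big_ord1; split=> // i; apply: sh_one.
have T2 a t : H a -> T t -> T (iota2 A a * t).
  move=> Ha ht; apply: TM => //; exists 1%N, (fun=> 1), (fun=> a).
  by rewrite big_ord1; split.
(* By [comul_antipode], Delta z(x) = (1 (x) S(x_1)) w(x_2). Modulo A (x) H, w(y) is 1 (x) y, because
   Delta eta and Delta differ by Delta p. With the expansion of [rep] this gives Delta z(x) = 1 (x)
   z(x) modulo A (x) H. *)
pose w := pt_mul s1S (comul \o eta).
have hw : linear w by apply: pt_mul_lin.
have wH : forall y, H y -> w y = 0.
  by apply: zero => // y Hy; rewrite /= eH // (lin0 hD).
have wE y : T (w y - iota2 A y).
  have -> : iota2 A y = pt_mul s1S comul y.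
    rewrite (eq_pt_mul (fun=> erefl) (@comul_iota _ A)) -pt_mulA //.
    rewrite (@eq_pt_mul _ _ _ _ (eps _) _ (@iota2 _ A A)) ?pt_mul1l //.
    exact: pt_mulVl.
  have [n [a [b [e _ _]]]] := tensor_rep (comul y).
  rewrite /w !pt_mulE e !cv_sum // -sumrB; apply: subsp_sum => // i _.
  rewrite -mulrBr; apply: T1 => f hf.
  rewrite /= /eta (linB hD) addrC addrA addNr add0r (linN (lsl_linear hf)).
  by apply: subspN => //; apply: sh_left.
have Dz : comul (z x) = pt_mul s2S w x.
  rewrite /z -[LHS]/((comul \o pt_mul antipode eta) x).
  rewrite (pt_mul_comp hS he hD (shomM (shom_comul A))).
  rewrite (eq_pt_mul (@comul_antipode _ A) (fun=> erefl)) pt_mulA //.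
have [n [a [b [e Ha Db]]]] := rep _ Dx.
have zE : z x = \sum_i antipode (a i) * b i.
  rewrite /z pt_mulE.
  transitivity (cv antipode idfun (tmap idfun eta (comul x))).
    rewrite [RHS](lin_tlift (cv_lin hS hi)); last exact: bilin_tens.
    by apply: tlift_eq => u v; rewrite cv_tens.
  by rewrite e cv_sum.
have TD : T (comul (z x) - iota2 A (z x)).
  rewrite Dz (cvE _ _ _ _ _ _ _ h2S hw wH e) zE (lin_sum h2) -sumrB.
  apply: subsp_sum => // i _; rewrite i2M -mulrBr; apply: T2 => //.
  exact: sh_antipode.
move=> f hf; have := TD f hf; rewrite (linB (lsl_linear hf)) /iota2 lsl_tens //.
Qed.
End Coinvariants.

(** * Hopf ideals generated by coinvariants *)

Section IdealOfCoinvariants.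
Variables (K : fieldType) (A : hopfSAlgType K).
Variables (H : A -> Prop) (hH : subhopf H).

Let sH := sh_subsp hH.

(* [Delta x - 1 (x) x] lies in [X (x) H] for all [x] in [X]. *)
Record cosub (X : A -> Prop) : Prop := CoSub {
  cs_subsp : subsp X;
  cs_graded : graded X;
  cs_counit : forall x, X x -> counit x = 0;
  cs_coinv : forall x, X x -> coinvmod H x;
  cs_right : forall x, X x -> forall g : A -> K^o, linear g ->
    X (lact g x - (g x : K)%:A)
}.

Variables (X : A -> Prop) (hX : cosub X).

Definition gen_ideal (y : A) : Prop :=
  exists n (a x : 'I_n -> A), (forall k, X (x k)) /\ y = \sum_k a k * x k.

Lemma gen_ideal1 a x : X x -> gen_ideal (a * x).
Proof. by move=> Xx; exists 1%N, (fun=> a), (fun=> x); rewrite big_ord1. Qed.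

Lemma subsp_gen_ideal : subsp gen_ideal.
Proof.
split; first by exists 0%N, (fun=> 0), (fun=> 0); split=> [[]|]; rewrite ?big_ord0.
move=> c _ _ [n [a [x [Xx ->]]]] [m [b [y [Xy ->]]]].
exists (n + m)%N, (fun k => match split k with inl i => c *: a i | inr j => b j end),
  (fun k => match split k with inl i => x i | inr j => y j end).
split; first by move=> k; case: split.
rewrite big_split_ord scaler_sumr; congr (_ + _); apply: eq_bigr => i _.
  by rewrite (unsplitK (inl i)) scalerAl.
by rewrite (unsplitK (inr i)).
Qed.

Lemma gen_ideal_l b y : gen_ideal y -> gen_ideal (b * y).
Proof.
move=> [n [a [x [Xx ->]]]]; exists n, (fun k => b * a k), x; split=> //.
by rewrite mulr_sumr; apply: eq_bigr => k _; rewrite mulrA.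
Qed.

Lemma gen_ideal_r b y : gen_ideal y -> gen_ideal (y * b).
Proof.
move=> [n [a [x [Xx ->]]]]; rewrite mulr_suml.
apply: subsp_sum => [|k _]; first exact: subsp_gen_ideal.
rewrite -mulrA -(hpart_bool (x k)) mulr_suml mulr_sumr.
apply: subsp_sum => [|i _]; first exact: subsp_gen_ideal.
rewrite -(hpart_bool b) !mulr_sumr.
apply: subsp_sum => [|j _]; first exact: subsp_gen_ideal.
rewrite (supercomm _ _ _ _ (hpart_homog i (x k)) (hpart_homog j b)).
rewrite -scalerAr mulrA; apply: subspZ; first exact: subsp_gen_ideal.
by apply: gen_ideal1; apply: cs_graded.
Qed.

Lemma gen_ideal_graded : graded gen_ideal.
Proof.
move=> b _ [n [a [x [Xx ->]]]]; rewrite (lin_sum (hpart_linear _)).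
apply: subsp_sum => [|k _]; first exact: subsp_gen_ideal.
rewrite -(hpart_bool (x k)) mulr_sumr (lin_sum (hpart_linear _)).
apply: subsp_sum => [|c _]; first exact: subsp_gen_ideal.
rewrite (hpartMr _ _ (hpart_homog c _)); apply: gen_ideal1; exact: cs_graded.
Qed.

Lemma gen_ideal_counit y : gen_ideal y -> counit y = 0.
Proof.
move=> [n [a [x [Xx ->]]]]; rewrite (lin_sum (@counit_lin _ A)) big1 // => k _.
by rewrite counitM (cs_counit hX (Xx k)) mulr0.
Qed.

Lemma cosub_rep x : X x -> exists n (y h : 'I_n -> A),
  [/\ comul x = tens 1 x + \sum_i tens (y i) (h i), forall i, X (y i) & forall i, H (h i)].
Proof.
move=> Xx; have [n [y [h [e fy fh]]]] := tensor_rep (comul x - tens 1 x).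
exists n, y, h; split.
- by rewrite -e addrC subrK.
- move=> i; have [g [hg gE]] := dual_fam fh.
  have := cs_right hX Xx (hg i); rewrite /lact.
  have -> : (g i x : K)%:A = rsl (g i) (tens 1 x : tensor A A) by rewrite rsl_tens.
  by rewrite -(linB (rsl_linear (hg i))) e rsl_sum // (@dual_sum _ _ _ _ _ i).
- move=> i; have [g [hg gE]] := dual_fam fy.
  have := cs_coinv hX Xx (hg i); rewrite /ract.
  have -> : (g i 1 : K) *: x = lsl (g i) (tens 1 x : tensor A A) by rewrite lsl_tens.
  by rewrite -(linB (lsl_linear (hg i))) e lsl_sum // (@dual_sum _ _ _ _ _ i).
Qed.

(** For a generator, Delta x = 1 (x) x + sum y_i (x) h_i with y_i in X. The antipode axiom gives 0 =
    eps(x) = S(x) + sum y_i S(h_i), so S(x) lies in the ideal. *)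
Lemma gen_ideal_antipode y : gen_ideal y -> gen_ideal (antipode y).
Proof.
have hS := @antipode_lin _ A; have [_ _ S1 SM] := shom_antipode A.
move=> [n [a [x [Xx ->]]]]; rewrite (lin_sum hS).
apply: subsp_sum => [|k _]; first exact: subsp_gen_ideal.
rewrite SM; apply: gen_ideal_l.
have [m [z [h [e Xz _]]]] := cosub_rep (Xx k).
have := pt_mulVr (shom_id A) (x k); rewrite /eps (cs_counit hX (Xx k)) scale0r.
rewrite pt_mulE e (linD (cv_lin (@lin_id _ A) hS)) cv_tens // cv_sum // mul1r.
move=> /eqP; rewrite addr_eq0 => /eqP /= ->.
apply: subspN; first exact: subsp_gen_ideal.
apply: subsp_sum => [|i _]; first exact: subsp_gen_ideal.
by apply: gen_ideal_r; rewrite -[z i]mul1r; apply: gen_ideal1.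
Qed.

Lemma gen_ideal_comul y : gen_ideal y -> forall f g : A -> K^o,
  linear f -> linear g -> (forall z, gen_ideal z -> f z = 0) ->
  (forall z, gen_ideal z -> g z = 0) -> g (ract f y) = 0.
Proof.
move=> [n [a [x [Xx ->]]]] f g hf hg f0 g0.
have hgf : linear (fun t : tensor A A => g (lsl f t)) by exact: (lin_comp hg (lsl_linear hf)).
rewrite (lin_sum (ract_lin hf)) (lin_sum hg) big1 // => k _.
rewrite /ract comulM; have [m [z [h [-> Xz _]]]] := cosub_rep (Xx k).
have [l [b [c [-> _ _]]]] := tensor_rep (comul (a k)).
have eM (s t : tensor A A) : tmul s t = s * t by [].
rewrite eM mulr_suml (lin_sum hgf) big1 // => i _.
have kill u v : (gen_ideal u \/ gen_ideal v) -> g (lsl f (tens u v)) = 0.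
  move=> huv; rewrite lsl_tens // (linZ hg); case: huv => [/f0->|/g0->].
    by rewrite [_ *: _]mul0r.
  by rewrite scaler0.
have tM (u v u' v' : A) : tens u v * tens u' v' = \sum_(i : bool) \sum_(j : bool)
    (-1) ^+ (i && j) *: tens (u * hpart j u') (hpart i v * v') :> tensor A A.
  exact: tmul_tens.
have killM (u v u' v' : A) :
    (forall j, gen_ideal (u * hpart j u')) \/ (forall j, gen_ideal (hpart j v * v')) ->
    g (lsl f (tens u v * tens u' v')) = 0.
  move=> huv; rewrite tM (lin_sum hgf) big1 // => d _.
  rewrite (lin_sum hgf) big1 // => d' _.
  by rewrite (linZ hgf) kill ?scaler0 //; case: huv => huv; [left|right].
rewrite mulrDr mulr_sumr (linD hgf) killM; last by right=> d; apply: gen_ideal1.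
rewrite add0r [LHS](lin_sum hgf) big1 // => j _.
by rewrite killM //; left=> d; apply: gen_ideal1; apply: cs_graded.
Qed.

Lemma hopf_ideal_gen : hopf_ideal gen_ideal.
Proof.
split.
- exact: subsp_gen_ideal.
- exact: gen_ideal_graded.
- exact: gen_ideal_l.
- exact: gen_ideal_r.
- exact: gen_ideal_counit.
- exact: gen_ideal_antipode.
exact: gen_ideal_comul.
Qed.
End IdealOfCoinvariants.

(** * Characteristic zero *)

Section AugIdeal.
Variables (K : fieldType) (A : hopfSAlgType K).
Variables (H : A -> Prop) (hH : subhopf H).

Let sH := sh_subsp hH.
Let hC := @counit_lin K A.

Lemma subsp_augideal : subsp (augideal H).
Proof.
split; first by exists [::]; split=> //; rewrite big_nil.
move=> c _ _ [s [hs ->]] [t [ht ->]].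
exists ([seq (c *: u.1, u.2) | u <- s] ++ t); split.
  move=> u; rewrite mem_cat => /orP[/mapP[v vs ->]|]; last exact: ht.
  have [h1 h2] := hs v vs; split; first exact: subspZ.
  by rewrite /= (linZ hC) h2 scaler0.
rewrite big_cat big_map scaler_sumr; congr (_ + _).
by apply: eq_bigr => u _; rewrite scalerAl.
Qed.

Lemma augideal1 h a : H h -> counit h = 0 -> augideal H (h * a).
Proof.
move=> Hh eh; exists [:: (h, a)]; split; last by rewrite big_seq1.
by move=> u; rewrite inE => /eqP ->.
Qed.

Lemma augideal_r x y : augideal H x -> augideal H (x * y).
Proof.
move=> [s [hs ->]]; rewrite mulr_suml big_seq; apply: subsp_sum => [|u us].
  exact: subsp_augideal.
by have [h1 h2] := hs u us; rewrite -mulrA; apply: augideal1.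
Qed.

Lemma augideal_l x y : augideal H y -> augideal H (x * y).
Proof.
move=> [s [hs ->]]; rewrite mulr_sumr big_seq; apply: subsp_sum => [|u us].
  exact: subsp_augideal.
have [h1 h2] := hs u us; rewrite mulrA; apply: augideal_r.
rewrite -(hpart_bool u.1) -(hpart_bool x) mulr_suml.
apply: subsp_sum => [|i _]; first exact: subsp_augideal.
rewrite mulr_sumr; apply: subsp_sum => [|j _]; first exact: subsp_augideal.
rewrite (supercomm _ _ _ _ (hpart_homog i x) (hpart_homog j u.1)).
apply: subspZ; first exact: subsp_augideal.
by apply: augideal1; [apply: sh_graded|apply: counit_hpart].
Qed.

Lemma augideal_graded : graded (augideal H).
Proof.
move=> b _ [s [hs ->]]; rewrite (lin_sum (hpart_linear _)) big_seq.
apply: subsp_sum => [|u us]; first exact: subsp_augideal.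
have [h1 h2] := hs u us.
rewrite -(hpart_bool u.2) mulr_sumr (lin_sum (hpart_linear _)).
apply: subsp_sum => [|c _]; first exact: subsp_augideal.
rewrite (hpartMr _ _ (hpart_homog c _)); apply: augideal1; first exact: sh_graded.
exact: counit_hpart.
Qed.

Lemma counit_augideal x : augideal H x -> counit x = 0.
Proof.
move=> [s [hs ->]]; rewrite (lin_sum hC) big_seq big1 // => u us.
by have [h1 h2] := hs u us; rewrite counitM h2 mul0r.
Qed.

Lemma augideal_H h : H h -> augideal H (h - (counit h)%:A).
Proof.
move=> Hh; rewrite -[X in augideal H X]mulr1; apply: augideal1.
  by apply: subspB => //; apply: subspZ => //; apply: sh_one.
by rewrite (linB hC) (linZ hC) counit1 [_ *: _]mulr1 subrr.
Qed.

Lemma augideal_sideal : exists q : sideal A, forall x, q x = 0 <-> augideal H x.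
Proof.
apply: sideal_of; [exact: subsp_augideal|exact: augideal_graded|exact: augideal_l|
  exact: augideal_r|].
by move=> /counit_augideal/eqP; rewrite counit1 oner_eq0.
Qed.

(** Delta x lies in Fil n (x) A + A (x) H; f kills the first factor of one summand and h the second
    factor of the other. *)
Lemma Fil_cv (R : salgType K) (f h : A -> R) n x : linear f -> linear h ->
  (forall y, H y -> h y = 0) -> (forall y, Fil H n y -> f y = 0) -> Fil H n.+1 x ->
  pt_mul f h x = 0.
Proof.
move=> hf hh h0 f0 Fx; have [p [hp pH Hp]] := proj_on sH.
pose eta y := y - p y.
have he : linear eta by apply: lin_add => //; apply: lin_opp.
have [m [a [b [e fa fb]]]] := tensor_rep (tmap idfun eta (comul x)).
have aF i : Fil H n (a i).
  apply: sepS => [|g hg g0]; first exact: subsp_Fil.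
  apply: (fb (fun i => g (a i))); rewrite -lsl_sum // -e.
  rewrite /tmap (lin_tlift (lsl_linear hg)); last exact: bilin_tens.
  transitivity (eta (ract g x)).
    rewrite /ract (lin_tlift he); last exact: bilin_scalel.
    by apply: tlift_eq => u w; rewrite lsl_tens // (linZ he).
  by rewrite /eta Hp ?subrr //; apply: Fx.
transitivity (cv f h (tmap idfun eta (comul x))).
  rewrite [RHS](lin_tlift (cv_lin hf hh)); last exact: bilin_tens.
  apply: tlift_eq => u w; rewrite cv_tens // /eta (linB hh) (h0 (p w)) ?subr0 //.
by rewrite e cv_sum // big1 // => i _; rewrite f0 // mul0r.
Qed.
End AugIdeal.

Section CharZero.
Variables (K : fieldType) (char0 : [pchar K] =i pred0).

Lemma nat_neq0 n : n.+1%:R != 0 :> K.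
Proof. by have /pcharf0P-> := char0. Qed.

(** The factor N is split off so that [linear_term_eq0] can see two of them in a product of two such
    binomial coefficients. *)
Lemma binomial_poly i : exists B : {poly K}, forall N,
  ('C(N, i.+1))%:R = N%:R * B.[N%:R].
Proof.
elim: i => [|i [B hB]].
  by exists 1 => N; rewrite bin1 hornerC mulr1.
exists (i.+2%:R^-1 *: (B * ('X - i.+1%:R%:P))) => N.
apply: (mulfI (nat_neq0 i.+1)).
rewrite -natrM mul_bin_left natrM hornerZ hornerM hornerXsubC.
rewrite [N%:R * (_^-1 * _)]mulrCA [RHS]mulrA mulfV ?nat_neq0 // mul1r mulrA -hB mulrC.
have [hN|hN] := leqP i.+1 N; first by rewrite natrB.
by rewrite bin_small // !mul0r.
Qed.

(* Comparing the terms linear in [N]: the left-hand side below is divisible by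
   [N ^ 2] as a polynomial in [N]. *)
Lemma linear_term_eq0 M (r : nat -> nat -> K) (l : K) :
  (forall N, \sum_(i < M) \sum_(j < M) ('C(N, i.+1) * 'C(N, j.+1))%:R * r i j = N%:R * l) ->
  l = 0.
Proof.
move=> h; pose B i := sval (cid (binomial_poly i)).
have BE i N : ('C(N, i.+1))%:R = N%:R * (B i).[N%:R] by rewrite /B; case: (cid _).
pose g : {poly K} := (\sum_(i < M) \sum_(j < M) (B i * B j * (r i j)%:P)) * 'X - l%:P.
have gE N : g.[N.+1%:R] = 0.
  apply: (mulfI (nat_neq0 N)); rewrite mulr0 hornerD hornerN hornerC hornerMX.
  rewrite mulrBr -h horner_sum mulrA mulr_sumr mulr_suml.
  apply/eqP; rewrite subr_eq0; apply/eqP; apply: eq_bigr => i _.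
  rewrite horner_sum mulr_sumr mulr_suml; apply: eq_bigr => j _.
  rewrite natrM !BE !hornerM hornerC.
  by rewrite [LHS]mulrC [in RHS]mulrACA -!mulrA.
suff g0 : g = 0.
  have : g.[0] = 0 by rewrite g0 horner0.
  by rewrite hornerD hornerN hornerC hornerMX mulr0 sub0r => /eqP; rewrite oppr_eq0 => /eqP.
apply: (@roots_geq_poly_eq0 _ g [seq n.+1%:R | n <- iota 0 (size g)]).
- by apply/allP => _ /mapP[n _ ->]; rewrite /root gE.
- rewrite map_inj_in_uniq ?iota_uniq // => m n _ _ /eqP.
  wlog mn : m n / (m <= n)%N.
    by move=> W; case: (leqP m n) => [/W//|/ltnW/W h1]; rewrite eq_sym => /h1.
  rewrite eq_sym -subr_eq0 -natrB // subSS => /eqP e; apply/eqP; rewrite eqn_leq mn /=.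
  rewrite -subn_eq0; move: e; case: (n - m)%N => // k /eqP.
  by rewrite (negbTE (nat_neq0 k)).
- by rewrite size_map size_iota.
Qed.
End CharZero.

Lemma pt_mul_suml (K : fieldType) (A : hopfSAlgType K) (R : salgType K) n
    (f : 'I_n -> A -> R) (c : 'I_n -> nat) (g : A -> R) x :
  pt_mul (fun y => \sum_k f k y *+ c k) g x = \sum_k pt_mul (f k) g x *+ c k.
Proof.
transitivity (\sum_(u <- repr (comul x)) (\sum_k f k u.1 *+ c k) * g u.2) => //.
under eq_bigr => u _ do rewrite mulr_suml.
rewrite exchange_big; apply: eq_bigr => k _.
transitivity ((\sum_(u <- repr (comul x)) f k u.1 * g u.2) *+ c k) => //.
by rewrite -sumrMnl; apply: eq_bigr => u _; rewrite mulrnAl.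
Qed.

Lemma pt_mul_splitr (K : fieldType) (A : hopfSAlgType K) (R : salgType K)
    (f g h : A -> R) x :
  pt_mul f g x = pt_mul f h x + pt_mul f (fun y => g y - h y) x.
Proof.
transitivity (\sum_(u <- repr (comul x)) (f u.1 * h u.2 + f u.1 * (g u.2 - h u.2))).
  by apply: eq_bigr => u _; rewrite -mulrDr addrC subrK.
by rewrite big_split.
Qed.

(** * Powers of a point and indecomposability of X *)

Section CharZeroIdeal.
Variables (K : fieldType) (char0 : [pchar K] =i pred0).
Variables (A : hopfSAlgType K) (H : A -> Prop) (hH : subhopf H).
Hypothesis exh : forall x, Filu H x.
Variables (X : A -> Prop) (hX : cosub H X).
Hypothesis XH : forall x, X x -> H x -> x = 0.

Let sH := sh_subsp hH.
Let sX := cs_subsp hX.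
Let hC := @counit_lin K A.

(** Such an x is a coinvariant: its slice by f minus f(x) 1 equals f(1) x + (h - eps(h)) with h in
    H, which lies in H^+ A. So x is in H by [coinv_in]. *)
Lemma cosub_aug x : X x -> augideal H x -> x = 0.
Proof.
move=> Xx ax; apply: XH => //; apply: (coinv_in hH) => f hf.
have := cs_coinv hX Xx hf; set h := ract f x - _ => Hh.
have eh : counit h = f x.
  rewrite /h (linB hC) (linZ hC) (cs_counit hX Xx) scaler0 subr0.
  by rewrite -[LHS]fconvE // /fconv lact_counit.
have -> : ract f x - (f x : K)%:A = (f 1 : K) *: x + (h - (counit h)%:A).
  by rewrite eh /h addrA addrCA subrr addr0.
apply: subspD; first exact: subsp_augideal.
  by apply: subspZ => //; exact: subsp_augideal.
exact: augideal_H.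
Qed.

Section PowerMaps.
Variables (R : salgType K) (p : A -> R).
Hypotheses (sp : shom p) (pH : forall h, H h -> p h = (counit h)%:A).

Let hp := shom_lin sp.
Let he := shom_lin (shom_eps A R).

(* [powmap N] is the [N]-th power of the point [p]; it is a polynomial in [N]
   with coefficients [difmap k]. *)
Fixpoint powmap (N : nat) : A -> R :=
  if N is N'.+1 then pt_mul (powmap N') p else @eps K A R.

Fixpoint difmap (k : nat) : A -> R :=
  if k is k'.+1 then pt_mul (difmap k') (fun x => p x - @eps K A R x) else @eps K A R.

Let hd : linear (fun x => p x - @eps K A R x).
Proof. by apply: lin_add => //; apply: lin_opp. Qed.

Lemma shom_powmap N : shom (powmap N).
Proof. by elim: N => [|N IHN]; [apply: shom_eps|apply: shom_mul]. Qed.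

Lemma difmap_lin k : linear (difmap k).
Proof. by elim: k => //= k IHk; apply: pt_mul_lin. Qed.

(** Binomial expansion of the N-th convolution power of eps + (p - eps), where eps is the unit for
    convolution. *)
Lemma powmapE N x : powmap N x = \sum_(k < N.+1) difmap k x *+ 'C(N, k).
Proof.
elim: N x => [|N IHN] x; first by rewrite big_ord1.
rewrite [LHS](eq_pt_mul IHN (fun=> erefl)) pt_mul_suml.
under eq_bigr => k _ do rewrite (pt_mul_splitr _ _ (eps R)) (pt_mul1r (difmap_lin k)) mulrnDl.
rewrite big_split /=.
transitivity (\sum_(k < N.+1) difmap k x *+ 'C(N, k) +
  \sum_(k < N.+1) difmap k.+1 x *+ 'C(N, k)) => //.
rewrite [RHS]big_ord_recl [X in X + _ = _]big_ord_recl /= !bin0 -addrA; congr (_ + _).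
rewrite [RHS](eq_bigr (fun k : 'I_N.+1 =>
  difmap k.+1 x *+ 'C(N, k.+1) + difmap k.+1 x *+ 'C(N, k))); last first.
  by move=> k _; rewrite -mulrnDr -binS.
rewrite big_split; congr (_ + _).
by rewrite big_ord_recr /= bin_small // mulr0n addr0.
Qed.

Lemma powmap_H N h : H h -> powmap N h = (counit h)%:A.
Proof.
elim: N h => //= N IHN h Hh; rewrite pt_mulE.
have [n [a [b [e Hb]]]] := inr_comul sH (sh_left hH) Hh.
transitivity (pt_mul (powmap N) (eps R) h).
  rewrite pt_mulE e !cv_sum //; try exact: shom_lin (shom_powmap N).
  by apply: eq_bigr => i _; rewrite pH.
by rewrite pt_mul1r ?IHN //; apply: (shom_lin (shom_powmap N)).
Qed.

(** Since p is the counit on H, elements of X behave like primitive elements: multiplying by one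
    more factor p adds one copy of p(x). *)
Lemma powmap_X N x : X x -> powmap N x = p x *+ N.
Proof.
elim: N x => [|N IHN] x Xx /=.
  by rewrite /eps (cs_counit hX Xx) scale0r mulr0n.
have hw := shom_lin (shom_powmap N).
have [n [y [h [e Xy Hh]]]] := cosub_rep hX Xx.
rewrite pt_mulE e (linD (cv_lin hw hp)) cv_tens // cv_sum //.
rewrite (shom1 (shom_powmap N)) mul1r mulrS; congr (_ + _).
rewrite -IHN // -{1}(lact_counit x) /lact e (linD (rsl_linear hC)) rsl_tens //.
rewrite (cs_counit hX Xx) scale0r add0r rsl_sum // (lin_sum hw).
by apply: eq_bigr => i _; rewrite pH // (linZ hw) -scalerAr mulr1.
Qed.

(** p - eps vanishes on H, so each convolution factor uses up one step of the filtration. Thus a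
    given element sees only finitely many [difmap] terms. *)
Lemma difmap_Fil n k x : Fil H n x -> (n < k)%N -> difmap k x = 0.
Proof.
have h0 y : H y -> p y - eps R y = 0 by move=> Hy; rewrite pH // subrr.
elim: n k x => [|n IHn] [|k] x // Fx nk.
  rewrite /= pt_mulE; have [m [a [b [-> Hb]]]] := inr_comul sH (sh_left hH) Fx.
  rewrite cv_sum //; last exact: difmap_lin.
  by rewrite big1 // => i _; rewrite h0 ?mulr0.
apply: (Fil_cv hH (difmap_lin k) hd h0 _ Fx) => y Fy.
exact: IHn.
Qed.

Lemma powmap_trunc M x : (forall k, (M < k)%N -> difmap k x = 0) -> counit x = 0 ->
  forall N, powmap N x = \sum_(i < M) difmap i.+1 x *+ 'C(N, i.+1).
Proof.
move=> dM ex N; pose F k := difmap k x *+ 'C(N, k).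
have F0 : F 0%N = 0 by rewrite /F /= /eps ex scale0r mul0rn.
have FM k : (M < k)%N -> F k = 0 by move=> /dM; rewrite /F => ->; rewrite mul0rn.
have FN k : (N < k)%N -> F k = 0 by move=> Nk; rewrite /F bin_small.
have E L d : (forall k, (L < k)%N -> F k = 0) ->
    \sum_(k < L.+1) F k = \sum_(k < L.+1 + d) F k.
  move=> hL; rewrite big_split_ord /= [X in _ = _ + X]big1 ?addr0 // => k _.
  by apply: hL; rewrite leq_addr.
rewrite powmapE (E N M.+1 FN) addnC -(E M N.+1 FM) big_ord_recl F0 add0r.
by [].
Qed.

Lemma fil_bound n (a : 'I_n -> A) :
  exists M, forall i k, (M < k)%N -> difmap k (a i) = 0.
Proof.
pose d i := sval (cid (exh (a i))).
have dP i : Fil H (d i) (a i) by rewrite /d; case: (cid _).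
exists (\max_i d i) => i k hk; apply: (difmap_Fil (dP i)).
by apply: leq_ltn_trans hk; apply: (leq_bigmax i).
Qed.

(** On x the N-th power of p is N p(x). On h it is eps(h) = 0, and it is multiplicative on each a_i
    b_i, where both factors expand in the binomials C(N, k) with k > 0, finitely many by the
    filtration. The second computation is therefore divisible by N^2, and [linear_term_eq0]
    concludes after applying a functional. *)
Lemma primitive_decomposable x h n (a b : 'I_n -> A) : X x -> H h ->
  (forall i, counit (a i) = 0) -> (forall i, counit (b i) = 0) ->
  x = h + \sum_i a i * b i -> p x = 0.
Proof.
move=> Xx Hh ea eb e.
have eh : counit h = 0.
  have := cs_counit hX Xx; rewrite e (linD hC) (lin_sum hC) big1 ?addr0 // => i _.
  by rewrite counitM ea mul0r.
have [Ma hMa] := fil_bound a.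
have [Mb hMb] := fil_bound b.
pose M := maxn Ma Mb.
have hMa' i k : (M < k)%N -> difmap k (a i) = 0.
  by rewrite gtn_max => /andP[h' _]; apply: hMa.
have hMb' i k : (M < k)%N -> difmap k (b i) = 0.
  by rewrite gtn_max => /andP[_ h']; apply: hMb.
apply: separate0 => l hl.
apply: (linear_term_eq0 char0 (M := M)
  (r := fun i j => l (\sum_k difmap i.+1 (a k) * difmap j.+1 (b k)))) => N.
have -> : N%:R * (l (p x) : K) = l (powmap N x).
  by rewrite powmap_X // -scaler_nat (linZ hl).
have sN := shom_powmap N; have hN := shom_lin sN.
rewrite {1}e (linD hN) powmap_H // eh scale0r add0r (lin_sum hN) (lin_sum hl).
under [RHS]eq_bigr => k _ do rewrite (shomM sN) (powmap_trunc (hMa' k) (ea k))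
  (powmap_trunc (hMb' k) (eb k)) mulr_suml (lin_sum hl).
rewrite [RHS]exchange_big; apply: eq_bigr => i _.
under [RHS]eq_bigr => k _ do rewrite mulr_sumr (lin_sum hl).
rewrite [RHS]exchange_big; apply: eq_bigr => j _.
rewrite (lin_sum hl) mulr_sumr; apply: eq_bigr => k _.
by rewrite [in RHS]mulrnAl [in RHS]mulrnAr -[in RHS]mulrnA -scaler_nat (linZ hl) mulnC.
Qed.
End PowerMaps.

(** The point used is the projection A -> A/H^+A: it kills x, so x lies in H^+ A, and [cosub_aug]
    applies. *)
Lemma cosub_indecomposable x h n (a b : 'I_n -> A) : X x -> H h ->
  (forall i, counit (a i) = 0) -> (forall i, counit (b i) = 0) ->
  x = h + \sum_i a i * b i -> x = 0.
Proof.
move=> Xx Hh ea eb e; have [q qE] := augideal_sideal hH.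
apply: cosub_aug => //; apply/qE/cl_eq0.
apply: (primitive_decomposable (shom_cl q) _ Xx Hh ea eb e) => k Hk.
apply/eqP; rewrite -subr_eq0; apply/eqP.
have [hc _ c1 _] := shom_cl q.
rewrite -c1 -(linZ hc) -(linB hc); apply/cl_eq0/qE; exact: augideal_H.
Qed.
End CharZeroIdeal.

(** * Derivations of A vanishing on H *)

Section Derivation.
Variables (K : fieldType) (A : hopfSAlgType K) (H : A -> Prop) (hH : subhopf H).
Variables (d : A -> K^o) (b0 : bool).
Hypotheses (hd : linear d) (ed : fdeg b0 d) (dH : forall h, H h -> d h = 0)
  (dM : forall x y, counit x = 0 -> counit y = 0 -> d (x * y) = 0).

Let hC := @counit_lin K A.

Lemma point_derivation x y : d (x * y) = counit x * d y + d x * counit y.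
Proof.
have d1 : d 1 = 0 by apply: dH; apply: sh_one hH.
have := dM (x := x - (counit x)%:A) (y := y - (counit y)%:A).
have e (z : A) : counit (z - (counit z)%:A) = 0.
  by rewrite (linB hC) (linZ hC) counit1 [_ *: _]mulr1 subrr.
rewrite !e => /(_ erefl erefl); rewrite mulrBl !mulrBr !(linB hd).
rewrite -!scalerAl -!scalerAr !mul1r !mulr1 !(linZ hd) d1 !scaler0 subr0.
move=> /eqP; rewrite subr_eq0 subr_eq => /eqP ->.
by congr (_ + _); apply: mulrC.
Qed.

(** Translation turns the point derivation d at the unit into a derivation of A. Its sign appears
    when d, of degree b0, moves past y, of degree c, to reach x. *)
Lemma lact_deriv c x y : homogeneous c y ->
  lact d (x * y) = x * lact d y + (-1) ^+ (b0 && c) *: (lact d x * y).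
Proof.
move=> hy; have hi := @lin_id K A; have heps := shom_lin (shom_eps A A).
have hr := @rsl_linear K A A d hd; have hcv := cv_lin hi heps.
have cvE z : cv idfun (@eps _ A A) (comul z) = z by apply: pt_mul1r.
rewrite -{2}(cvE x) -{3}(cvE y) /lact comulM.
have : hpart c (comul y) = comul y by rewrite comul_hpart hy.
move: (comul y) (comul x) => t s <-.
rewrite -[tmul _ _]/(s * hpart c t).
move: s; apply: tensor_hext.
- exact: (lin_comp hr (lin_mull _)).
- apply: lin_add; first exact: (lin_comp (lin_mull _) hcv).
  by apply: lin_scaler; apply: (lin_comp (lin_mull _) hr).
move=> i0 i a1 a2 ha1 ha2.
have hpl : linear (hpart c : tensor A A -> tensor A A) by apply: hpart_linear.
move: t; apply: tensor_hext.
- exact: (lin_comp hr (lin_comp (lin_mulr _) hpl)).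
- apply: lin_add; first exact: (lin_comp (lin_mulr _) (lin_comp hr hpl)).
  by apply: lin_scaler; apply: (lin_comp (lin_mulr _) (lin_comp hcv hpl)).
move=> j k b1 b2 hb1 hb2; rewrite (thpart_homog _ hb1 hb2).
case: eqP => [ec|_]; last first.
  by rewrite mulr0 (lin0 hr) (lin0 hcv) !mulr0 scaler0 addr0.
rewrite (tensM _ _ ha2 hb1) (linZ hr) !rsl_tens // !cv_tens //= point_derivation.
have e2 : counit a2 = (if i then 0 else counit a2).
  by case: (i) ha2 => // <-; rewrite counit_odd.
have e2' : counit b2 = (if k then 0 else counit b2).
  by case: (k) hb2 => // <-; rewrite counit_odd.
have e3 : d a2 = if i == b0 then d a2 else 0 by rewrite -ed ha2.
rewrite scalerDl scalerDr; congr (_ + _).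
  rewrite /eps -!scalerAr -!scalerAl mulr1 !scalerA e2; congr (_ *: _).
  by case: (i); rewrite /= ?mul0r ?mulr0 // mul1r mulrC.
rewrite /eps -!scalerAr -!scalerAl mulr1 !scalerA e2' e3 ec; congr (_ *: _).
case: (k); first by rewrite !mulr0 ?mul0r.
by case: eqP => [->|_]; rewrite ?mul0r ?mulr0 // addbF -mulrA [counit b2 * _]mulrC.
Qed.

Lemma lact_d_H h : H h -> lact d h = 0.
Proof.
move=> Hh; have [n [a [b [e Hb]]]] := inr_comul (sh_subsp hH) (sh_left hH) Hh.
by rewrite /lact e rsl_sum // big1 // => i _; rewrite dH ?scale0r.
Qed.

Lemma lact_Fil n x : Fil H n.+1 x -> Fil H n (lact d x).
Proof.
move=> Fx; apply: sepS => [|f hf f0]; first exact: subsp_Fil.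
by rewrite -[f _]/(fconv f d x) fconvE // dH //; apply: Fx.
Qed.

Lemma lact_nilp x : Filu H x -> exists n, iter n (lact d) x = 0.
Proof.
move=> [n]; elim: n x => [|n IHn] x Fx; first by exists 1%N; apply: lact_d_H.
by have [m e] := IHn _ (lact_Fil Fx); exists m.+1; rewrite iterSr.
Qed.
End Derivation.

Section CharZeroIntersection.
Variables (K : fieldType) (char0 : [pchar K] =i pred0).
Variables (A : hopfSAlgType K) (H : A -> Prop) (hH : subhopf H).
Hypothesis exh : forall x, Filu H x.
Variables (X : A -> Prop) (hX : cosub H X).
Hypothesis XH : forall x, X x -> H x -> x = 0.

Let sH := sh_subsp hH.
Let sX := cs_subsp hX.
Let hC := @counit_lin K A.

(** This is H + (A^+)^2: functionals vanishing on it are the point derivations at the unit that are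
    zero on H. *)
Definition decomposable (y : A) : Prop := exists h n (a b : 'I_n -> A),
  [/\ H h, forall i, counit (a i) = 0, forall i, counit (b i) = 0 &
      y = h + \sum_i a i * b i].

Lemma subsp_decomposable : subsp decomposable.
Proof.
split.
  exists 0, 0%N, (fun=> 0), (fun=> 0); split; rewrite ?big_ord0 ?addr0 //; try by case.
  exact: subsp0.
move=> c _ _ [h [n [a [b [Hh ea eb ->]]]]] [h' [m [a' [b' [Hh' ea' eb' ->]]]]].
exists (c *: h + h'), (n + m)%N,
  (fun k => match split k with inl i => c *: a i | inr j => a' j end),
  (fun k => match split k with inl i => b i | inr j => b' j end); split.
- by case: sH => _; apply.
- by move=> k; case: split => i //; rewrite (linZ hC) ea scaler0.
- by move=> k; case: split.
rewrite big_split_ord scalerDr addrACA scaler_sumr; congr (_ + (_ + _)); apply: eq_bigr => i _.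
  by rewrite (unsplitK (inl i)) scalerAl.
by rewrite (unsplitK (inr i)).
Qed.

Lemma decomposable_graded : graded decomposable.
Proof.
move=> c _ [h [n [a [b [Hh ea eb ->]]]]]; rewrite hpartD.
apply: (subspD subsp_decomposable).
  exists (hpart c h), 0%N, (fun=> 0), (fun=> 0).
  split; rewrite ?big_ord0 ?addr0 //; try by case.
  exact: sh_graded.
rewrite (lin_sum (hpart_linear _)); apply: subsp_sum => [|i _].
  exact: subsp_decomposable.
rewrite -(hpart_bool (b i)) mulr_sumr (lin_sum (hpart_linear _)).
apply: subsp_sum => [|j _]; first exact: subsp_decomposable.
rewrite (hpartMr _ _ (hpart_homog j _)).
exists 0, 1%N, (fun=> hpart (c (+) j) (a i)), (fun=> hpart j (b i)).
split; rewrite ?big_ord1 ?add0r //; first exact: subsp0.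
  by move=> _; apply: counit_hpart.
by move=> _; apply: counit_hpart.
Qed.

(** Write y = sum a_k x_k with the fewest terms. There is a derivation D killing H and every x_k
    except the last one, z, with D z = 1. As D y = 0, applying D shows that a z, with a the last
    coefficient, already lies in the ideal J of the other x_k, which contradicts minimality. *)
Lemma gen_ideal_contract y : gen_ideal X y -> H y -> y = 0.
Proof.
move=> Iy Hy.
pose P r := exists (a x : 'I_r -> A) (deg : 'I_r -> bool),
  [/\ forall k, X (x k), homog_fam x deg & y = \sum_k a k * x k].
have exP : exists r, `[< P r >].
  have [n [a [x [Xx ey]]]] := Iy; exists (n + n)%N; apply/asboolP.
  exists (fun k => match split k with inl i => a i | inr i => a i end),
    (fun k => match split k with inl i => hpart false (x i) | inr i => hpart true (x i) end),
    (fun k => match split k with inl i => false | inr i => true end).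
  split; try by move=> k; case: split => i; apply: (cs_graded hX).
    by move=> k; case: split => i; apply: hpart_homog.
  rewrite ey big_split_ord /= -big_split /=; apply: eq_bigr => i _.
  by rewrite (unsplitK (inl i)) (unsplitK (inr i)) -mulrDr hpart_sum.
case: (ex_minnP exP) => r /asboolP[a [x [deg [Xx hx ey]]]] minr.
case: r a x deg Xx hx ey minr => [|m] a x deg Xx hx ey minr.
  by rewrite ey big_ord0.
exfalso; pose z := x ord_max; pose c := deg ord_max.
pose J w := exists a' : 'I_m -> A, w = \sum_k a' k * x (widen_ord (leqnSn m) k).
have nJ : ~ J y.
  move=> [a' ea']; have : (m.+1 <= m)%N.
    apply: minr; apply/asboolP.
    exists a', (x \o widen_ord (leqnSn m)), (deg \o widen_ord (leqnSn m)).
    by split=> // k; [apply: Xx|apply: hx].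
  by rewrite ltnn.
have sJ : subsp J.
  split; first by exists (fun=> 0); rewrite big1 // => k _; rewrite mul0r.
  move=> s _ _ [u ->] [v ->]; exists (fun k => s *: u k + v k).
  rewrite scaler_sumr -big_split; apply: eq_bigr => k _ /=.
  by rewrite mulrDl -scalerAl.
have J1 u k : J (u * x (widen_ord (leqnSn m) k)).
  exists (fun l => if l == k then u else 0); rewrite (bigD1 k) //= eqxx big1 ?addr0 //.
  by move=> l /negbTE ->; rewrite mul0r.
have Jr w : J w -> J (w * z).
  move=> [u ->]; rewrite mulr_suml; apply: subsp_sum => // k _; rewrite -mulrA.
  rewrite (supercomm _ _ _ _ (hx _) (hx _)) -scalerAr; apply: subspZ => //.
  by rewrite mulrA; apply: J1.
have ey' : y - a ord_max * z = \sum_k a (widen_ord (leqnSn m) k) * x (widen_ord (leqnSn m) k).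
  by rewrite ey big_ord_recr addrK.
have Jy : J (y - a ord_max * z) by rewrite ey'; eexists.
(* A combination of the x_k lying in H + (A^+)^2 is zero by [cosub_indecomposable]; a nontrivial one
   would eliminate some x_k and shorten the expression of y. *)
have fr : free_mod decomposable x.
  move=> s ds; have [h [n [u [v [Hh eu ev E]]]]] := ds.
  have Xs : X (\sum_i s i *: x i) by apply: subsp_sum => // i _; apply: subspZ.
  have E0 := cosub_indecomposable char0 hH exh hX XH Xs Hh eu ev E.
  move=> k; apply/eqP; apply: contrapT => /negP sk.
  have : (m.+1 <= m)%N; last by rewrite ltnn.
  apply: minr; apply/asboolP.
  have xk : x k = - \sum_(i | i != k) (s i / s k) *: x i.
    apply: (scalerI sk); rewrite scalerN scaler_sumr.
    apply/eqP; rewrite -addr_eq0; apply/eqP.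
    rewrite -[RHS]E0 [RHS](bigD1 k) //=; congr (_ + _); apply: eq_bigr => i _.
    by rewrite scalerA mulrCA divff // mulr1.
  exists (fun j => a (lift k j) - (s (lift k j) / s k) *: a k), (x \o lift k), (deg \o lift k).
  split; [by move=> j; apply: Xx|by move=> j; apply: hx|].
  have bl (F : 'I_m.+1 -> A) : \sum_(i | i != k) F i = \sum_j F (lift k j).
    apply: (@addrI _ (F k)).
    by rewrite -[LHS](@bigD1 _ _ _ _ k predT F) // (bigD1_ord k).
  rewrite ey (bigD1 k) //= xk bl bl mulrN mulr_sumr addrC -sumrB.
  by apply: eq_bigr => j _; rewrite mulrBl -scalerAr -scalerAl.
have [w0 [hw0 w0x w00]] := dual_mod subsp_decomposable fr.
pose d : A -> K^o := w0 ord_max \o hpart c.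
have hd : linear d by have [] := fdeg_part c (hw0 ord_max).
have ed : fdeg c d by have [] := fdeg_part c (hw0 ord_max).
have dx k : d (x k) = (ord_max == k)%:R.
  rewrite /d /= (homogP _ (hx k)) -/c; case: eqP => [_|ne]; first exact: w0x.
  by rewrite (lin0 (hw0 _)); case: eqP => // ek; case: ne; rewrite -ek.
have dD u : decomposable u -> d u = 0.
  by move=> hu; apply: w00; apply: decomposable_graded.
have dH h : H h -> d h = 0.
  move=> Hh; apply: dD; exists h, 0%N, (fun=> 0), (fun=> 0).
  by split; rewrite ?big_ord0 ?addr0 //; case.
have dM u v : counit u = 0 -> counit v = 0 -> d (u * v) = 0.
  move=> eu ev; apply: dD; exists 0, 1%N, (fun=> u), (fun=> v).
  by split; rewrite ?big_ord1 ?add0r //; apply: subsp0.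
clearbody d; have hl := lact_lin hd.
have der u k : lact d (u * x k) =
    u * ((d (x k) : K) *: 1) + (-1) ^+ (c && deg k) *: (lact d u * x k).
  rewrite (lact_deriv hH hd ed dH dM _ (hx k)); congr (_ * _ + _).
  have [n [v [h [e Xv Hh]]]] := cosub_rep hX (Xx k).
  rewrite /lact e (linD (rsl_linear hd)) rsl_tens // rsl_sum // big1 ?addr0 // => i _.
  by rewrite dH ?scale0r.
have dJ u : J u -> J (lact d u).
  move=> [v ->]; rewrite (lin_sum hl); apply: subsp_sum => // k _.
  rewrite der dx; have -> : (ord_max == widen_ord (leqnSn m) k) = false.
    by apply/eqP => /(congr1 val) /= e; have := ltn_ord k; rewrite -e ltnn.
  by rewrite scale0r mulr0 add0r; apply: subspZ.
have derz u : lact d (u * z) = u + (-1) ^+ (c && c) *: (lact d u * z).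
  by rewrite der dx eqxx scale1r mulr1.
apply: nJ; rewrite -[y](subrK (a ord_max * z)); apply: subspD => //.
move: (a ord_max) Jy => {a ey ey'}a Jy.
(* Odd z: z z = 0 because 2 is invertible. Here a - D(a) z lies in J, and multiplying it by z gives
   a z in J. *)
case ec : c in derz.
  have z2 : z * z = 0.
    have := supercomm _ _ _ _ (hx ord_max) (hx ord_max); rewrite -/c ec /= expr1 scaleN1r.
    move=> /eqP; rewrite -addr_eq0 -mulr2n -scaler_nat scaler_eq0 => /orP[|/eqP//].
    by rewrite (negbTE (nat_neq0 char0 1)).
  have := dJ _ Jy; rewrite (linB hl) (lact_d_H hH hd dH Hy) sub0r derz /= expr1 scaleN1r.
  move=> /(subspN sJ); rewrite opprK => /Jr.
  by rewrite mulrBl -mulrA z2 mulr0 subr0.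
have {}derz u : lact d (u * z) = u + lact d u * z by rewrite derz scale1r.
have itJ n u : J u -> J (iter n (lact d) u).
  by elim: n => //= n IHn Ju; apply: dJ; apply: IHn.
have derzn n : iter n.+1 (lact d) (a * z) =
    iter n (lact d) a *+ n.+1 + iter n.+1 (lact d) a * z.
  elim: n => [|n IHn]; first by rewrite /= derz.
  rewrite iterS IHn (linD hl) derz addrA [in RHS]mulrSr /=; congr (_ + _ + _).
  by rewrite -!scaler_nat (linZ hl).
apply: (Jr).
(* Even z: D^(n+1)(a z) = (n+1) D^n(a) + D^(n+1)(a) z lies in J. If D^(n+1)(a) is in J, division by
   n+1 puts D^n(a) in J. Some power of D kills a by local nilpotency, so the least exponent is 0 and
   a itself is in J. *)
have exn : exists n, `[< J (iter n (lact d) a) >].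
  have [n e] := lact_nilp hH hd dH (exh a); exists n; apply/asboolP.
  by rewrite e; apply: subsp0.
case: (ex_minnP exn) => -[|n] /asboolP Jn minn //.
have /minn : `[< J (iter n (lact d) a) >]; last by rewrite ltnn.
apply/asboolP.
have y0 : iter n.+1 (lact d) y = 0.
  by rewrite iterSr (lact_d_H hH hd dH Hy); elim: (n) => //= k ->; apply: lin0.
have hit k : linear (iter k (lact d)).
  by elim: k => //= k IHk; apply: (lin_comp hl IHk).
have := itJ n.+1 _ Jy; rewrite (linB (hit _)) y0 sub0r derzn.
move=> /(subspN sJ); rewrite opprK => h.
have := subspB sJ h (Jr _ Jn); rewrite addrK -scaler_nat.
move=> /(subspZ sJ (n.+1%:R^-1)); rewrite scalerA mulVf ?scale1r //.
exact: nat_neq0.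
Qed.
End CharZeroIntersection.

(** * Linearly reductive quotients *)

Section AugmentedCoinvariants.
Variables (K : fieldType) (A : hopfSAlgType K).
Variables (H : A -> Prop) (hH : subhopf H).

Let hC := @counit_lin K A.

Definition coinvmod0 (x : A) : Prop := coinvmod H x /\ counit x = 0.

Lemma cosub_coinvmod0 : cosub H coinvmod0.
Proof.
split.
- split; first by split; [apply: subsp0 (subsp_coinvmod hH)|apply: lin0 hC].
  move=> a x y [hx ex] [hy ey]; split.
    by case: (subsp_coinvmod hH) => _; apply.
  by rewrite hC ex ey scaler0 addr0.
- by move=> b x [hx ex]; split; [apply: coinvmod_graded|apply: counit_hpart].
- by move=> x [].
- by move=> x [].
move=> x [hx ex] g hg; split; last first.
  rewrite (linB hC) (linZ hC) counit1 [_ *: _]mulr1.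
  have -> : counit (lact g x) = g x :> K^o by rewrite -[LHS]/(@fconv K A counit g x) fconvE // ract_counit.
  by rewrite subrr.
have hcm := subsp_coinvmod hH.
apply: (subspB hcm); last by apply: (subspZ hcm); apply: coinvmod_H => //; apply: sh_one hH.
move=> f hf; rewrite ract_lact // -(linZ (lact_lin hg)) -(linB (lact_lin hg)).
by apply: (sh_right hH) => //; apply: hx.
Qed.

End AugmentedCoinvariants.

(** Gives a graded subspace a type of its own, as the image of an even idempotent, on which a
    comodule structure can be put. *)
Record gproj (K : fieldType) (V : superModType K) := GProj {
  gpmap :> V -> V;
  gp_lin : linear gpmap;
  gp_even : evenmap gpmap;
  gpK : forall x, gpmap (gpmap x) = gpmap x
}.

Record img (K : fieldType) (V : superModType K) (p : gproj V) := Img {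
  ival : V;
  _ : p ival == ival
}.

Section ImageModule.
Variables (K : fieldType) (V : superModType K) (p : gproj V).

HB.instance Definition _ := [isSub for @ival K V p].
HB.instance Definition _ := [Choice of img p by <:].

Let hp := gp_lin p.

Lemma toimg_subproof x : p (p x) == p x. Proof. by rewrite gpK. Qed.
Definition toimg (x : V) : img p := Img (toimg_subproof x).

Lemma ivalP (a : img p) : p (ival a) = ival a. Proof. by case: a => x /= /eqP. Qed.

Lemma toimgK (a : img p) : toimg (ival a) = a.
Proof. by apply: val_inj; apply: ivalP. Qed.

Definition iadd (a b : img p) := toimg (ival a + ival b).
Definition iopp (a : img p) := toimg (- ival a).
Definition iscale k (a : img p) := toimg (k *: ival a).
Definition ipart b (a : img p) := toimg (hpart b (ival a)).

Lemma iaddE a b : ival (iadd a b) = ival a + ival b.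
Proof. by rewrite /= (linD hp) !ivalP. Qed.
Lemma ioppE a : ival (iopp a) = - ival a.
Proof. by rewrite /= (linN hp) !ivalP. Qed.
Lemma iscaleE k a : ival (iscale k a) = k *: ival a.
Proof. by rewrite /= (linZ hp) !ivalP. Qed.
Lemma ipartE b a : ival (ipart b a) = hpart b (ival a).
Proof. by rewrite /= gp_even !ivalP. Qed.
Lemma izeroE : ival (toimg 0) = 0. Proof. by rewrite /= (lin0 hp). Qed.

Lemma iaddA : associative iadd.
Proof.
move=> a b c; apply: val_inj.
by rewrite [LHS]iaddE [RHS]iaddE [ival (iadd b c)]iaddE [ival (iadd a b)]iaddE addrA.
Qed.
Lemma iaddC : commutative iadd.
Proof. by move=> a b; apply: val_inj; rewrite /= addrC. Qed.
Lemma iadd0 : left_id (toimg 0) iadd.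
Proof. by move=> a; apply: val_inj; rewrite [LHS]iaddE izeroE add0r. Qed.
Lemma iaddN : left_inverse (toimg 0) iopp iadd.
Proof. by move=> a; apply: val_inj; rewrite [LHS]iaddE ioppE [RHS]izeroE addNr. Qed.
HB.instance Definition _ := GRing.isZmodule.Build (img p) iaddA iaddC iadd0 iaddN.

Lemma iscaleA k l a : iscale k (iscale l a) = iscale (k * l) a.
Proof. by apply: val_inj; rewrite [LHS]iscaleE iscaleE [RHS]iscaleE scalerA. Qed.
Lemma iscale1 : left_id 1 iscale.
Proof. by move=> a; apply: val_inj; rewrite [LHS]iscaleE scale1r. Qed.
Lemma iscaleDr : right_distributive iscale +%R.
Proof.
move=> k a b; apply: val_inj; rewrite [LHS]iscaleE [ival (a + b)]iaddE [RHS]iaddE.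
by rewrite !iscaleE scalerDr.
Qed.
Lemma iscaleDl a : {morph iscale^~ a : k l / k + l}.
Proof.
by move=> k l; apply: val_inj; rewrite [LHS]iscaleE [RHS]iaddE !iscaleE scalerDl.
Qed.
HB.instance Definition _ :=
  GRing.Zmodule_isLmodule.Build K (img p) iscaleA iscale1 iscaleDr iscaleDl.

Lemma ival_lin : linear (@ival K V p).
Proof. by move=> k a b; rewrite [LHS]iaddE [ival (k *: a)]iscaleE. Qed.

Lemma ival_inj : injective (@ival K V p).
Proof. by move=> a b; apply: val_inj. Qed.

Lemma ipart_linear b : linear (ipart b).
Proof.
move=> k x y; apply: ival_inj.
by rewrite ipartE !ival_lin hpart_linear !ipartE.
Qed.
Lemma ipartK b c x : ipart b (ipart c x) = if b == c then ipart c x else 0.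
Proof.
apply: ival_inj; rewrite !ipartE hpartK.
by case: eqP => _; rewrite ?ipartE // (lin0 ival_lin).
Qed.
Lemma ipart_sum x : ipart false x + ipart true x = x.
Proof. by apply: ival_inj; rewrite (linD ival_lin) !ipartE hpart_sum. Qed.
HB.instance Definition _ := isSuper.Build K (img p) ipart_linear ipartK ipart_sum.

Lemma ival_even : evenmap (@ival K V p).
Proof. by move=> b x; rewrite [LHS]ipartE. Qed.

Lemma toimg_lin : linear toimg.
Proof. by move=> k x y; apply: ival_inj; rewrite ival_lin /= hp. Qed.

Lemma toimg_even : evenmap toimg.
Proof.
by move=> b x; apply: ival_inj; rewrite [RHS]ival_even /= gp_even.
Qed.
End ImageModule.

Section ImageSubhopf.
Variables (K : fieldType) (A Q : hopfSAlgType K) (i : hopf_hom Q A).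

Definition hopf_image (x : A) : Prop := exists q, x = i q.

Let hi : linear i := shom_lin (shom_hopf i).

Lemma ract_hopf (f : A -> K^o) q : linear f -> ract f (i q) = i (ract (f \o i) q).
Proof.
move=> hf; have hfi : linear (f \o i : Q -> K^o) by apply: lin_comp.
rewrite /ract hopf_hom_comul /tmap (lin_tlift (lsl_linear hf)); last exact: bilin_tens.
rewrite (lin_tlift hi); last exact: bilin_scalel.
by apply: tlift_eq => a b; rewrite lsl_tens // (linZ hi).
Qed.

Lemma lact_hopf (f : A -> K^o) q : linear f -> lact f (i q) = i (lact (f \o i) q).
Proof.
move=> hf; have hfi : linear (f \o i : Q -> K^o) by apply: lin_comp.
rewrite /lact hopf_hom_comul /tmap (lin_tlift (rsl_linear hf)); last exact: bilin_tens.
rewrite (lin_tlift hi); last exact: bilin_scaler.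
by apply: tlift_eq => a b; rewrite rsl_tens // (linZ hi).
Qed.

Lemma subhopf_image : subhopf hopf_image.
Proof.
have [_ ei i1 iM] := shom_hopf i; split.
- split; first by exists 0; rewrite (lin0 hi).
  by move=> a _ _ [q ->] [r ->]; exists (a *: q + r); rewrite hi.
- by move=> b _ [q ->]; exists (hpart b q); rewrite ei.
- by exists 1.
- by move=> _ _ [q ->] [r ->]; exists (q * r).
- by move=> f hf _ [q ->]; rewrite ract_hopf //; eexists.
- by move=> f hf _ [q ->]; rewrite lact_hopf //; eexists.
- by move=> _ [q ->]; rewrite -hopf_antipode; eexists.
Qed.

Lemma image_retraction : injective i ->
  exists j : A -> Q, [/\ linear j, evenmap j & forall q, j (i q) = q].
Proof.
move=> inj; have hH := subhopf_image.
have [p [hp ep pH Hp]] := graded_proj (sh_subsp hH) (sh_graded hH).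
pose j x := sval (cid (pH x)).
have jE x : i (j x) = p x by rewrite /j; case: (cid _).
have [_ ei _ _] := shom_hopf i; exists j; split.
- by move=> k x y; apply: inj; rewrite jE hp hi !jE.
- by move=> b x; apply: inj; rewrite jE ei jE ep.
- by move=> q; apply: inj; rewrite jE Hp //; exists q.
Qed.
End ImageSubhopf.

Section CoinvariantComodule.
Variables (K : fieldType) (A Q : hopfSAlgType K) (i : hopf_hom Q A).
Hypothesis inj_i : injective i.

Let H := hopf_image i.
Let hH : subhopf H := subhopf_image i.
Let sH := sh_subsp hH.
Let hi : linear i := shom_lin (shom_hopf i).
Let hC := @counit_lin K A.
Let hD := @comul_lin K A.

(** On coinvariants of augmentation zero, x |-> Delta x - 1 (x) x is a coaction of H: it is the
    coaction of A/K 1 transported to the augmentation ideal. Complete reducibility decomposes this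
    comodule into simple ones. They cannot all lie in H, and one that does not lie in H meets it
    trivially. *)
Lemma linearly_reductive_cosub : linearly_reductive Q ->
  (exists x, coinvmod H x /\ ~ H x) ->
  exists X, [/\ cosub H X, forall x, X x -> H x -> x = 0 & exists x, X x /\ x <> 0].
Proof.
move=> lr [x0 [cx0 nHx0]]; have hN := cosub_coinvmod0 hH.
have [p0 [hp0 ep0 pN Np]] := graded_proj (cs_subsp hN) (cs_graded hN).
have p0K x : p0 (p0 x) = p0 x by apply: Np; apply: pN.
pose p := GProj hp0 ep0 p0K.
have [j [hj ej ji]] := image_retraction inj_i.
pose M : superModType K := img p; pose va : M -> A := @ival K A p; pose cl : A -> M := toimg p.
have hva : linear va by exact: ival_lin.
have hcl : linear cl by exact: toimg_lin.
have vaN (a : M) : coinvmod0 H (va a) by rewrite /va -(ivalP a); apply: pN.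
have vacl x : coinvmod0 H x -> va (cl x) = x by move=> /Np.
pose del (x : A) : tensor A A := comul x - tens 1 x.
have hdel : linear del.
  by apply: lin_add => //; apply: lin_opp; apply: lin_tensr.
pose co (a : M) : tensor M Q := tmap cl j (del (va a)).
have hcj : linear (tmap cl j) by apply: tmap_linear.
have hvi : linear (tmap va i) by apply: tmap_linear.
have hco : linear co by apply: (lin_comp hcj (lin_comp hdel hva)).
have coE a : tmap va i (co a) = del (va a).
  have [n [y [h [e Ny Hh]]]] := cosub_rep hN (vaN a).
  rewrite /co tmap_comp // /del e addrC addKr (lin_sum (tmap_linear _ _)); last 2 first.
  - exact: lin_comp.
  - exact: lin_comp.
  apply: eq_bigr => k _; rewrite tmap_tens; last 2 first.
  - exact: lin_comp.
  - exact: lin_comp.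
  by have [q ->] := Hh k; congr tens; [apply: vacl|rewrite /= ji].
have co_hpart b a : hpart b (co a) = co (hpart b a).
  have et : evenmap (tmap cl j).
    move=> c; apply: tensor_hext.
    - exact: (lin_comp hcj (hpart_linear _)).
    - exact: (lin_comp (hpart_linear _) hcj).
    move=> k l v w hv hw; rewrite (thpart_homog _ hv hw) tmap_tens //.
    have hv' : homogeneous k (cl v) by rewrite /homogeneous -toimg_even hv.
    have hw' : homogeneous l (j w) by rewrite /homogeneous -ej hw.
    rewrite (thpart_homog _ hv' hw').
    by case: eqP => _; rewrite ?tmap_tens // (lin0 hcj).
  rewrite /co -et; congr (tmap cl j _).
  rewrite /del /va ival_even (linB (hpart_linear b)) comul_hpart; congr (_ - _).
  by rewrite -[tens 1 _]/(iota2 A (ival a)) -(shom_even (shom_iota2 A A)).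
clearbody co.
have coA a : tassoc (tmap co idfun (co a)) = tmap idfun comul (co a).
  have hii : linear (tmap i i) by apply: tmap_linear.
  have hjj : linear (tmap j j) by apply: tmap_linear.
  have hDQ := @comul_lin K Q.
  (* The retractions [cl] and [j] make the embedding into A (x) (A (x) A) injective, so
     coassociativity can be checked there. *)
  have inj3 s t : tmap va (tmap i i) s = tmap va (tmap i i) t -> s = t.
    move=> /(congr1 (tmap cl (tmap j j))); rewrite !tmap_comp //.
    have idE (u : tensor M (tensor Q Q)) :
        tmap (cl \o va) (tmap j j \o tmap i i) u = u.
      transitivity (tmap idfun idfun u).
        apply: eq_tmap => [b|v /=]; first exact: toimgK.
        rewrite tmap_comp //; transitivity (tmap idfun idfun v).
          by apply: eq_tmap => q; apply: ji.
        transitivity (idfun v) => //; move: v; apply: tensor_ext => //.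
          exact: tmap_linear.
        by move=> v w; rewrite tmap_tens.
      transitivity (idfun u) => //; move: u; apply: tensor_ext => //.
        exact: tmap_linear.
      by move=> v w; rewrite tmap_tens.
    by rewrite !idE.
  apply: inj3; rewrite -tassoc_nat // !tmap_comp //; try exact: lin_comp.
  transitivity (tassoc (tmap (del \o va) i (co a))).
    by congr tassoc; apply: eq_tmap => // b; apply: coE.
  transitivity (tmap idfun comul (del (va a))); last first.
    rewrite -coE tmap_comp //.
    by apply: eq_tmap => // q; rewrite /= hopf_hom_comul.
  transitivity (tassoc (tmap del idfun (del (va a)))).
    by rewrite -coE tmap_comp.
  move: (va a) => y.
  have hda : linear (tmap del idfun : tensor A A -> _) by apply: tmap_linear.
  have hid : linear (tmap idfun comul : tensor A A -> _) by apply: tmap_linear.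
  have has := @tassoc_linear K A A A.
  have del1 : del 1 = 0 by rewrite /del comul1 subrr.
  rewrite {2}/del (linB hda) [tmap del idfun (tens 1 y)]tmap_tens // del1.
  rewrite (lin0 (lin_tensl _)) subr0 {2}/del (linB hid) tmap_tens // -comulA.
  have -> : tmap del idfun (comul y) =
      tmap comul idfun (comul y) - tmap (@iota2 _ A A) idfun (comul y).
    have h2 : linear (@iota2 _ A A) := shom_lin (shom_iota2 A A).
    move: (comul y); apply: tensor_ext => //.
      by apply: lin_add; [|apply: lin_opp]; apply: tmap_linear.
    move=> u w; rewrite !tmap_tens // -(linB (lin_tensl _)); congr tens.
  rewrite (linB has); congr (_ - _).
  have h2 : linear (@iota2 _ A A) := shom_lin (shom_iota2 A A).
  move: (comul y); apply: tensor_ext => //.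
  - by apply: (lin_comp has); apply: tmap_linear.
  - exact: lin_tensr.
  move=> u w; rewrite tmap_tens // tassoc_tens tlift_tens //.
  exact: bilin_assoc_pure.
have rslE (g : A -> K^o) a : linear g ->
    va (rsl (g \o i) (co a)) = lact g (va a) - (g (va a) : K)%:A.
  move=> hg; have hgi : linear (g \o i : Q -> K^o) by apply: lin_comp.
  transitivity (rsl g (tmap va i (co a))).
    rewrite /tmap (lin_tlift (rsl_linear hg)); last exact: bilin_tens.
    rewrite (lin_tlift hva); last exact: bilin_scaler.
    by apply: tlift_eq => u w; rewrite rsl_tens // (linZ hva).
  by rewrite coE /del (linB (rsl_linear hg)) rsl_tens.
have co_counit a : tlift (fun m b => counit b *: m) (co a) = a.
  apply: (@ival_inj K A p); rewrite -/va.
  have -> : tlift (fun m b => counit b *: m) (co a) =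
      rsl ((counit : A -> K^o) \o i) (co a).
    by apply: tlift_eq => u w; rewrite /= hopf_hom_counit.
  by rewrite rslE // lact_counit (proj2 (vaN a)) scale0r subr0.
pose S := @Supermodule K Q M co hco co_hpart coA co_counit.
have [I [F [simF [genF _]]]] := lr S.
pose T0 (a : M) := H (va a).
have [k nk] : exists k, ~ (forall a : M, F k a -> T0 a).
  apply: contrapT => nex.
  have FT k a : F k a -> T0 a.
    by move=> Fa; apply: contrapT => nT; apply: nex; exists k => /(_ a Fa).
  have cx1 : coinvmod0 H (x0 - (counit x0)%:A).
    split; last by rewrite (linB hC) (linZ hC) counit1 [_ *: _]mulr1 subrr.
    apply: (subspB (subsp_coinvmod hH)) => //.
    by apply: coinvmod_H => //; apply: subspZ => //; apply: sh_one.
  have [r [f [Ff ef]]] := genF (cl (x0 - (counit x0)%:A)).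
  apply: nHx0; rewrite -[x0](subrK (counit x0)%:A); apply: subspD => //; last first.
    by apply: subspZ => //; apply: sh_one.
  rewrite -(vacl _ cx1) ef (lin_sum hva); apply: subsp_sum => // l _.
  exact: FT (Ff l).
have [subF neF minF] := simF k.
have sF : subsp (F k : M -> Prop).
  by split; [exact: (sub_smod0 subF)|exact: (sub_smod_linear subF)].
have Frsl a (g : Q -> K^o) : linear g -> F k a -> F k (rsl g (co a)).
  move=> hg Fa; have [s [hs es]] := sub_smod_coact subF Fa.
  have -> : co a = \sum_(u <- s) tens u.1 u.2 := es.
  rewrite (lin_sum (rsl_linear hg)) big_seq; apply: subsp_sum => // u us.
  by rewrite rsl_tens //; apply: subspZ => //; apply: hs.
(* The part of F k inside H is a subcomodule; by the choice of k it is not all of F k, so simplicity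
   makes it zero. *)
have Tcap a : F k a -> T0 a -> a = 0.
  have sub : @sub_supermodule K Q S (fun a => F k a /\ T0 a).
    split.
    - by split; [exact: (subsp0 sF)|rewrite /T0 (lin0 hva); exact: subsp0].
    - move=> c x y [Fx Tx] [Fy Ty]; split; first exact: (sub_smod_linear subF).
      by rewrite /T0 hva; case: sH => _; apply.
    - move=> b x [Fx Tx]; split; first exact: (sub_smod_hpart subF).
      by rewrite /T0 [va _]ival_even; exact: (sh_graded hH).
    move=> x [Fx Tx].
    have sFT : subsp (fun a : M => F k a /\ T0 a).
      split; first by split; [exact: (subsp0 sF)|rewrite /T0 (lin0 hva); exact: subsp0].
      move=> c u w [Fu Tu] [Fw Tw]; split; first exact: (sub_smod_linear subF).
      by rewrite /T0 hva; case: sH => _; apply.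
    have [|n [v [w [e _ hv]]]] := @rsl_in K M Q _ (co x) sFT.
      move=> g hg; split; first exact: Frsl.
      have hgj : linear (g \o j : A -> K^o) by apply: lin_comp.
      rewrite /T0.
      have -> : rsl g (co x) = rsl ((g \o j) \o i) (co x).
        by apply: tlift_eq => u u'; rewrite /= ji.
      rewrite rslE //; apply: subspB => //; first exact: (sh_right hH).
      by apply: subspZ => //; apply: sh_one.
    exists [seq (v l, w l) | l <- enum 'I_n]; split.
      by move=> u /mapP[l _ ->]; apply: hv.
    rewrite big_map big_enum; exact: e.
  move=> Fa Ta; have [|e|e] := minF _ sub; first by move=> x [].
    exact: (eq_ind _ (fun P : M -> Prop => P a) (conj Fa Ta) _ e).
  exfalso; apply: nk => b Fb.
  by case: (eq_ind _ (fun P : M -> Prop => P b) Fb _ (esym e)).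
exists (fun y => exists2 a, F k a & y = va a); split.
- split.
  + split; first by exists 0; [exact: (subsp0 sF)|rewrite (lin0 hva)].
    move=> c _ _ [a Fa ->] [b Fb ->]; exists (c *: a + b); last by rewrite hva.
    exact: (sub_smod_linear subF).
  + move=> b _ [a Fa ->]; exists (hpart b a); last by rewrite /va ival_even.
    exact: (sub_smod_hpart subF).
  + by move=> _ [a _ ->]; case: (vaN a).
  + by move=> _ [a _ ->]; case: (vaN a).
  + move=> _ [a Fa ->] g hg; exists (rsl (g \o i) (co a)); last by rewrite rslE.
    by apply: Frsl => //; apply: lin_comp.
- by move=> _ [a Fa ->] Ha; rewrite (Tcap a Fa Ha) (lin0 hva).
- have [a [Fa a0]] : exists a, F k a /\ a <> 0.
    apply: contrapT => nex; apply: neF; apply/seteqP; split=> a /=.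
      by move=> Fa; apply: contrapT => a0; apply: nex; exists a.
    by move=> ->; exact: (subsp0 sF).
  exists (va a); split; first by exists a.
  by move=> e; apply: a0; apply: (@ival_inj K A p); rewrite -/va e (lin0 hva).
Qed.
End CoinvariantComodule.

(** * Diagonalizable quotients *)

Section GrouplikeSpan.
Variables (K : fieldType) (A : hopfSAlgType K).
Variables (H : A -> Prop) (hH : subhopf H).

Let sH := sh_subsp hH.
Let hC := @counit_lin K A.

Hypothesis spanH : forall h, H h -> exists s : seq (K * A),
  (forall u, u \in s -> grouplike u.2 /\ H u.2) /\ h = \sum_(u <- s) u.1 *: u.2.

Lemma grouplike_basis (S : A -> Prop) n (h : 'I_n -> A) : subsp S -> (forall k, H (h k)) ->
  exists r (g : 'I_r -> A), [/\ free_mod S g, forall j, grouplike (g j) /\ H (g j) &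
    forall k, exists c : 'I_r -> K, S (h k - \sum_j c j *: g j)].
Proof.
move=> hS Hh; pose sq k := sval (cid (spanH (Hh k))).
have sqP k u : u \in sq k -> grouplike u.2 /\ H u.2 by rewrite /sq; case: (cid _) => s /= [+ _]; apply.
have hE k : h k = \sum_(u <- sq k) u.1 *: u.2 by rewrite /sq; case: (cid _) => s /= [].
pose s := flatten [seq sq k | k <- enum 'I_n].
have sP u : u \in s -> grouplike u.2 /\ H u.2 by move=> /flatten_mapP[k _]; apply: sqP.
pose v (j : 'I_(size s)) := (nth (0, 0) s j).2.
have [r [e [fe se]]] := basis_mod v hS.
exists r, (v \o e); split=> [//|j|k]; first exact: (sP _ (mem_nth _ (ltn_ord (e j)))).
pose P z := exists c : 'I_r -> K, S (z - \sum_j c j *: (v \o e) j).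
have sP' : subsp P.
  split.
    by exists (fun=> 0); rewrite big1 ?subr0; [apply: subsp0|move=> j _; rewrite scale0r].
  move=> a x y [c Sx] [d Sy]; exists (fun j => a * c j + d j).
  have -> : a *: x + y - \sum_j (a * c j + d j) *: (v \o e) j =
      a *: (x - \sum_j c j *: (v \o e) j) + (y - \sum_j d j *: (v \o e) j).
    rewrite scalerBr addrACA -opprD; congr (_ - _).
    rewrite scaler_sumr -big_split; apply: eq_bigr => j _.
    by rewrite scalerDl scalerA.
  by case: hS => _; apply.
suff: P (h k) by [].
rewrite hE big_seq.
apply: (subsp_sum (S := P)) => [|u us]; first exact: sP'.
apply: (subspZ sP').
have us' : u \in s.
  by apply/flatten_mapP; exists k; rewrite ?mem_enum.
have := se (Ordinal (etrans (index_mem u s) us')).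
by rewrite {1}/v /= nth_index.
Qed.

(** Expand h in grouplikes v_j free modulo K 1. Slicing Delta h by the functional dual to v_j, which
    vanishes at 1, gives c_j v_j = c_j g. So h is a combination of 1 and g, and its counit is
    zero. *)
Lemma skew_primitive_scalar g h : grouplike g -> H h -> comul h = tens 1 h + tens h g ->
  exists c : K, h = c *: (1 - g).
Proof.
move=> [_ eg] Hh dh.
have [r [v [fv gv hv]]] := @grouplike_basis _ 1 (fun=> h) (subsp_line (1 : A)) (fun=> Hh).
have [c [c0 hE]] := hv ord0.
have [d [hd dv d1]] := dual_mod (subsp_line (1 : A)) fv.
have d10 j : d j 1 = 0 by apply: d1; exists 1; rewrite scale1r.
have hE' : h = c0 *: 1 + \sum_j c j *: v j by rewrite -hE subrK.
have hD := @comul_lin K A.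
have cg j : c j *: v j = c j *: g.
  have := congr1 (lsl (d j)) dh; rewrite (linD (lsl_linear (hd j))) !lsl_tens // d10.
  rewrite scale0r add0r.
  have -> : d j h = c j.
    rewrite hE' (linD (hd j)) (linZ (hd j)) d10 scaler0 add0r (lin_sum (hd j)).
    rewrite (bigD1 j) //= (linZ (hd j)) dv eqxx [_ *: _]mulr1 big1 ?addr0 // => k kj.
    by rewrite (linZ (hd j)) dv eq_sym (negbTE kj) scaler0.
  move=> <-; rewrite hE' (linD hD) (linZ hD) comul1 (linD (lsl_linear (hd j))).
  rewrite (linZ (lsl_linear (hd j))) lsl_tens // d10 scale0r scaler0 add0r.
  have -> : comul (\sum_k c k *: v k) = \sum_k tens (c k *: v k) (v k).
    by rewrite (lin_sum hD); apply: eq_bigr => k _; rewrite (linZ hD) (proj1 (proj1 (gv k))) tensZl.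
  rewrite lsl_sum // (bigD1 j) //= (linZ (hd j)) dv eqxx [_ *: 1]mulr1 big1 ?addr0 // => k kj.
  by rewrite (linZ (hd j)) dv eq_sym (negbTE kj) scaler0 scale0r.
have hE2 : h = c0 *: 1 + (\sum_j c j) *: g.
  by rewrite {1}hE' scaler_suml; congr (_ + _); apply: eq_bigr.
have eh : counit h = 0.
  have := congr1 (@lsl K A A counit) dh.
  rewrite -[lsl _ (comul h)]/(@ract K A counit h) ract_counit (linD (lsl_linear hC)) !lsl_tens // counit1 scale1r.
  move=> /eqP; rewrite -subr_eq0 opprD addrA subrr add0r oppr_eq0 scaler_eq0 => /orP[/eqP //|].
  by move=> /eqP g0; move: eg; rewrite g0 (lin0 hC) => /eqP; rewrite eq_sym oner_eq0.
have cE : \sum_j c j = - c0.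
  move: eh; rewrite {1}hE2 (linD hC) !(linZ hC) counit1 eg ![_ *: 1]mulr1 => /eqP.
  by rewrite addr_eq0 => /eqP ->; rewrite opprK.
by exists c0; rewrite {1}hE2 cE scaleNr scalerBr.
Qed.

Hypothesis evH : forall h, H h -> homogeneous false h.

(** For a coinvariant x of augmentation zero, write Delta x = 1 (x) x + sum z_j (x) v_j with
    independent grouplikes v_j. Coassociativity makes z_j skew-primitive with respect to v_j, and
    the counit gives x = sum z_j, so some z_j is outside H. As v_j is even, a homogeneous part of
    z_j does the job. *)
Lemma exists_skew_primitive : (exists x, coinvmod H x /\ ~ H x) ->
  exists b g x, [/\ homogeneous b x, ~ H x, counit x = 0, grouplike g /\ H g &
    comul x = tens 1 x + tens x g].
Proof.
move=> [x0 [cx0 nHx0]]; have hN := cosub_coinvmod0 hH.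
have cx1 : coinvmod0 H (x0 - (counit x0)%:A).
  split; last by rewrite (linB hC) (linZ hC) counit1 [_ *: _]mulr1 subrr.
  apply: (subspB (subsp_coinvmod hH)) => //.
  by apply: coinvmod_H => //; apply: subspZ => //; apply: sh_one hH.
have nHx1 : ~ H (x0 - (counit x0)%:A).
  move=> Hx; apply: nHx0; rewrite -[x0](subrK (counit x0)%:A); apply: subspD => //.
  by apply: subspZ => //; apply: sh_one hH.
move: (x0 - _) cx1 nHx1 => {x0 cx0 nHx0} x cx nHx.
have [n [y [h [dx _ Hh]]]] := cosub_rep hN cx.
have s0 : subsp (fun z : A => z = 0) by split=> // a u w -> ->; rewrite scaler0 addr0.
have [r [v [fv gv hv]]] := grouplike_basis s0 Hh.
have [d [hd dv _]] := dual_mod s0 fv.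
pose c i := sval (cid (hv i)).
have hE i : h i = \sum_j c i j *: v j.
  by apply/eqP; rewrite -subr_eq0; apply/eqP; rewrite /c; case: (cid _).
pose z j := \sum_i c i j *: y i.
have dxE : comul x = tens 1 x + \sum_j tens (z j) (v j).
  rewrite dx; congr (_ + _); transitivity (\sum_i \sum_j tens (c i j *: y i) (v j)).
    apply: eq_bigr => i _; rewrite hE (lin_sum (lin_tensr _)); apply: eq_bigr => j _.
    by rewrite tensZl tensZr.
  by rewrite exchange_big; apply: eq_bigr => j _; rewrite (lin_sum (lin_tensl _)).
have lactE g : linear g -> lact g x = (g x : K) *: 1 + \sum_j (g (v j) : K) *: z j.
  by move=> hg; rewrite /lact dxE (linD (rsl_linear hg)) rsl_tens // rsl_sum.
have zE j : z j = lact (d j) x - (d j x : K) *: 1.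
  by rewrite lactE // addrC addKr (@dual_sum _ _ _ _ _ j).
have Xz j : coinvmod0 H (z j) by rewrite zE; apply: (cs_right hN).
have [j nHz] : exists j, ~ H (z j).
  apply: contrapT => nex; apply: nHx; rewrite -[x]lact_counit lactE //.
  rewrite (proj2 cx) scale0r add0r.
  apply: (subsp_sum (S := H)) => [|j _]; first exact: sH.
  apply: (subspZ sH).
  by apply: contrapT => nH; apply: nex; exists j.
have [[dg eg] Hg] := gv j.
have dz : comul (z j) = tens 1 (z j) + tens (z j) (v j).
  apply: slice_ext => f g hf hg; rewrite !lsl_rsl //; congr (f _).
  rewrite (linD (rsl_linear hg)) !rsl_tens // -/(lact g (z j)) {1}zE.
  rewrite (linB (lact_lin hg)) (linZ (lact_lin hg)) lact_lact // lactE; last exact: fconv_lin.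
  have fE k : fconv g (d j) (v k) = (j == k)%:R * g (v j).
    rewrite /fconv /lact (proj1 (proj1 (gv k))) rsl_tens // (linZ hg) dv.
    by case: eqP => [->|]; rewrite // scale0r mul0r.
  have -> : \sum_k (fconv g (d j) (v k) : K) *: z k = (g (v j) : K) *: z j.
    rewrite (bigD1 j) //= fE eqxx mul1r big1 ?addr0 // => k kj.
    by rewrite fE eq_sym (negbTE kj) mul0r scale0r.
  rewrite addrAC; congr (_ + _).
  have -> : lact g 1 = (g 1 : K) *: 1 by rewrite /lact comul1 rsl_tens.
  rewrite scalerA -scalerBl zE (linB hg) (linZ hg); congr ((_ - _) *: _).
have [b nHb] : exists b, ~ H (hpart b (z j)).
  apply: contrapT => nex; apply: nHz; rewrite -[z j]hpart_bool.
  apply: (subsp_sum (S := H)) => [|b _]; first exact: sH.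
  by apply: contrapT => nH; apply: nex; exists b.
exists b, (v j), (hpart b (z j)); split=> //; first exact: hpart_homog.
  by have [_ +] := Xz j; apply: counit_hpart.
rewrite -comul_hpart dz hpartD; congr (_ + _).
  by rewrite -[tens 1 _]/(iota2 A (z j)) -(shom_even (shom_iota2 A A)).
rewrite [LHS]thpart_tens big_bool /= !(homogP _ (evH Hg)).
by case: b {nHb} => /=; rewrite tens0r ?addr0 ?add0r.
Qed.
End GrouplikeSpan.

Section SkewPrimitive.
Variables (K : fieldType) (A : hopfSAlgType K).
Variables (H : A -> Prop) (hH : subhopf H).
Variables (g x : A).
Hypotheses (Hg : H g) (ex : counit x = 0) (dx : comul x = tens 1 x + tens x g).

Let sH := sh_subsp hH.
Let hD := @comul_lin K A.

Definition line (y : A) : Prop := exists c : K, y = c *: x.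

Lemma cosub_line b : homogeneous b x -> cosub H line.
Proof.
move=> hx; split.
- exact: subsp_line.
- move=> c _ [a ->]; exists (if c == b then a else 0).
  by rewrite (linZ (hpart_linear _)) (homogP _ hx); case: ifP; rewrite ?scale0r ?scaler0.
- by move=> _ [a ->]; rewrite (linZ (@counit_lin K A)) ex scaler0.
- move=> _ [a ->]; apply: (subspZ (subsp_coinvmod hH)) => f hf.
  rewrite /ract dx (linD (lsl_linear hf)) !lsl_tens // addrC addKr.
  exact: (subspZ sH).
move=> _ [a ->] f hf; exists (a * (f g : K)).
rewrite /lact (linZ hD) dx (linZ (rsl_linear hf)) (linD (rsl_linear hf)) !rsl_tens //.
by rewrite (linZ hf) scalerDr !scalerA addrAC subrr add0r.
Qed.

Lemma gen_ideal_line y : gen_ideal line y -> exists a, y = a * x.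
Proof.
move=> [n [a [z [Xz ->]]]]; pose c k := sval (cid (Xz k)).
exists (\sum_k c k *: a k); rewrite mulr_suml; apply: eq_bigr => k _.
by rewrite /c; case: (cid _) => e /= ->; rewrite -scalerAr scalerAl.
Qed.

Lemma comul_rep (S T : A -> Prop) y :
  (forall f : A -> K^o, linear f -> S (lact f y)) ->
  (forall f : A -> K^o, linear f -> T (ract f y)) -> exists n (a b : 'I_n -> A),
  [/\ comul y = \sum_i tens (a i) (b i), forall i, S (a i) & forall i, T (b i)].
Proof.
move=> Sy Ty; have [n [a [b [e fa fb]]]] := tensor_rep (comul y).
have [d [hd dE]] := dual_fam fa; have [d' [hd' dE']] := dual_fam fb.
exists n, a, b; split=> // i.
  have := Sy _ (hd' i); rewrite /lact e rsl_sum //.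
  by rewrite (@dual_sum _ _ _ _ _ i).
have := Ty _ (hd i); rewrite /ract e lsl_sum //.
by rewrite (@dual_sum _ _ _ _ _ i).
Qed.

Lemma comul_subhopf y : H y -> exists n (a b : 'I_n -> A),
  [/\ comul y = \sum_i tens (a i) (b i), forall i, H (a i) & forall i, H (b i)].
Proof.
by move=> Hy; apply: comul_rep => f hf; [apply: (sh_right hH)|apply: (sh_left hH)].
Qed.

Hypothesis evH : forall h, H h -> homogeneous false h.

(* Comparing the even left-hand components in [Delta (y x) = 0] shows that the
   annihilator of [x] in [H] is stable under [Delta]. *)
Lemma odd_contract a y : 2%N \notin [pchar K] -> homogeneous true x -> x <> 0 ->
  H y -> y = a * x -> y = 0.
Proof.
move=> ch2 hx x0 Hy ey.
have xx : x * x = 0.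
  have /eqP := supercomm _ _ _ _ hx hx; rewrite expr1 scaleN1r -subr_eq0 opprK.
  rewrite -mulr2n -scaler_nat scaler_eq0 => /orP[e2|/eqP //].
  by move: ch2; rewrite inE /= e2.
(* The even projection on the first factor keeps z_1 (x) z_2 x and kills z_1 x (x) z_2 g. *)
have key z : H z -> z * x = 0 -> exists n (c d : 'I_n -> A),
    [/\ comul z = \sum_i tens (c i) (d i), forall i, H (c i) &
        \sum_i tens (c i) (d i * x) = 0].
  move=> Hz zx; have [n [c [d [e Hc Hd]]]] := comul_subhopf Hz.
  exists n, c, d; split=> //.
  have hp : linear (tmap (hpart false) idfun : tensor A A -> tensor A A).
    exact: tmap_linear (hpart_linear _) _.
  have /(congr1 (tmap (hpart false) idfun)) : comul (z * x) = 0 by rewrite zx (lin0 hD).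
  rewrite comulM -[tmul _ _]/(comul z * comul x) e dx mulrDr (linD hp) (lin0 hp).
  rewrite !mulr_suml !(lin_sum hp) [X in _ + X]big1 ?addr0 => [|i _].
    move=> e1; rewrite -[RHS]e1; apply: eq_bigr => i _.
    rewrite (tensM _ _ (evH (Hd i)) (homog1 A)) scale1r mulr1 tmap_tens //.
      by rewrite (evH (Hc i)).
    exact: hpart_linear.
  rewrite (tensM _ _ (evH (Hd i)) hx) scale1r tmap_tens //; last exact: hpart_linear.
  have := homogM (evH (Hc i)) hx => /= hcx.
  by rewrite (homogP _ hcx) (lin0 (lin_tensl _)).
have ann0 z : H z -> z * x = 0 -> counit z = 0.
  move=> Hz /(key z Hz)[n [c [d [e Hc]]]] /(congr1 (cv antipode idfun)).
  have hS := @antipode_lin K A.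
  rewrite (lin0 (cv_lin hS _)) // (lin_sum (cv_lin hS _)) //.
  under eq_bigr do rewrite cv_tens // mulrA.
  rewrite -mulr_suml.
  have -> : \sum_i antipode (c i) * idfun (d i) = (counit z)%:A.
    by rewrite -antipodel e -(cv_sum hS).
  by move/eqP; rewrite -scalerAl mul1r scaler_eq0 => /orP[/eqP //|/eqP].
have yx : y * x = 0 by rewrite ey -mulrA xx mulr0.
apply: separate0 => f hf.
have := @fconvE K A f counit y hf (@counit_lin K A); rewrite /fconv lact_counit => ->.
apply: ann0; first exact: (sh_left hH).
have [n [c [d [e Hc e0]]]] := key y Hy yx.
have := congr1 (lsl f) e0; rewrite lsl_sum // (lin0 (lsl_linear hf)) => <-.
rewrite /ract e lsl_sum // mulr_suml; apply: eq_bigr => i _.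
by rewrite -scalerAl.
Qed.
End SkewPrimitive.

(** * Adjoining an even skew-primitive element to H *)

Section AdjoinEven.
Variables (K : fieldType) (A : hopfSAlgType K).
Variables (H : A -> Prop) (hH : subhopf H).
Hypothesis evH : forall h, H h -> homogeneous false h.
Variables (g x : A).
Hypotheses (Hg : H g) (ex : counit x = 0) (dx : comul x = tens 1 x + tens x g).
Hypothesis hx : homogeneous false x.

Let sH := sh_subsp hH.
Let hD := @comul_lin K A.
Let hg : homogeneous false g := evH Hg.

Definition polyH (P : {poly A}) : Prop := forall k, H P`_k.

Lemma polyHC h : H h -> polyH h%:P.
Proof. by move=> Hh k; rewrite coefC; case: ifP => // _; apply: subsp0. Qed.

Lemma polyHM P Q : polyH P -> polyH Q -> polyH (P * Q).
Proof.
move=> hP hQ k; rewrite coefM; apply: (subsp_sum (S := H)) => [|j _]; first exact: sH.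
exact: sh_mul.
Qed.

Lemma polyHD P Q : polyH P -> polyH Q -> polyH (P + Q).
Proof. by move=> hP hQ k; rewrite coefD; apply: subspD. Qed.

Lemma polyHN P : polyH P -> polyH (- P).
Proof. by move=> hP k; rewrite coefN; apply: subspN. Qed.

Lemma polyHX n : polyH 'X^n.
Proof. by move=> k; rewrite coefXn; case: eqP => _; [apply: sh_one|apply: subsp0]. Qed.

Lemma polyH_poly n (F : nat -> A) : (forall k, (k < n)%N -> H (F k)) -> polyH (\poly_(k < n) F k).
Proof. by move=> hF k; rewrite coef_poly; case: ifP => [/hF|_] //; apply: subsp0. Qed.

Lemma homogX (y : A) n : homogeneous false y -> homogeneous false (y ^+ n).
Proof.
move=> hy; elim: n => [|n IHn]; first exact: homog1.
by rewrite exprS; apply: (homogM hy IHn).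
Qed.

Lemma commx (y : A) : x * y = y * x. Proof. exact: even_central. Qed.
Lemma commg (y : A) : g * y = y * g. Proof. exact: even_central. Qed.

Lemma polyH_horner P Q : (P * Q).[x] = P.[x] * Q.[x].
Proof. by apply: hornerM_comm; rewrite /comm_poly -commx. Qed.

Let tensMe (a b c d : A) : homogeneous false c -> tens a b * tens c d = tens (a * c) (b * d).
Proof.
move=> hc; have h2 : linear (fun b' => tens a b' * tens c d).
  exact: (lin_comp (lin_mull _) (lin_tensr a)).
rewrite -[b]hpart_bool mulr_suml (lin_sum h2) (lin_sum (lin_tensr _)).
by apply: eq_bigr => i _; rewrite (tensM _ _ (hpart_homog i b) hc) andbF scale1r.
Qed.

(** 1 (x) x and x (x) g commute because x is even, so the binomial formula applies. The bound N pads
    the sum with zero binomials, which lets the powers of x share one range of summation. *)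
Lemma comul_pow j N : (j < N)%N ->
  comul (x ^+ j) = \sum_(k < N) tens (x ^+ k) (x ^+ (j - k) * g ^+ k) *+ 'C(j, k).
Proof.
move=> jN; have powM (a b : A) n : homogeneous false a ->
    (tens a b : tensor A A) ^+ n = tens (a ^+ n) (b ^+ n).
  move=> ha; elim: n => [|n IHn] //; rewrite !exprS IHn tensMe //; exact: homogX.
have -> : comul (x ^+ j) = (comul x : tensor A A) ^+ j.
  elim: j {jN} => [|j IHj]; first by rewrite !expr0 comul1.
  by rewrite !exprS comulM IHj.
rewrite dx exprDn_comm; last first.
  rewrite /GRing.comm !tensMe //; last exact: homog1.
  by rewrite mul1r mulr1 commx.
rewrite (big_ord_widen_cond N xpredT (fun k => tens 1 x ^+ (j - k) * tens x g ^+ k *+ 'C(j, k))) //.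
rewrite big_mkcond; apply: eq_bigr => k _; rewrite ltnS andTb.
case: leqP => [kj|kj]; last by rewrite bin_small.
rewrite !powM //; last exact: homog1.
by rewrite tensMe ?expr1n ?mul1r //; apply: homogX.
Qed.

Lemma lact_mul_pow (f : A -> K^o) h j N : linear f -> H h -> (j < N)%N ->
  lact f (h * x ^+ j) =
  \sum_(k < N) (lact (fun z => f (z * (x ^+ (j - k) * g ^+ k))) h * x ^+ k) *+ 'C(j, k).
Proof.
move=> hf Hh jN; rewrite /lact comulM -[tmul _ _]/(comul h * comul (x ^+ j)) (comul_pow jN).
rewrite mulr_sumr (lin_sum (rsl_linear hf)); apply: eq_bigr => k _.
rewrite mulrnAr -scaler_nat (linZ (rsl_linear hf)) scaler_nat; congr (_ *+ _).
set v := x ^+ _ * _; have hfv : linear (fun z => f (z * v)) by apply: (lin_comp hf (lin_mull v)).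
move: (comul h); apply: tensor_ext.
- exact: (lin_comp (rsl_linear hf) (lin_mull _)).
- exact: (lin_comp (lin_mull _) (rsl_linear hfv)).
move=> a b; rewrite tensMe; last exact: homogX.
by rewrite !rsl_tens // -scalerAl.
Qed.

Lemma ract_mul_pow (f : A -> K^o) h j N : linear f -> H h -> (j < N)%N ->
  ract f (h * x ^+ j) =
  \sum_(k < N) (ract (fun z => f (z * x ^+ k)) h * (x ^+ (j - k) * g ^+ k)) *+ 'C(j, k).
Proof.
move=> hf Hh jN; rewrite /ract comulM -[tmul _ _]/(comul h * comul (x ^+ j)) (comul_pow jN).
rewrite mulr_sumr (lin_sum (lsl_linear hf)); apply: eq_bigr => k _.
rewrite mulrnAr -scaler_nat (linZ (lsl_linear hf)) scaler_nat; congr (_ *+ _).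
have hfv : linear (fun z => f (z * x ^+ k)) by apply: (lin_comp hf (lin_mull _)).
move: (comul h); apply: tensor_ext.
- exact: (lin_comp (lsl_linear hf) (lin_mull _)).
- exact: (lin_comp (lin_mull _) (lsl_linear hfv)).
move=> a b; rewrite tensMe; last exact: homogX.
by rewrite !lsl_tens // -scalerAl.
Qed.

Definition adjoin (y : A) : Prop := exists2 P, polyH P & y = P.[x].

Lemma subsp_adjoin : subsp adjoin.
Proof.
split; first by exists 0; [move=> k; rewrite coef0; apply: subsp0|rewrite horner0].
move=> a _ _ [P hP ->] [Q hQ ->]; exists ((a%:A)%:P * P + Q).
  apply: polyHD => //; apply: polyHM => //; apply: polyHC.
  by apply: (subspZ sH); apply: sh_one hH.
by rewrite hornerD hornerCM -scalerAl mul1r.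
Qed.

Lemma adjoin_mul y z : adjoin y -> adjoin z -> adjoin (y * z).
Proof.
move=> [P hP ->] [Q hQ ->]; exists (P * Q); first exact: polyHM.
by rewrite polyH_horner.
Qed.

Lemma adjoin_H h : H h -> adjoin h.
Proof. by move=> Hh; exists h%:P; [apply: polyHC|rewrite hornerC]. Qed.

Lemma adjoin_pow n : adjoin (x ^+ n).
Proof. by exists 'X^n; [apply: polyHX|rewrite hornerXn]. Qed.

Lemma H_pow n : H (g ^+ n).
Proof. by elim: n => [|n IHn]; [apply: sh_one|rewrite exprS; apply: sh_mul]. Qed.

Lemma adjoin_ind (S : A -> Prop) : subsp S -> (forall h j, H h -> S (h * x ^+ j)) ->
  forall y, adjoin y -> S y.
Proof.
move=> hS h _ [P hP ->]; rewrite horner_coef; apply: (subsp_sum (S := S)) => // j _.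
exact: h.
Qed.

Lemma adjoin_even y : adjoin y -> homogeneous false y.
Proof.
move: y; apply: adjoin_ind => [|h j Hh].
  split; first exact: homog0.
  by move=> a y z hy hz; apply: homogD => //; apply: homogZ.
exact: (homogM (evH Hh) (homogX _ hx)).
Qed.

(** Stability under the antipode comes from S(x) = - x S(g). The result makes purity over H[x], and
    not only over H, available to [even_cosub]. *)
Lemma subhopf_adjoin : subhopf adjoin.
Proof.
have hA := subsp_adjoin; split=> //.
- move=> b y ay; rewrite (homogP _ (adjoin_even ay)).
  by case: eqP => // _; apply: subsp0.
- by apply: adjoin_H; apply: sh_one.
- exact: adjoin_mul.
- move=> f hf y; move: y; apply: adjoin_ind => [|h j Hh].
    exact: subsp_preim (ract_lin hf) hA.
  rewrite (ract_mul_pow hf Hh (ltnSn j)); apply: (subsp_sum (S := adjoin)) => // k _.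
  rewrite -scaler_nat; apply: (subspZ hA); apply: adjoin_mul.
    apply: adjoin_H; apply: (sh_left hH) => //.
    exact: (lin_comp hf (lin_mull _)).
  by apply: adjoin_mul; [apply: adjoin_pow|apply: adjoin_H; apply: H_pow].
- move=> f hf y; move: y; apply: adjoin_ind => [|h j Hh].
    exact: subsp_preim (lact_lin hf) hA.
  rewrite (lact_mul_pow hf Hh (ltnSn j)); apply: (subsp_sum (S := adjoin)) => // k _.
  rewrite -scaler_nat; apply: (subspZ hA); apply: adjoin_mul; last exact: adjoin_pow.
  apply: adjoin_H; apply: (sh_right hH) => //.
  exact: (lin_comp hf (lin_mull _)).
have [hS eS S1 SM] := shom_antipode A.
have Sx : antipode x = - (x * antipode g).
  have := antipoder x; rewrite dx.
  rewrite -[tlift _ _]/(cv idfun antipode _) (linD (cv_lin (@lin_id _ _) hS)) //.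
  by rewrite !cv_tens // mul1r ex scale0r => /eqP; rewrite addr_eq0 => /eqP.
move=> y; move: y; apply: adjoin_ind => [|h j Hh]; first exact: subsp_preim hS hA.
rewrite SM; apply: adjoin_mul; first by apply: adjoin_H; apply: sh_antipode.
have aSx : adjoin (antipode x).
  rewrite Sx -mulrN; apply: adjoin_mul; first by rewrite -[x]expr1; apply: adjoin_pow.
  by apply: adjoin_H; apply: (subspN sH); apply: sh_antipode.
elim: j => [|j IHj]; first by rewrite expr0 S1; apply: adjoin_H; apply: sh_one.
by rewrite exprS SM; apply: adjoin_mul.
Qed.
Definition relation (P : {poly A}) : Prop := polyH P /\ P.[x] = 0.

Lemma relationB P Q : relation P -> relation Q -> relation (P - Q).
Proof.
move=> [hP eP] [hQ eQ]; split; first by apply: polyHD => //; apply: polyHN.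
by rewrite hornerD hornerN eP eQ subrr.
Qed.

Lemma relationM P Q : relation P -> polyH Q -> relation (P * Q).
Proof.
by move=> [hP eP] hQ; split; [apply: polyHM|rewrite polyH_horner eP mul0r].
Qed.

(** The formal lift of [lact f] from values at x to polynomials; it sends relations of size at most
    n to relations of size at most n. *)
Definition lact_poly n (f : A -> K^o) (P : {poly A}) : {poly A} :=
  \poly_(k < n) \sum_(j < n) lact (fun z => f (z * (x ^+ (j - k) * g ^+ k))) P`_j *+ 'C(j, k).

Let lin_fmul (f : A -> K^o) v : linear f -> linear (fun z => f (z * v)).
Proof. by move=> hf; apply: (lin_comp hf (lin_mull v)). Qed.

Lemma polyH_lact n f P : linear f -> polyH P -> polyH (lact_poly n f P).
Proof.
move=> hf hP; apply: polyH_poly => k _.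
apply: (subsp_sum (S := H)) => [|j _]; first exact: sH.
by rewrite -scaler_nat; apply: (subspZ sH); apply: (sh_right hH) => //; apply: lin_fmul.
Qed.

Lemma lact_poly_horner n f P : linear f -> polyH P -> (size P <= n)%N ->
  (lact_poly n f P).[x] = lact f P.[x].
Proof.
move=> hf hP sP; rewrite horner_poly (horner_coef_wide _ sP) (lin_sum (lact_lin hf)).
under [RHS]eq_bigr => j _ do rewrite (lact_mul_pow hf (hP j) (ltn_ord j)).
rewrite exchange_big; apply: eq_bigr => k _ /=; rewrite mulr_suml; apply: eq_bigr => j _.
by rewrite mulrnAl.
Qed.

Lemma lact_poly_relation n f P : linear f -> relation P -> (size P <= n)%N ->
  relation (lact_poly n f P).
Proof.
move=> hf [hP eP] sP; split; first exact: polyH_lact.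
by rewrite lact_poly_horner // eP (lin0 (lact_lin hf)).
Qed.

Lemma lact_poly_lead n f P : (lact_poly n.+1 f P)`_n = lact (fun z => f (z * g ^+ n)) P`_n.
Proof.
rewrite coef_poly ltnSn big_ord_recr /= binn subnn expr0 mul1r big1 ?add0r // => j _.
by rewrite bin_small.
Qed.

Hypothesis gg : grouplike g.

Let ginv := antipode g.

Let mulgV : g * ginv = 1.
Proof.
have hS := @antipode_lin K A; have := antipoder g; rewrite (proj1 gg) (proj2 gg) scale1r.
by rewrite -[tlift _ _]/(cv idfun antipode _) cv_tens.
Qed.

Let mulgXV n : g ^+ n * ginv ^+ n = 1.
Proof. by rewrite -exprMn_comm ?mulgV ?expr1n //; apply: commg. Qed.

Lemma grouplikeX n : grouplike (g ^+ n).
Proof.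
elim: n => [|n [IH1 IH2]]; first by split; [apply: comul1|apply: counit1].
rewrite exprS; split; last by rewrite counitM IH2 (proj2 gg) mulr1.
by rewrite comulM IH1 (proj1 gg) -[tmul _ _]/(tens g g * tens _ _) tensMe //; apply: homogX.
Qed.

Section Minimal.
Variable n : nat.
Hypothesis minimal : forall P, relation P -> (size P <= n)%N -> P = 0.

(* The leading coefficients of the relations of degree at most [n] form an
   ideal of [H] stable under [Delta], hence all of [H]. *)
Lemma monic_relation : (exists P, [/\ relation P, (size P <= n.+1)%N & P <> 0]) ->
  exists m, [/\ relation m, (size m <= n.+1)%N & m`_n = 1].
Proof.
move=> [P0 [rP0 sP0 nP0]].
pose J h := exists P, [/\ relation P, (size P <= n.+1)%N & P`_n = h].
have sJ : subsp J.
  split.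
    exists 0; split; rewrite ?size_poly0 ?coef0 //.
    by split=> [k|]; rewrite ?coef0 ?horner0 //; apply: subsp0.
  move=> a _ _ [P [rP sP <-]] [Q [rQ sQ <-]]; exists (P * (a%:A)%:P + Q); split.
  - rewrite -[Q]opprK; apply: relationB.
      by apply: relationM => //; apply: polyHC; apply: (subspZ sH); apply: sh_one hH.
    rewrite -[- Q]add0r; apply: relationB => //.
    by split=> [k|]; rewrite ?coef0 ?horner0 //; apply: subsp0.
  - apply/leq_sizeP => j nj; rewrite coefD coefMC.
    by rewrite (leq_sizeP _ _ sP) // (leq_sizeP _ _ sQ) // mul0r addr0.
  by rewrite coefD coefMC -scalerAr mulr1.
have JM h b : J h -> H b -> J (h * b).
  move=> [P [rP sP <-]] Hb; exists (P * b%:P); split; last by rewrite coefMC.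
    by apply: relationM => //; apply: polyHC.
  by apply/leq_sizeP => j nj; rewrite coefMC (leq_sizeP _ _ sP) // mul0r.
have Jlact h (f : A -> K^o) : linear f -> J h -> J (lact f h).
  (* Slicing a relation multiplies the argument of f by g^n in the leading coefficient; composing f
     with multiplication by the inverse of g^n undoes this. *)
  move=> hf [P [rP sP <-]]; have hf' := lin_fmul (ginv ^+ n) hf.
  exists (lact_poly n.+1 (fun z => f (z * ginv ^+ n)) P); split.
  - exact: lact_poly_relation.
  - exact: size_poly.
  rewrite lact_poly_lead; apply: tlift_eq => u v.
  by rewrite -mulrA mulgXV mulr1.
have [f0 [hf0 f01]] : exists f : A -> K^o, linear f /\ f P0`_n = 1.
  have nz : P0`_n <> 0.
    move=> e; apply: nP0; apply: minimal => //; apply/leq_sizeP => j.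
    by rewrite leq_eqVlt => /orP[/eqP <- //|]; apply: (leq_sizeP _ _ sP0).
  have s0 : subsp (fun z : A => z = 0) by split=> // a u w -> ->; rewrite scaler0 addr0.
  by have [f [hf f1 _]] := separate s0 nz; exists f.
have Jh : J (lact f0 P0`_n) by apply: Jlact => //; exists P0.
set h := lact f0 _ in Jh.
have eh : counit h = 1.
  have := @fconvE K A counit f0 P0`_n (@counit_lin K A) hf0.
  by rewrite ract_counit f01.
have Hh : H h by case: Jh => P [[hP _] _ <-].
(* Delta h lies in J (x) H and J is stable under multiplication by H, so 1 = eps(h) 1 = h_1 S(h_2)
   lies in J. *)
have [r [a [b [e Ja Hb]]]] := @comul_rep K A J H h (fun f hf => Jlact _ _ hf Jh)
  (fun f hf => sh_left hH hf Hh).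
suff [m [rm sm m1]] : J 1 by exists m.
have hS := @antipode_lin K A.
have <- : \sum_i a i * antipode (b i) = 1.
  have := antipoder h; rewrite eh scale1r e => <-.
  by rewrite -[tlift _ _]/(cv idfun antipode _) cv_sum.
apply: (subsp_sum (S := J)) => // i _; apply: JM => //.
exact: sh_antipode.
Qed.
(** The slice of m and f(g^n) m have the same leading coefficient, so their difference is a relation
    of degree below n, hence zero. *)
Lemma monic_lact m (f : A -> K^o) k : relation m -> (size m <= n.+1)%N -> m`_n = 1 ->
  linear f -> (k <= n)%N ->
  \sum_(j < n.+1) lact (fun z => f (z * (x ^+ (j - k) * g ^+ k))) m`_j *+ 'C(j, k) =
  (f (g ^+ n) : K) *: m`_k.
Proof.
move=> rm sm m1 hf kn; pose c : A := (f (g ^+ n) : K) *: 1.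
have rD : relation (lact_poly n.+1 f m - m * c%:P).
  apply: relationB; first exact: lact_poly_relation.
  by apply: relationM => //; apply: polyHC; apply: (subspZ sH); apply: sh_one hH.
have D0 : lact_poly n.+1 f m - m * c%:P = 0.
  apply: minimal => //; apply/leq_sizeP => j; rewrite leq_eqVlt => /orP[/eqP <-|nj].
    rewrite coefB lact_poly_lead coefMC m1 mul1r /lact comul1 rsl_tens ?mul1r ?subrr //.
    exact: lin_fmul.
  rewrite coefB coefMC (leq_sizeP _ _ sm) // mul0r subr0.
  by apply: (leq_sizeP _ _ (size_poly _ _)).
have := congr1 (fun P : {poly A} => P`_k) D0.
rewrite coefB coefMC coef0 coef_poly ltnS kn => /eqP; rewrite subr_eq0 => /eqP ->.
by rewrite -scalerAr mulr1.
Qed.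

(** This is [monic_lact] with the two tensor factors exchanged: both identities are the same after
    applying a functional to each factor. *)
Lemma monic_ract m (f : A -> K^o) k : relation m -> (size m <= n.+1)%N -> m`_n = 1 ->
  linear f -> (k <= n)%N ->
  \sum_(j < n.+1) (ract f m`_j * (x ^+ (j - k) * g ^+ k)) *+ 'C(j, k) =
  (f m`_k : K) *: g ^+ n.
Proof.
move=> rm sm m1 hf kn; apply/eqP; rewrite -subr_eq0; apply/eqP; apply: separate0 => f' hf'.
have := congr1 f (monic_lact rm sm m1 hf' kn).
rewrite (linB hf') (linZ hf) (linZ hf') (lin_sum hf) (lin_sum hf') => e.
apply/eqP; rewrite subr_eq0; apply/eqP.
rewrite [_ *: _]mulrC -[RHS]e; apply: eq_bigr => j _.
rewrite -!scaler_nat (linZ hf) (linZ hf'); congr (_ *: _).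
by rewrite -[RHS]lsl_rsl //; apply: lin_fmul.
Qed.

(** The k-th divided derivative, with coefficients sliced by f and multiplied by g^k. *)
Definition ract_poly (f : A -> K^o) k (P : {poly A}) : {poly A} :=
  \poly_(i < n.+1) ((ract f P`_(i + k) * g ^+ k) *+ 'C(i + k, k)).

Lemma polyH_ract f k P : linear f -> polyH P -> polyH (ract_poly f k P).
Proof.
move=> hf hP; apply: polyH_poly => i _; rewrite -scaler_nat; apply: (subspZ sH).
by apply: sh_mul => //; [apply: (sh_left hH)|apply: H_pow].
Qed.

Lemma monic_ract_horner m (f : A -> K^o) k : relation m -> (size m <= n.+1)%N ->
  m`_n = 1 -> linear f -> (k <= n)%N -> (ract_poly f k m).[x] = (f m`_k : K) *: g ^+ n.
Proof.
move=> rm sm m1 hf kn; rewrite -(monic_ract rm sm m1 hf kn) horner_poly.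
pose F j := (ract f m`_j * (x ^+ (j - k) * g ^+ k)) *+ 'C(j, k).
rewrite -[RHS](big_mkord xpredT F) (@big_cat_nat _ _ _ k) //=; last exact: leqW.
rewrite [X in _ = X + _]big_nat [X in _ = X + _]big1 ?add0r; last first.
  by move=> j /andP[_ jk]; rewrite /F bin_small.
pose F' i := (ract f m`_(i + k) * g ^+ k) *+ 'C(i + k, k) * x ^+ i.
rewrite -[LHS](big_mkord xpredT F') (@big_cat_nat _ _ _ (n.+1 - k)) //=; last exact: leq_subr.
rewrite [X in _ + X]big_nat [X in _ + X]big1 ?addr0; last first.
  move=> i /andP[ni _]; rewrite /F' (leq_sizeP _ _ sm) ?(lin0 (ract_lin hf)) ?mul0r ?mul0rn ?mul0r //.
  by rewrite addnC -leq_subLR.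
rewrite -{2}[k]add0n big_addn; apply: eq_bigr => i _.
by rewrite /F /F' addnK mulrnAl -mulrA (even_central (g ^+ k) (homogX i hx)).
Qed.

Section Monic.
Variable m : {poly A}.
Hypotheses (rm : relation m) (sm : (size m <= n.+1)%N) (m1 : m`_n = 1).

Let n_gt0 : (0 < n)%N.
Proof.
case: n sm m1 => // sm0 m10; have em : m = 1%:P.
  by rewrite (size1_polyC sm0) m10.
by have [_ /eqP] := rm; rewrite em hornerC oner_eq0.
Qed.

(** For k > 0 the k-th divided derivative of m, times g^k, minus eps(m_k) g^n is a relation of
    degree below n, hence zero. This is what makes m a p-polynomial up to its constant term. *)
Lemma monic_coef_pos k i : (0 < k <= n)%N ->
  m`_(i.+1 + k) *+ 'C(i.+1 + k, k) = 0 /\ m`_k * g ^+ k = (counit m`_k) *: g ^+ n.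
Proof.
move=> /andP[k0 kn]; have hC := @counit_lin K A.
pose R := ract_poly counit k m - ((counit m`_k : K) *: g ^+ n)%:P.
have R0 : R = 0.
  apply: minimal.
    split; last by rewrite hornerD hornerN (monic_ract_horner rm sm m1 hC kn) hornerC subrr.
    apply: polyHD; first exact: polyH_ract hC (proj1 rm).
    by apply: polyHN; apply: polyHC; apply: (subspZ sH); apply: H_pow.
  apply/leq_sizeP => j nj; rewrite coefB coefC (gtn_eqF (leq_trans n_gt0 nj)) subr0.
  rewrite coef_poly; case: ifP => // _.
  rewrite (leq_sizeP _ _ sm) ?(lin0 (ract_lin hC)) ?mul0r ?mul0rn //.
  by rewrite -addn1 leq_add.
have coefR j : R`_j = 0 by rewrite R0 coef0.
split.
  have [ni|ni] := ltnP (i.+1 + k) n.+1; last by rewrite (leq_sizeP _ _ sm) // mul0rn.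
  have := coefR i.+1; rewrite coefB coefC subr0 coef_poly (leq_trans _ ni) ?ltnS ?leq_addr //.
  rewrite ract_counit -mulrnAl => /(congr1 (fun z => z * ginv ^+ k)).
  by rewrite mul0r -mulrA mulgXV mulr1.
have := coefR 0%N; rewrite coefB coefC coef_poly /= add0n binn ract_counit => /eqP.
by rewrite subr_eq0 => /eqP.
Qed.

(** The case k = 0: the slice of m keeps its degree, so f(1) m has to be subtracted as well to
    obtain a relation of degree below n. *)
Lemma monic_coef0 (f : A -> K^o) : linear f ->
  (forall i, ract f m`_i.+1 = (f 1 : K) *: m`_i.+1) /\
  ract f m`_0 = (f m`_0 : K) *: g ^+ n + (f 1 : K) *: m`_0.
Proof.
move=> hf; pose c : A := (f 1 : K) *: 1.
pose R := ract_poly f 0 m - ((f m`_0 : K) *: g ^+ n)%:P - m * c%:P.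
have coefE i : (ract_poly f 0 m)`_i = ract f m`_i.
  rewrite coef_poly addn0 bin0 expr0 mulr1; case: ltnP => // ni.
  by rewrite (leq_sizeP _ _ sm) // (lin0 (ract_lin hf)).
have Hc : H c by apply: (subspZ sH); apply: sh_one hH.
have R0 : R = 0.
  apply: minimal.
    apply: relationB; last by apply: relationM => //; apply: polyHC.
    split; last by rewrite hornerD hornerN (monic_ract_horner rm sm m1 hf) // hornerC subrr.
    apply: polyHD; first exact: polyH_ract hf (proj1 rm).
    by apply: polyHN; apply: polyHC; apply: (subspZ sH); apply: H_pow.
  apply/leq_sizeP => j nj; rewrite !coefB coefC (gtn_eqF (leq_trans n_gt0 nj)) subr0.
  rewrite coefE coefMC; move: nj; rewrite leq_eqVlt => /orP[/eqP <-|nj].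
    by rewrite m1 mul1r /ract comul1 lsl_tens // subrr.
  by rewrite (leq_sizeP _ _ sm) // (lin0 (ract_lin hf)) mul0r subrr.
have coefR j : R`_j = 0 by rewrite R0 coef0.
split=> [i|].
  have := coefR i.+1; rewrite !coefB coefE coefC coefMC subr0 => /eqP.
  by rewrite subr_eq0 => /eqP ->; rewrite -scalerAr mulr1.
have := coefR 0%N; rewrite !coefB coefE coefC coefMC /= => /eqP.
by rewrite subr_eq0 subr_eq addrC => /eqP ->; rewrite -scalerAr mulr1.
Qed.

Lemma monic_coef_scalar i : m`_i.+1 = (counit m`_i.+1)%:A.
Proof.
apply/eqP; rewrite -subr_eq0; apply/eqP; apply: separate0 => f hf.
have := @fconvE K A f counit m`_i.+1 hf (@counit_lin K A).
rewrite /fconv lact_counit (proj1 (monic_coef0 hf)) (linZ (@counit_lin K A)) => e.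
by rewrite (linB hf) (linZ hf) e [_ *: f 1]mulrC subrr.
Qed.

Lemma monic_coef0_skew : comul m`_0 = tens 1 m`_0 + tens m`_0 (g ^+ n).
Proof.
apply: slice_ext => f f' hf hf'; congr (f' _).
by rewrite -/(ract f m`_0) (proj2 (monic_coef0 hf)) (linD (lsl_linear hf)) !lsl_tens // addrC.
Qed.

Hypothesis Kclosed : GRing.closed_field_axiom K.
Hypothesis spanH : forall h, H h -> exists s : seq (K * A),
  (forall u, u \in s -> grouplike u.2 /\ H u.2) /\ h = \sum_(u <- s) u.1 *: u.2.

(* Up to a factor killed by the middle binomial coefficients, [(g - 1)^j] is [g^j - 1]. *)
Lemma monic_coef_pow j : (j < n)%N ->
  m`_j.+1 * (g - 1) ^+ j.+1 = (counit m`_j.+1) *: (g ^+ n - 1).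
Proof.
move=> jn; have [_ gn] := @monic_coef_pos j.+1 0 jn.
rewrite scalerBr -gn -[X in _ = _ - X]/((counit m`_j.+1)%:A) -monic_coef_scalar.
have := exprD1n (g - 1) j.+1; rewrite subrK => ->.
rewrite mulr_sumr big_ord_recr big_ord_recl /= bin0 binn expr0 mulr1 big1 ?addr0.
  by rewrite addrC addrK.
move=> i _; rewrite mulrnAr -mulrnAl.
have le : (0 < bump 0 i <= n)%N by rewrite /= (leq_trans (ltn_ord i)) // ltnW.
have [e _] := monic_coef_pos (j - i.+1) le.
have ji : ((j - i.+1).+1 + bump 0 i = j.+1)%N.
  by rewrite /bump add1n addSn subnK.
by rewrite -ji e mul0r.
Qed.

(** Since m_0 = c (1 - g^n) and m_j (g - 1)^j = eps(m_j) (g^n - 1) for j > 0, the value of m at l (g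
    - 1) is g^n - 1 times the scalar sum_(j > 0) eps(m_j) l^j - c. *)
Lemma monic_root : exists l : K, m.[l *: (g - 1)] = 0.
Proof.
have [c ec] := skew_primitive_scalar spanH (grouplikeX n) (proj1 rm 0%N) monic_coef0_skew.
(* The closedness axiom solves l^n = sum_(j < n) P_j l^j, which explains the signs; the term j = n
   has coefficient eps(m_n) = 1. *)
have [l el] := Kclosed (fun j => if j is 0%N then c else - counit m`_j) n_gt0.
exists l; rewrite (horner_coef_wide _ sm) big_ord_recl expr0 mulr1 ec.
under eq_bigr => j _ do
  rewrite exprZn -scalerAr monic_coef_pow // scalerA.
rewrite -scaler_suml -[1 - _]opprB scalerN addrC -scalerBl.
suff -> : \sum_(j < n) l ^+ (lift ord0 j) * counit m`_(lift ord0 j) = c.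
  by rewrite subrr scale0r.
have [n' en] : exists n', n = n'.+1 by exists n.-1; rewrite prednK.
move: el m1; rewrite en big_ord_recl [X in _ -> _ -> X = _]big_ord_recr /= expr0 mulr1.
rewrite /bump leq0n add1n => el ->; rewrite counit1 mulr1 el addrCA -big_split big1 ?addr0 //.
by move=> j _ /=; rewrite mulNr [_ * counit _]mulrC subrr.
Qed.
End Monic.

Lemma central_horner (u : A) P Q : homogeneous false u -> (P * Q).[u] = P.[u] * Q.[u].
Proof. by move=> hu; apply: hornerM_comm; rewrite /comm_poly -(even_central _ hu). Qed.

(** Division by the monic m leaves a relation of degree below n, which is zero by minimality; so
    every relation is a multiple of m. *)
Lemma monic_transfer m (u : A) : homogeneous false u ->
  relation m -> (size m <= n.+1)%N -> m`_n = 1 -> m.[u] = 0 ->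
  forall P, relation P -> P.[u] = 0.
Proof.
move=> hu rm sm m1 mu P; have [s] := ubnP (size P); elim: s P => // s IHs P sP rP.
have [Pn|nP] := leqP (size P) n; first by rewrite (minimal rP Pn) horner0.
pose d := ((size P).-1 - n)%N; pose a := P`_(size P).-1.
have eP : (size P).-1 = (d + n)%N by rewrite subnK // -ltnS (ltn_predK nP).
pose R := m * (a%:P * 'X^d).
have rR : relation R.
  apply: relationM => //; apply: polyHM; last exact: polyHX.
  by apply: polyHC; apply: (proj1 rP).
have coefR j : R`_j = if (j < d)%N then 0 else m`_(j - d) * a.
  by rewrite /R mulrA coefMXn coefMC.
have sR : (size (P - R)%R < s)%N.
  apply: (@leq_trans (size P)); last by rewrite -ltnS.
  rewrite -(ltn_predK nP) ltnS; apply/leq_sizeP => j dj.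
  rewrite coefB coefR ltnNge (leq_trans _ dj) ?eP ?leq_addr //=.
  move: dj; rewrite leq_eqVlt => /orP[/eqP <-|dj].
    by rewrite eP addKn m1 mul1r /a eP subrr.
  rewrite (leq_sizeP _ _ (leqnn _)) ?(leq_sizeP _ _ sm) ?mul0r ?subrr //.
    by rewrite ltn_subRL -eP.
  by rewrite -(ltn_predK nP).
have e := IHs _ sR; have -> : P = (P - R) + R by rewrite subrK.
by rewrite hornerD e ?(central_horner _ _ hu) ?mu ?mul0r ?addr0 //; apply: relationB.
Qed.

End Minimal.

Hypothesis Kclosed : GRing.closed_field_axiom K.
Hypothesis spanH : forall h, H h -> exists s : seq (K * A),
  (forall u, u \in s -> grouplike u.2 /\ H u.2) /\ h = \sum_(u <- s) u.1 *: u.2.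

Let homog_shift l : homogeneous false (l *: (g - 1)).
Proof. by apply: homogZ; apply: homogD => //; apply: homogN; apply: homog1. Qed.

(** If x is transcendental over H, the only relation is 0 and l = 0 is taken. Otherwise n is the
    least degree of a nonzero relation. *)
Lemma relation_root : exists l : K, forall P, relation P -> P.[l *: (g - 1)] = 0.
Proof.
have [nr|] := pselect (forall P, relation P -> P = 0).
  by exists 0 => P /nr ->; rewrite horner0.
move=> /existsNP[P0 /not_implyP[rP0 nP0]].
pose Q n := `[< exists P, [/\ relation P, (size P <= n.+1)%N & P <> 0] >].
have exQ : exists n, Q n by exists (size P0); apply/asboolP; exists P0.
have [n /asboolP ex_n min_n] := ex_minnP exQ.
have minimal P : relation P -> (size P <= n)%N -> P = 0.
  move=> rP sP; apply: contrapT => nP; move: sP; case: n {ex_n} min_n => [|n] min_n sP.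
    by apply: nP; apply/eqP; rewrite -size_poly_leq0.
  suff /min_n : Q n by rewrite ltnn.
  by apply/asboolP; exists P.
have [m [rm sm m1]] := monic_relation minimal ex_n.
have [l ml] := monic_root minimal rm sm m1 Kclosed spanH.
by exists l; apply: (monic_transfer minimal (homog_shift l) rm sm m1 ml).
Qed.

Lemma even_cosub : ~ H x -> exists X, [/\ cosub H X, exists y, X y /\ y <> 0 &
  forall y, gen_ideal X y -> H y -> y = 0].
Proof.
move=> nHx; have [l lr] := relation_root; set u := l *: (g - 1) in lr.
have Hu : H u.
  by apply: (subspZ sH); apply: (subspB sH) => //; apply: sh_one hH.
pose y := x - u.
have hC := @counit_lin K A.
have ey : counit y = 0.
  rewrite (linB hC) ex (linZ hC) (linB hC) counit1 (proj2 gg).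
  by rewrite subrr scaler0 subrr.
have dy : comul y = tens 1 y + tens y g.
  rewrite /y (linB hD) dx (linZ hD) (linB hD) comul1 (proj1 gg).
  rewrite (linB (lin_tensr _)) (linB (lin_tensl _)) (linZ (lin_tensr _)) (linZ (lin_tensl _)).
  rewrite (linB (lin_tensr _)) (linB (lin_tensl _)) [RHS]addrACA -opprD -scalerDr.
  by congr (_ - _ *: _); rewrite [RHS]addrC addrA subrK.
have hy : homogeneous false y by apply: homogD => //; apply: homogN; apply: evH.
exists (line y); split.
- exact: (cosub_line hH Hg ey dy hy).
- exists y; split; first by exists 1; rewrite scale1r.
  by move=> /eqP; rewrite subr_eq0 => /eqP exu; apply: nHx; rewrite exu.
move=> z /gen_ideal_line[a za] Hz.
have Ay : adjoin y.
  apply: (subspB subsp_adjoin); last exact: adjoin_H.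
  by rewrite -[x]expr1; apply: adjoin_pow.
have zy : z = y * a by rewrite (even_central _ hy).
(* Purity over H[x] replaces the cofactor a by Q(x) with Q over H. Then z - (X - u) Q is a relation;
   its value at u vanishes by the choice of l, and this value is z. *)
have [_ [Q hQ ->] zQ] := ideal_contract subhopf_adjoin (adjoin_H Hz) Ay zy.
have Xu v : ('X - u%:P).[v] = v - u by rewrite hornerD hornerN hornerX hornerC.
have := lr (z%:P - ('X - u%:P) * Q).
rewrite hornerD hornerN central_horner; last exact: homog_shift.
rewrite Xu subrr mul0r subr0 hornerC; apply.
split.
  apply: polyHD; first exact: polyHC.
  apply: polyHN; apply: polyHM => //; rewrite -['X]expr1; apply: polyHD; first exact: polyHX.
  by apply: polyHN; apply: polyHC.
by rewrite hornerD hornerN polyH_horner Xu hornerC -/y -zQ subrr.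
Qed.

End AdjoinEven.

Lemma diagonalizable_cosub (K : fieldType) (A : hopfSAlgType K) (H : A -> Prop) :
  2%N \notin [pchar K] -> GRing.closed_field_axiom K -> subhopf H ->
  (forall h, H h -> homogeneous false h) ->
  (forall h, H h -> exists s : seq (K * A),
    (forall u, u \in s -> grouplike u.2 /\ H u.2) /\ h = \sum_(u <- s) u.1 *: u.2) ->
  (exists x, coinvmod H x /\ ~ H x) ->
  exists X, [/\ cosub H X, exists y, X y /\ y <> 0 &
    forall y, gen_ideal X y -> H y -> y = 0].
Proof.
move=> ch2 Kclosed hH evH spanH exx.
have [b [g [x [hx nHx ex [gg Hg] dx]]]] := exists_skew_primitive hH spanH evH exx.
case: b hx => hx; last exact: (even_cosub hH evH Hg ex dx hx gg Kclosed spanH nHx).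
have x0 : x <> 0 by move=> e; apply: nHx; rewrite e; apply: subsp0 (sh_subsp hH).
exists (line x); split.
- exact: (cosub_line hH Hg ex dx hx).
- by exists x; split=> //; exists 1; rewrite scale1r.
move=> y /gen_ideal_line[a ya] Hy.
exact: (odd_contract hH dx evH ch2 hx x0 Hy ya).
Qed.

(** * Construction of the section *)

Section HopfMorphisms.
Variables (K : fieldType).

Lemma hopf_comp (A B C : hopfSAlgType K) (f : hopf_hom A B) (g : hopf_hom B C) :
  exists h : hopf_hom A C, forall x, h x = g (f x).
Proof.
have sf := shom_hopf f; have sg := shom_hopf g.
have hD x : comul ((g \o f) x) = tmap (g \o f) (g \o f) (comul x).
  rewrite -tmap_comp; try exact: shom_lin.
  by rewrite /= !hopf_hom_comul.
have hc x : counit ((g \o f) x) = counit x by rewrite /= !hopf_hom_counit.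
by exists (mk_hopf_hom (shom_comp sg sf) hD hc).
Qed.

Lemma hopf_inverse (A Q : hopfSAlgType K) (i : hopf_hom Q A) :
  injective i -> (forall x, hopf_image i x) -> exists s : hopf_hom A Q, cancel i s.
Proof.
move=> inj sur; have [j [hj ej ji]] := image_retraction inj.
have [hi ei i1 iM] := shom_hopf i.
have ij x : i (j x) = x by have [q ->] := sur x; rewrite ji.
have sj : shom j.
  split=> // [|x y]; first by rewrite -[RHS]ji i1.
  by rewrite -{1}(ij x) -{1}(ij y) -iM ji.
have hD x : comul (j x) = tmap j j (comul x).
  rewrite -{2}(ij x) hopf_hom_comul tmap_comp //.
  transitivity (tmap idfun idfun (comul (j x))); last first.
    by apply: eq_tmap => q; rewrite /= ji.
  transitivity (idfun (comul (j x))) => //; move: (comul (j x)); apply: tensor_ext => //.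
    exact: tmap_linear.
  by move=> v w; rewrite tmap_tens.
have hc x : counit (j x) = counit x by rewrite -{2}(ij x) hopf_hom_counit.
by exists (mk_hopf_hom sj hD hc).
Qed.
End HopfMorphisms.

Section MaximalIdeal.
Variables (K : fieldType) (A : hopfSAlgType K) (H : A -> Prop).

Definition transversal (I : A -> Prop) : Prop :=
  hopf_ideal I /\ forall x, I x -> H x -> x = 0.

Lemma transversal0 : transversal (fun x => x = 0).
Proof.
split=> //; split=> //.
- by split=> // a x y -> ->; rewrite scaler0 addr0.
- by move=> b x ->; rewrite hpart0.
- by move=> a x ->; rewrite mulr0.
- by move=> a x ->; rewrite mul0r.
- by move=> x ->; apply: lin0 (@counit_lin K A).
- by move=> x ->; apply: lin0 (@antipode_lin K A).
by move=> x -> f g hf hg _ _; rewrite (lin0 (ract_lin hf)) (lin0 hg).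
Qed.

(** The condition on Delta passes to the union of a chain because a functional vanishing on the
    union vanishes on each member. *)
Lemma maximal_transversal : exists2 I, transversal I &
  forall J, transversal J -> (forall x, I x -> J x) -> forall x, J x -> I x.
Proof.
have [F FP Ftot|I [PI maxI]] := @Zorn_bigcup A (fun T => (exists x, T x) -> transversal T).
  move=> [x0 [X0 FX0 X0x0]].
  have tr X x : F X -> X x -> transversal X by move=> FX Xx; apply: (FP X FX); exists x.
  have id X x FX Xx := proj1 (tr X x FX Xx).
  split; last by move=> x [X FX Xx]; have [_] := tr X x FX Xx; apply.
  split.
  - split; first by exists X0 => //; apply: subsp0 (hid_subsp (id X0 x0 FX0 X0x0)).
    move=> a x y [X FX Xx] [Y FY Yy].
    have [XY|YX] := Ftot X Y FX FY.
      by exists Y => //; have [_ h] := hid_subsp (id Y y FY Yy); apply: h => //; apply: XY.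
    by exists X => //; have [_ h] := hid_subsp (id X x FX Xx); apply: h => //; apply: YX.
  - by move=> b x [X FX Xx]; exists X => //; apply: (hid_graded (id X x FX Xx)).
  - by move=> a x [X FX Xx]; exists X => //; apply: (hid_mull (id X x FX Xx)).
  - by move=> a x [X FX Xx]; exists X => //; apply: (hid_mulr (id X x FX Xx)).
  - by move=> x [X FX Xx]; apply: (hid_counit (id X x FX Xx)).
  - by move=> x [X FX Xx]; exists X => //; apply: (hid_antipode (id X x FX Xx)).
  move=> x [X FX Xx] f g hf hg f0 g0; apply: (hid_comul (id X x FX Xx)) => // y Xy.
    by apply: f0; exists X.
  by apply: g0; exists X.
have [x Ix] : exists x, I x.
  apply: contrapT => nI; apply: (maxI (fun x => x = 0)); last by move=> _; apply: transversal0.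
  split; first by move=> x Ix; case: nI; exists x.
  by move=> h; apply: nI; exists 0; apply: h.
exists I; first by apply: PI; exists x.
move=> J tJ IJ y Jy; apply: contrapT => nIy.
by apply: (maxI J) => //; split=> // JI; apply: nIy; apply: JI.
Qed.
End MaximalIdeal.

Section QuotientFiltration.
Variables (K : fieldType) (A B Q : hopfSAlgType K).
Variables (i : hopf_hom Q A) (pi : hopf_hom A B) (j : hopf_hom Q B).
Hypothesis jE : forall q, j q = pi (i q).

Lemma Fil_hopf n x : Fil (hopf_image i) n x -> Fil (hopf_image j) n (pi x).
Proof.
have hp := shom_lin (shom_hopf pi).
elim: n x => [|n IHn] x; first by move=> [q ->]; exists q; rewrite jE.
move=> Fx f hf f0; rewrite ract_hopf //.
have [|y Fy|q ->] := Fx (f \o pi); last by exists q; rewrite jE.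
  exact: lin_comp.
by apply: f0; apply: IHn.
Qed.
End QuotientFiltration.

(** A functional vanishing on the preimage vanishes on J, so it factors through the quotient, where
    the condition on Delta is known. *)
Lemma hopf_ideal_preim (K : fieldType) (A : hopfSAlgType K) (J : hideal A)
    (I : hquo J -> Prop) : hopf_ideal I -> hopf_ideal (fun x => I (hcl J x)).
Proof.
move=> [sI gI Il Ir I1 I2 I3]; have [hc ec c1 cM] := shom_hcl J; split.
- exact: subsp_preim.
- by move=> b x Ix; rewrite ec; apply: gI.
- by move=> a x Ix; rewrite cM; apply: Il.
- by move=> a x Ix; rewrite cM; apply: Ir.
- by move=> x /I1; rewrite -[hcl J x]/(hquo_hom J x) hopf_hom_counit.
- by move=> x /I2; rewrite -[hcl J x]/(hquo_hom J x) -hopf_antipode.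
move=> x Ix f g hf hg f0 g0.
have fac (k : A -> K^o) : linear k -> (forall y, I (hcl J y) -> k y = 0) ->
    exists k' : hquo J -> K^o, [/\ linear k', forall y, k' (hcl J y) = k y &
      forall a, I a -> k' a = 0].
  move=> hk k0; have k0' y : J y = 0 -> k y = 0.
    by move=> /hcl_eq0 e; apply: k0; rewrite e; apply: subsp0.
  have kE y : k (qval (hcl J y)) = k y by apply: lift_hcl.
  exists (fun a => k (qval a)); split=> // [c|].
    by elim/hquo_ind=> y; elim/hquo_ind=> z; rewrite -hc !kE hk.
  by elim/hquo_ind=> y Iy; rewrite kE; apply: k0.
have [f' [hf' fE f0']] := fac f hf f0; have [g' [hg' gE g0']] := fac g hg g0.
rewrite -gE -[RHS](I3 _ Ix f' g' hf' hg' f0' g0'); congr g'.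
rewrite -[hcl J x]/(hquo_hom J x) ract_hopf //; congr hcl.
by apply: tlift_eq => a b; rewrite /= [f' _]fE.
Qed.

Lemma exists_transversal (K : fieldType) (A Q : hopfSAlgType K) (i : hopf_hom Q A) :
  2%N \notin [pchar K] ->
  ([pchar K] =i pred0 /\ linearly_reductive Q) \/
  (GRing.closed_field_axiom K /\ diagonalizable_supergroup Q) ->
  injective i -> (forall x, Filu (hopf_image i) x) -> (exists x, ~ hopf_image i x) ->
  exists2 I, transversal (hopf_image i) I & exists x, I x /\ x <> 0.
Proof.
move=> ch2 cases inj exh nH; have hH := subhopf_image i.
have ci := exists_coinvmod hH exh nH.
suff [X [hX [x [Xx x0]] XH]] : exists X, [/\ cosub (hopf_image i) X,
    exists x, X x /\ x <> 0 & forall y, gen_ideal X y -> hopf_image i y -> y = 0].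
  exists (gen_ideal X); first by split=> //; apply: (hopf_ideal_gen hX).
  by exists x; split=> //; rewrite -[x]mul1r; apply: gen_ideal1.
case: cases => [[ch0 lr]|[closed [even diag]]].
  have [X [hX XH nX]] := linearly_reductive_cosub inj lr ci.
  by exists X; split=> // y; apply: (gen_ideal_contract ch0 hH exh hX XH).
have [hi ei _ _] := shom_hopf i.
apply: (diagonalizable_cosub ch2 closed hH) => // _ [q ->].
  have := hpart_sum q; rewrite even addr0 => eq.
  by rewrite /homogeneous -ei eq.
have [s [gs ->]] := diag q; exists [seq (u.1, i u.2) | u <- s]; split.
  move=> _ /mapP[u us ->] /=; split; last by exists u.2.
  have [du eu] := gs u us; split; last by rewrite hopf_hom_counit.
  by rewrite hopf_hom_comul du tmap_tens.
by rewrite (lin_sum hi) big_map; apply: eq_bigr => u _; rewrite (linZ hi).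
Qed.

Lemma split_exhausted (K : fieldType) (A Q : hopfSAlgType K) (i : hopf_hom Q A) :
  2%N \notin [pchar K] ->
  ([pchar K] =i pred0 /\ linearly_reductive Q) \/
  (GRing.closed_field_axiom K /\ diagonalizable_supergroup Q) ->
  injective i -> (forall x, Filu (hopf_image i) x) -> exists s : hopf_hom A Q, cancel i s.
Proof.
move=> ch2 cases inj exh; have hi := shom_lin (shom_hopf i).
have [I [hI IH] maxI] := maximal_transversal (hopf_image i).
have [J JE] := hideal_of hI.
have [j jE] := hopf_comp i (hquo_hom J); have hc := shom_lin (shom_hcl J).
have injj : injective j.
  move=> q r; rewrite !jE !hquo_homE => /eqP; rewrite -subr_eq0 -(linB hc) -(linB hi).
  move=> /eqP/hcl_eq0/JE/IH e; apply/inj/eqP; rewrite -subr_eq0 -(linB hi); apply/eqP.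
  by apply: e; exists (q - r).
have exhj a : Filu (hopf_image j) a.
  elim/hquo_ind: a => x; have [n Fx] := exh x.
  by exists n; apply: (Fil_hopf jE Fx).
have surj a : hopf_image j a.
  apply: contrapT => na.
  (* If the image were proper, A/I would have a nonzero transversal ideal, and its preimage in A
     would contradict the maximality of I. *)
  have [I' [hI' I'H] [b [I'b nb]]] := exists_transversal ch2 cases injj exhj (ex_intro _ a na).
  elim/hquo_ind: b I'b nb => x I'x nx; apply: nx; apply/hcl_eq0/JE.
  apply: (maxI (fun x => I' (hcl J x))) I'x => [|y Iy].
    split; first exact: hopf_ideal_preim.
    move=> y I'y [q yq]; apply: IH; last by exists q.
    apply/JE/hcl_eq0; apply: I'H => //; exists q.
    by rewrite jE yq.
  by rewrite (proj2 (hcl_eq0 J y)) //; [apply: subsp0 (hid_subsp hI')|apply/JE].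
have [s sK] := hopf_inverse injj surj.
have [t tE] := hopf_comp (hquo_hom J) s.
by exists t => q; rewrite tE -jE sK.
Qed.

Theorem proposition9p1 (K : fieldType) (G Gu Q : hopfSAlgType K)
  (p : hopf_hom G Gu) (i : hopf_hom Q G) :
  2%N \notin [pchar K] ->
  unipotent_radical p ->
  is_quotient p i ->
  ([pchar K] =i pred0 /\ linearly_reductive Q) \/
  ((GRing.closed_field_axiom K /\
    exists2 l : nat, l \in [pchar K] & (2 < l)%N) /\
   (purely_even Q /\ diagonalizable_supergroup Q)) ->
  exists s : hopf_hom G Q, cancel i s.

Proof.
move=> ch2 [_ _ uGu _] [inj kerp] cases.
apply: (split_exhausted ch2) => //.
  by case: cases => [|[[closed _] [_ diag]]]; [left|right].
(* By definition of the quotient, the kernel of p is H^+ A for H the image of i. *)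
apply: (unipotent_exhausts (subhopf_image i) uGu) => x /kerp[s [s0 ->]].
exists [seq (i u.1, u.2) | u <- s]; split; last by rewrite big_map.
move=> _ /mapP[u us ->] /=; split; first by exists u.1.
by rewrite hopf_hom_counit s0.
Qed.
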